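(* For each $w\in\widetilde W_{\mathrm{ea}}$ let $t_w$ be a spanning element of $(\mathcal{H}_2)_w$ (a space of dimension at most one). Let $w_1,w_2\in\widetilde W_{\mathrm{ea}}$. If $\tilde\ell(w_1w_2)=\tilde\ell(w_1)+\tilde\ell(w_2)$, then in $\mathcal{H}_2$ \[ t_{w_1}*t_{w_2}=C(w_1,w_2)\,t_{w_1w_2} \] for some $C(w_1,w_2)\in\mathbb{C}$. Furthermore, if $t_{w_1}$ is invertible and $t_{w_2}\neq0$, then $C(w_1,w_2)\in\mathbb{C}^\times$.
   Context: $F$ is a finite extension of $\mathbb{Q}_2$ with ring of integers $\mathcal{O}$, uniformizer $\varpi$, ramification index $e$ ($2\mathcal{O}=\varpi^e\mathcal{O}$). $(-,-)$ is the quadratic Hilbert symbol of $F$. $G$ is the group of $F$-points of an almost simple simply-connected split (Chevalley) group with irreducible simply-laced root system $\Phi$ (relative to a split maximal torus $T$) of rank at least $2$. $\Delta=\{\alpha_1,\dots,\alpha_r\}$ is a set of simple roots, $\Phi^\pm$ the positive/negative roots, $\alpha_0$ the lowest root, $W$ the Weyl group, $Y=\mathbb{Z}[\Phi^\vee]$ the cocharacter lattice. $x_\alpha(t)$ are the Chevalley generators, $w_\alpha(t)=x_\alpha(t)x_{-\alpha}(-t^{-1})x_\alpha(t)$, $h_\alpha(t)=w_\alpha(t)w_\alpha(-1)$. $\widetilde{G}$ is the unique nontrivial topological central extension $1\to\mu_2\to\widetilde{G}\xrightarrow{\mathrm{pr}}G\to1$; it is generated by $\mu_2$ and lifts $\tilde{x}_\alpha(t)$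 of $x_\alpha(t)$ with relations $\tilde x_\alpha(t)\tilde x_\alpha(u)=\tilde x_\alpha(t+u)$; for $\alpha+\beta\ne0$, $[\tilde x_\alpha(t),\tilde x_\beta(u)]=\tilde x_{\alpha+\beta}(ctu)$ if $\alpha+\beta\in\Phi$ (with $c=c(\alpha,\beta)\in\{\pm1\}$ as in $G$) and $1$ otherwise; $\tilde h_\alpha(t)\tilde h_\alpha(u)=(t,u)\tilde h_\alpha(tu)$, where $\tilde w_\alpha(t)=\tilde x_\alpha(t)\tilde x_{-\alpha}(-t^{-1})\tilde x_\alpha(t)$, $\tilde h_\alpha(t)=\tilde w_\alpha(t)\tilde w_\alpha(-1)$. For $H\subseteq G$, $\widetilde{H}=\mathrm{pr}^{-1}(H)$. A representation is genuine if $-1\in\mu_2$ acts by $-1$. Subgroups: $T_0=\langle h_\alpha(u):u\in\mathcal{O}^\times,\alpha\in\Phi\rangle$; $T_k=\langle h_\alpha(u):u\in1+\varpi^k\mathcal{O},\alpha\in\Phi\rangle$ for $k\ge1$; $U_j^\pm=\langle x_\alpha(t):\alpha\in\Phi^\pm,t\in\varpi^j\mathcal{O}\rangle$, $U_j=U_j^+$, viewed in $\widetilde G$ via $x_\alpha(t)\mapsto\tilde x_\alpha(t)$; $K=\langle x_\alpha(t):\alpha\in\Phi,t\in\mathcal{O}\rangle$; $\Gamma(k)=\langle T_k,\,x_\alpha(t):\alpha\in\Phi,t\in\varpi^k\mathcal{O}\rangle$; $I_2=\langle U_0,T_0,U_2^-\rangle$. Splitting of $\Gamma(2e)$: each element of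 $\Gamma(2e)$ is uniquely $u^-tu^+$ with $u^\pm\in U^\pm_{2e}$, $t=\prod_i h_{\alpha_i}(a_i)\in T_{2e}$; the map $\mathbf{s}$ lifting $u^\pm$ by $x_\alpha(\cdot)\mapsto\tilde x_\alpha(\cdot)$ and $t$ to $\prod_i\tilde h_{\alpha_i}(a_i)$ is a homomorphism $\Gamma(2e)\to\widetilde G$ with image normal in $\widetilde{K}$. Sans-serif letters denote images in the finite group $\widetilde{\mathsf{K}}=\widetilde K/\mathbf{s}(\Gamma(2e))$. $R=\{a\in\mathcal{O}^\times:(a,b)=1\ \forall b\in\mathcal{O}^\times\}$, $T_R=\langle h_\alpha(a):a\in R,\alpha\in\Phi\rangle$, regarded as a subgroup of $\widetilde{T}_0$ via $\prod_i h_{\alpha_i}(a_i)\mapsto\prod_i\tilde h_{\alpha_i}(a_i)$. $\tau$ is a pseudo-spherical representation of $\widetilde{T}_0$, i.e. an irreducible genuine representation trivial on $T_R$; it factors through $\widetilde{\mathsf{T}}_0$ because $T_{2e}\subseteq T_R$. Parahoric induction: if $A$ is a finite group with subgroups $P,L,Q$ such that $L$ normalizes $P$ and $Q$ and multiplication $P\times L\times Q\to A$ is bijective, then $i_{P,Q}^A\tau=\mathbb{C}[A]e_Pe_Q\otimes_{\mathbb{C}[L]}\tau$ for a representation $\tau$ of $L$, where $e_P=|P|^{-1}\sum_{p\in P}p$, etc. Define $\sigma_2=i^{\widetilde{\mathsf I}_2}_{\mathsf U_0,\mathsf U_2^-}\tau$, inflated to $\widetilde I_2$. $\mathcal{H}_2=\mathcal{H}(\widetilde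 G,\widetilde I_2;\sigma_2)$ is the algebra under convolution $*$ (Haar measure giving $\widetilde I_2$ volume $1$) of $f\in C_c^\infty(\widetilde G,\mathrm{End}_{\mathbb{C}}(\sigma_2^\vee))$ with $f(k_1gk_2)=\sigma_2^\vee(k_1)f(g)\sigma_2^\vee(k_2)$ for $k_1,k_2\in\widetilde I_2$. Affine Weyl groups: $N_G(T)/T_0\cong W\ltimes Y$ acts on $Y\otimes\mathbb{R}$ by affine maps, $w_\alpha(1)$ acting by $v\mapsto v-\langle\alpha,v\rangle\alpha^\vee$ and $y(\varpi)$ ($y\in Y$) by translation by $-y$. $\widetilde Y=\{y\in Y:\langle\alpha,y\rangle\in2\mathbb{Z}\ \forall\alpha\in\Phi\}$; $\widetilde W_{\mathrm{ea}}=W\ltimes\widetilde Y$; $\widetilde W_{\mathrm{af}}=W\ltimes2Y$, a Coxeter group with generators the reflections $w_{\alpha}$ ($\alpha\in\Delta$) and $w_{\mathrm{af}}$, the reflection in $\{v:\langle\alpha_0,v\rangle=-2\}$ (represented by $w_{\alpha_0}(\varpi^2)$). $\widetilde\Omega\subset\widetilde W_{\mathrm{ea}}$ is the stabilizer of the alcove $\{v:\langle\alpha,v\rangle>0\ (\alpha\in\Delta),\ \langle\alpha_0,v\rangle>-2\}$; $\widetilde W_{\mathrm{ea}}=\widetilde\Omega\ltimes\widetilde W_{\mathrm{af}}$ and the length is $\tilde\ell(\varepsilon w)=\tilde\ell(w)$ for $\varepsilon\in\widetilde\Omega$, $w\in\widetilde W_{\mathrm{af}}$, with $\tilde\ell$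 the Coxeter length on $\widetilde W_{\mathrm{af}}$. For $w\in\widetilde W_{\mathrm{ea}}$, $(\mathcal{H}_2)_w$ is the subspace of functions vanishing outside $\widetilde I_2n\widetilde I_2$, where $n\in N_{\widetilde G}(\widetilde T)$ is any element representing $w$. *)

(* Defs.v *)
From HB Require Import structures.
From mathcomp Require Import all_boot all_order all_algebra all_fingroup all_field.
From mathcomp Require Import boolp classical_sets reals complex.

Set Implicit Arguments.
Unset Strict Implicit.
Unset Printing Implicit Defensive.

Import Order.TTheory GRing.Theory Num.Theory.

Local Open Scope classical_set_scope.
Local Open Scope ring_scope.

Definition abs2_rat (q : rat) : rat :=
  if q == 0 then 0
  else 2%:R ^+ logn 2 `|denq q|%N / 2%:R ^+ logn 2 `|numq q|%N.

(* Q_2 is characterised as a completion of Q for the 2-adic absolute value;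
   the absolute value takes rational values. *)
Record is_Q2 (K : fieldType) (abs : K -> rat) : Prop := IsQ2 {
  Q2_eq0 : forall x, abs x = 0 <-> x = 0;
  Q2_mul : forall x y, abs (x * y) = abs x * abs y;
  Q2_ultra : forall x y, abs (x + y) <= Num.max (abs x) (abs y);
  Q2_rat : forall q : rat, abs (ratr q) = abs2_rat q;
  Q2_dense : forall x eps, 0 < eps -> exists q : rat, abs (x - ratr q) < eps;
  Q2_complete : forall u : nat -> K,
    (forall eps, 0 < eps -> exists N, forall m n,
       (N <= m)%N -> (N <= n)%N -> abs (u m - u n) < eps) ->
    exists l, forall eps, 0 < eps -> exists N, forall n,
       (N <= n)%N -> abs (u n - l) < eps }.

(* The ring of integers is the integral closure of Z_2 in F. *)
Definition integers (K : fieldType) (abs : K -> rat) (F : fieldExtType K) :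
    set F :=
  [set x | exists2 p : {poly K},
     p \is monic /\ (forall i, abs p`_i <= 1) & root (map_poly (in_alg F) p) x].

Definition int_units (K : fieldType) (abs : K -> rat) (F : fieldExtType K) :
    set F :=
  [set x | [/\ x != 0, integers abs x & integers abs x^-1]].

Record dyadic_field := DyadicField {
  dy_Q2 : fieldType;
  dy_abs : dy_Q2 -> rat;
  dy_Q2P : is_Q2 dy_abs;
  dy_F :> fieldExtType dy_Q2;
  dy_unif : dy_F;
  dy_ram : nat;
  dy_unifP : dy_unif != 0 /\
    forall x : dy_F, (integers dy_abs x /\ ~ int_units dy_abs x) <->
      exists2 y, integers dy_abs y & x = dy_unif * y;
  dy_ramP : forall x : dy_F,
    (exists2 y, integers dy_abs y & x = 2%:R * y) <->
    (exists2 y, integers dy_abs y & x = dy_unif ^+ dy_ram * y) }.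

Section DyadicField.
Variable F : dyadic_field.

Definition O_F : set F := integers (@dy_abs F) (F := F).
Definition O_units : set F := int_units (@dy_abs F) (F := F).

Definition O_ideal (k : nat) : set F :=
  [set x | exists2 y, O_F y & x = dy_unif F ^+ k * y].

(* [unit_filtration 0] is the full unit group, and [unit_filtration k] is
   1 + (uniformizer)^k O for k > 0. *)
Definition unit_filtration (k : nat) : set F :=
  if k is 0 then O_units else [set u | O_ideal k (u - 1)].

(* (a, b) = 1 for the quadratic Hilbert symbol; a and b are meant nonzero. *)
Definition hilbert_trivial (a b : F) : Prop :=
  exists x y z : F,
    (x, y, z) != (0, 0, 0) /\ z ^+ 2 = a * x ^+ 2 + b * y ^+ 2.

Definition hilbert_radical : set F :=
  [set a | O_units a /\ forall b, O_units b -> hilbert_trivial a b].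

End DyadicField.

Definition dot (R : realType) (n : nat) (u v : 'rV[R]_n) : R :=
  \sum_i u 0 i * v 0 i.

Definition coroot (R : realType) (n : nat) (a : 'rV[R]_n) : 'rV[R]_n :=
  (2%:R / dot a a) *: a.

(* Roots are linear forms on R^n through [dot]. *)
Definition reflection (R : realType) (n : nat) (a v : 'rV[R]_n) : 'rV[R]_n :=
  v - dot a v *: coroot a.

Definition nat_span (R : realType) (n : nat) (D : 'I_n -> 'rV[R]_n) :
    set 'rV[R]_n :=
  [set v | exists m : 'I_n -> nat, v = \sum_i D i *+ m i].

Record root_system (R : realType) := RootSystem {
  rk : nat;
  roots : seq 'rV[R]_rk;
  simple : 'I_rk -> 'rV[R]_rk;
  lowest : 'rV[R]_rk;
  rk_ge2 : (2 <= rk)%N;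
  roots_uniq : uniq roots;
  roots_neq0 : 0 \notin roots;
  roots_span : forall v, exists c : 'rV[R]_rk -> R,
    v = \sum_(a <- roots) c a *: a;
  roots_refl : forall a b, a \in roots -> b \in roots ->
    reflection a b \in roots;
  roots_int : forall a b, a \in roots -> b \in roots ->
    dot a (coroot b) \is a Num.int;
  roots_reduced : forall a c, a \in roots -> c *: a \in roots ->
    c = 1 \/ c = -1;
  roots_irreducible : forall S : pred 'rV[R]_rk,
    (exists2 a, a \in roots & S a) ->
    (forall a b, a \in roots -> b \in roots -> S a -> ~~ S b -> dot a b = 0) ->
    forall a, a \in roots -> S a;
  roots_simply_laced : forall a b, a \in roots -> b \in roots ->
    dot a a = dot b b;
  simple_root : forall i, simple i \in roots;
  simple_free : \matrix_i simple i \in unitmx;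
  simple_base : forall a, a \in roots ->
    nat_span simple a \/ nat_span simple (- a);
  lowest_root : lowest \in roots;
  lowestP : forall a, a \in roots -> nat_span simple (a - lowest) }.

Section RootSystem.
Variables (R : realType) (Phi : root_system R).
Local Notation E := 'rV[R]_(rk Phi).

Definition pos_roots : set E :=
  [set a | a \in roots Phi /\ nat_span (@simple R Phi) a].
Definition neg_roots : set E := [set a | pos_roots (- a)].

Definition coroot_lattice : set E :=
  [set y | exists n : E -> int, y = \sum_(a <- roots Phi) coroot a *~ n a].

Definition even_lattice : set E :=
  [set y | coroot_lattice y /\
     forall a, a \in roots Phi -> exists k : int, dot a y = (2 * k)%:~R].

Definition twice_lattice : set E :=
  [set y | exists2 z, coroot_lattice z & y = z *+ 2].

Inductive weyl : set (E -> E) :=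
| weyl_id : weyl id
| weyl_refl a w : a \in roots Phi -> weyl w -> weyl (reflection a \o w).

Definition weyl_semidirect (L : set E) : set (E -> E) :=
  [set f | exists w y, [/\ weyl w, L y & f = fun v => w v + y]].

Definition W_ea : set (E -> E) := weyl_semidirect even_lattice.
Definition W_af : set (E -> E) := weyl_semidirect twice_lattice.

(* the reflection in the hyperplane { v | <lowest, v> = -2 } *)
Definition w_af (v : E) : E :=
  reflection (lowest Phi) v - coroot (lowest Phi) *+ 2.

Definition alcove : set E :=
  [set v | (forall i, 0 < dot (simple i) v) /\ - 2%:R < dot (lowest Phi) v].

Definition Omega : set (E -> E) := [set w | W_ea w /\ w @` alcove = alcove].

Definition coxeter_gen (s : option 'I_(rk Phi)) : E -> E :=
  if s is Some i then reflection (simple i) else w_af.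

Definition word_value (s : seq (option 'I_(rk Phi))) : E -> E :=
  foldr (fun i f => coxeter_gen i \o f) id s.

Definition coxeter_length (w : E -> E) (k : nat) : Prop :=
  (exists2 s, size s = k & word_value s = w) /\
  (forall s, word_value s = w -> (k <= size s)%N).

Definition length_ea (w : E -> E) (k : nat) : Prop :=
  exists eps u, [/\ Omega eps, W_af u, w = eps \o u & coxeter_length u k].

End RootSystem.

Definition bracket (n : nat) (A B : 'M[int]_n) : 'M[int]_n :=
  A *m B - B *m A.

(* The division is exact where this is used, see [chev_admissible]. *)
Definition divided_power (n : nat) (A : 'M[int]_n) (k : nat) : 'M[int]_n :=
  map_mx (fun z => (z %/ (k`!)%:Z)%Z) (A ^+ k).

Definition root_exp (F : fieldType) (n : nat) (A : 'M[int]_n) (t : F) :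
    'M[F]_n :=
  \sum_(k < n) t ^+ k *: map_mx intr (divided_power A k).

Definition is_weight (n r : nat) (H : 'I_r -> 'M[int]_n) (l : 'I_r -> int) :
    Prop :=
  exists2 v : 'cV[int]_n, v != 0 & forall i, H i *m v = l i *: v.

(* Chevalley's construction: root vectors [root_vec a] of the simple Lie
   algebra of type Phi, normalised as in a Chevalley basis, act on a
   representation preserving an admissible lattice Z^n.  The group is generated
   by the exponentials of the root vectors, and the condition that the weights
   of the representation generate the whole weight lattice Hom(Y, Z) makes it
   the simply-connected one. *)
Record chevalley_group (R : realType) (Phi : root_system R) (F : fieldType) :=
  ChevalleyGroup {
  chev_dim : nat;
  root_vec : 'rV[R]_(rk Phi) -> 'M[int]_chev_dim;
  chev_c : 'rV[R]_(rk Phi) -> 'rV[R]_(rk Phi) -> int;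
  chev_c_sign : forall a b, a \in roots Phi -> b \in roots Phi ->
    a + b \in roots Phi -> chev_c a b = 1 \/ chev_c a b = -1;
  chev_bracket_root : forall a b, a \in roots Phi -> b \in roots Phi ->
    a + b \in roots Phi ->
    bracket (root_vec a) (root_vec b) = chev_c a b *: root_vec (a + b);
  chev_bracket0 : forall a b, a \in roots Phi -> b \in roots Phi ->
    a + b \notin roots Phi -> a + b != 0 ->
    bracket (root_vec a) (root_vec b) = 0;
  chev_bracket_cartan : forall a b (m : int),
    a \in roots Phi -> b \in roots Phi -> m%:~R = dot b (coroot a) ->
    bracket (bracket (root_vec a) (root_vec (- a))) (root_vec b)
      = m *: root_vec b;
  chev_nilpotent : forall a, a \in roots Phi -> root_vec a ^+ chev_dim = 0;
  chev_admissible : forall a k i j, a \in roots Phi ->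
    ((k`!)%:Z %| (root_vec a ^+ k) i j)%Z;
  chev_simply_connected : forall mu : 'I_(rk Phi) -> int,
    exists (k : nat) (c : 'I_k -> int) (l : 'I_k -> 'I_(rk Phi) -> int),
      (forall j, is_weight (fun i : 'I_(rk Phi) =>
           bracket (root_vec (simple i)) (root_vec (- simple i))) (l j)) /\
      (forall i, mu i = \sum_j c j * l j i);
  chev_G :> groupType;
  chev_mx : chev_G -> 'M[F]_chev_dim;
  chev_x : 'rV[R]_(rk Phi) -> F -> chev_G;
  chev_mx_inj : injective chev_mx;
  chev_mx1 : chev_mx 1%g = 1%:M;
  chev_mxM : forall g h, chev_mx (g * h)%g = chev_mx g *m chev_mx h;
  chev_xE : forall a t, a \in roots Phi ->
    chev_mx (chev_x a t) = root_exp (root_vec a) t;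
  chev_generated : forall g : chev_G,
    exists s : seq ('rV[R]_(rk Phi) * F),
      (forall x, x \in s -> x.1 \in roots Phi) /\
      g = (\prod_(x <- s) chev_x x.1 x.2)%g }.

Section Subgroups.
Variable H : groupType.

Definition is_subgroup (S : set H) : Prop :=
  [/\ S 1%g, forall g h, S g -> S h -> S (g * h)%g
    & forall g, S g -> S (g^-1)%g].

Definition generated (S : set H) : set H :=
  [set g | forall K, is_subgroup K -> S `<=` K -> K g].

Definition normalizer (S : set H) : set H :=
  [set n | forall g, S g <-> S (n * g * n^-1)%g].

End Subgroups.

Section WH.
Variables (R : realType) (n : nat) (F : fieldType) (H : groupType).
Variable x : 'rV[R]_n -> F -> H.

Definition w_elt (a : 'rV[R]_n) (t : F) : H :=
  (x a t * x (- a)%R (- t^-1)%R * x a t)%g.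
Definition h_elt (a : 'rV[R]_n) (t : F) : H :=
  (w_elt a t * w_elt a (- 1)%R)%g.

End WH.

(* [cov_hilbert], with the nontrivial Hilbert symbol as cocycle, singles out the
   nontrivial extension. *)
Record double_cover (R : realType) (F : dyadic_field) (Phi : root_system R)
    (G : chevalley_group Phi F) := DoubleCover {
  cov_G :> groupType;
  cov_pr : cov_G -> G;
  cov_eps : cov_G;
  cov_x : 'rV[R]_(rk Phi) -> F -> cov_G;
  cov_prM : forall g h, cov_pr (g * h)%g = (cov_pr g * cov_pr h)%g;
  cov_pr_surj : forall g, exists h, cov_pr h = g;
  cov_ker : forall g, cov_pr g = 1%g <-> (g = 1%g \/ g = cov_eps);
  cov_eps_neq1 : cov_eps <> 1%g;
  cov_eps_sq : (cov_eps * cov_eps)%g = 1%g;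
  cov_eps_central : forall g, (cov_eps * g)%g = (g * cov_eps)%g;
  cov_pr_x : forall a t, a \in roots Phi -> cov_pr (cov_x a t) = chev_x G a t;
  cov_xD : forall a t u, a \in roots Phi ->
    (cov_x a t * cov_x a u)%g = cov_x a (t + u);
  cov_comm_root : forall a b t u, a \in roots Phi -> b \in roots Phi ->
    a + b \in roots Phi ->
    [~ cov_x a t, cov_x b u]%g = cov_x (a + b) ((chev_c G a b)%:~R * t * u);
  cov_comm1 : forall a b t u, a \in roots Phi -> b \in roots Phi ->
    a + b != 0 -> a + b \notin roots Phi ->
    [~ cov_x a t, cov_x b u]%g = 1%g;
  cov_hilbert : forall a t u, a \in roots Phi -> t != 0 -> u != 0 ->
    (h_elt cov_x a t * h_elt cov_x a u)%g =
    ((if `[< hilbert_trivial t u >] then 1 else cov_eps)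
       * h_elt cov_x a (t * u)%R)%g }.

Section Cover.
Variables (R : realType) (F : dyadic_field) (Phi : root_system R).
Variables (G : chevalley_group Phi F) (Gt : double_cover G).
Local Notation E := 'rV[R]_(rk Phi).

Definition torus : set G :=
  generated [set g | exists a t, [/\ a \in roots Phi, t != 0
                       & g = h_elt (chev_x G) a t]].

Definition T_ (k : nat) : set G :=
  generated [set g | exists a u, [/\ a \in roots Phi, unit_filtration k u
                       & g = h_elt (chev_x G) a u]].

Definition root_gens (H : groupType) (x : E -> F -> H) (A : set E) (k : nat) :
    set H :=
  [set g | exists a t, [/\ A a, O_ideal k t & g = x a t]].

Definition U_pos (k : nat) : set G :=
  generated (root_gens (chev_x G) (@pos_roots R Phi) k).
Definition U_neg (k : nat) : set G :=
  generated (root_gens (chev_x G) (@neg_roots R Phi) k).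

Definition K_ : set G :=
  generated (root_gens (chev_x G) [set a | a \in roots Phi] 0).

Definition I_2 : set G := generated (U_pos 0 `|` T_ 0 `|` U_neg 2).

Definition tilde (S : set G) : set Gt := [set g | S (cov_pr g)].

Definition Ut_pos (k : nat) : set Gt :=
  generated (root_gens (@cov_x _ _ _ _ Gt) (@pos_roots R Phi) k).
Definition Ut_neg (k : nat) : set Gt :=
  generated (root_gens (@cov_x _ _ _ _ Gt) (@neg_roots R Phi) k).

Definition torus_lift (A : set F) : set Gt :=
  [set g | exists2 a : 'I_(rk Phi) -> F, (forall i, A (a i))
     & g = (\prod_i h_elt (@cov_x _ _ _ _ Gt) (simple i) (a i))%g].

(* The subgroup T_R of the cover: on the radical of the Hilbert symbol the
   standard lift is multiplicative. *)
Definition T_R : set Gt := torus_lift (hilbert_radical (F := F)).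

(* The image s(Gamma(m)) of the splitting, for m >= 2e: every element of
   Gamma(m) is u^- t u^+ and each factor is lifted in the standard way. *)
Definition sGamma (m : nat) : set Gt :=
  [set g | exists u t v, [/\ Ut_neg m u, torus_lift (unit_filtration m) t,
                             Ut_pos m v & g = (u * t * v)%g]].

Definition ram2 : nat := (2 * dy_ram F)%N.

(* The topology of the cover: the cosets of s(Gamma(m)), m >= 2e, form a
   basis. *)
Definition cover_open (U : set Gt) : Prop :=
  forall g, U g -> exists2 m, (ram2 <= m)%N & forall k, sGamma m k -> U (g * k)%g.

Definition cover_compact (S : set Gt) : Prop :=
  forall (J : choiceType) (U : J -> set Gt),
    (forall j, cover_open (U j)) -> S `<=` \bigcup_j U j ->
    exists s : seq J, S `<=` [set g | exists2 j, j \in s & U j g].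

Definition Cc_smooth (V : zmodType) (f : Gt -> V) : Prop :=
  (forall g, exists2 U, cover_open U /\ U g & forall h, U h -> f h = f g) /\
  (exists2 S, cover_compact S & forall g, ~ S g -> f g = 0).

Local Notation C := (complex R).

(* The Haar measure giving I_2~ volume 1, as the integration functional on
   C_c^oo functions; values of [I] elsewhere are irrelevant. *)
Record is_haar (I : (Gt -> C) -> C) : Prop := IsHaar {
  haar_linear : forall a f g, Cc_smooth f -> Cc_smooth g ->
    I (fun h => a * f h + g h) = a * I f + I g;
  haar_invariant : forall x f, Cc_smooth f -> I (fun h => f (x * h)%g) = I f;
  haar_pos : forall f, Cc_smooth f -> (forall h, 0 <= f h) -> 0 <= I f;
  haar_vol : I (fun h => if `[< tilde I_2 h >] then 1 else 0) = 1 }.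

Definition vint (I : (Gt -> C) -> C) (V : vectType C) (f : Gt -> V) : V :=
  \sum_(i < \dim {:V}) I (fun h => coord (vbasis {:V}) i (f h))
     *: (vbasis {:V})`_i.

Record is_affine_action (act : G -> E -> E) : Prop := IsAffineAction {
  actM : forall g h, normalizer torus g -> normalizer torus h ->
    act (g * h)%g = act g \o act h;
  act_T0 : forall t, T_ 0 t -> act t = id;
  act_w : forall a, a \in roots Phi ->
    act (w_elt (chev_x G) a 1) = reflection a;
  act_h : forall a, a \in roots Phi ->
    act (h_elt (chev_x G) a (dy_unif F)) = fun v => v - coroot a }.

Definition represents (act : G -> E -> E) (n : Gt) (w : E -> E) : Prop :=
  normalizer (tilde torus) n /\ act (cov_pr n) = w.

(* [rho] is only meaningful on the subgroup [S]. *)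
Definition is_rep (V : vectType C) (S : set Gt) (rho : Gt -> 'End(V)) : Prop :=
  rho 1%g = \1%VF /\
  forall g h, S g -> S h -> rho (g * h)%g = (rho g \o rho h)%VF.

Definition is_irreducible (V : vectType C) (S : set Gt) (rho : Gt -> 'End(V)) :
    Prop :=
  fullv <> 0%VS :> {vspace V} /\
  forall U : {vspace V}, (forall g, S g -> (rho g @: U <= U)%VS) ->
    U = 0%VS \/ U = fullv.

Record pseudo_spherical (V : vectType C) (tau : Gt -> 'End(V)) : Prop :=
  PseudoSpherical {
  ps_rep : is_rep (tilde (T_ 0)) tau;
  ps_irr : is_irreducible (tilde (T_ 0)) tau;
  ps_genuine : tau (cov_eps Gt) = - \1%VF;
  ps_TR : forall g, T_R g -> tau g = \1%VF }.

End Cover.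

Section Parahoric.
Variables (R : realType) (gT : finGroupType).
Local Notation C := (complex R).
Local Notation CG := {ffun gT -> C}.

Definition galg_mul (a b : CG) : CG :=
  [ffun x => \sum_(y : gT) a y * b (y^-1 * x)%g].
Definition galg_delta (g : gT) : CG := [ffun x => (x == g)%:R].
Definition galg_idem (P : {set gT}) : CG :=
  [ffun x => if x \in P then (#|P|%:R)^-1 else 0].

(* the left ideal C[A] e_P e_Q of the group algebra of A *)
Definition parahoric_ideal (A P Q : {set gT}) : set CG :=
  [set a | exists2 b : CG, (forall x, x \notin A -> b x = 0)
     & a = galg_mul (galg_mul b (galg_idem P)) (galg_idem Q)].

Definition balanced (M : set CG) (L : {set gT}) (V : vectType C)
    (tau : gT -> 'End(V)) (W : lmodType C) (th : CG -> V -> W) : Prop :=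
  [/\ forall c a b v, M a -> M b -> th (c *: a + b) v = c *: th a v + th b v,
      forall c a u v, M a -> th a (c *: u + v) = c *: th a u + th a v
    & forall a l v, M a -> l \in L ->
        th (galg_mul a (galg_delta l)) v = th a (tau l v)].

(* [rho], on the space S, is i_{P,Q}^A tau = C[A] e_P e_Q (x)_{C[L]} tau: the
   tensor product is described by its universal property, and A acts by left
   multiplication on the first factor. *)
Definition is_parahoric_induction (A P L Q : {set gT})
    (V : vectType C) (tau : gT -> 'End(V))
    (S : vectType C) (rho : gT -> 'End(S)) : Prop :=
  let M := parahoric_ideal A P Q in
  exists th : CG -> V -> S,
  [/\ balanced M L tau th,
      forall (W : lmodType C) (b : CG -> V -> W), balanced M L tau b ->
        exists! f : S -> W, linear f /\
          forall a v, M a -> f (th a v) = b a v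
    & forall g a v, g \in A -> M a ->
        rho g (th a v) = th (galg_mul (galg_delta g) a) v].

End Parahoric.

Section Hecke.
Variables (R : realType) (F : dyadic_field) (Phi : root_system R).
Variables (G : chevalley_group Phi F) (Gt : double_cover G).
Local Notation E := 'rV[R]_(rk Phi).
Local Notation C := (complex R).

(* [q] realizes [gT] as the finite group K~ / s(Gamma(2e)). *)
Record is_finite_quotient (gT : finGroupType) (q : Gt -> gT) : Prop :=
  IsFiniteQuotient {
  fq_M : forall g h, tilde (@K_ _ _ _ G) g -> tilde (@K_ _ _ _ G) h ->
    q (g * h)%g = (q g * q h)%g;
  fq_surj : forall a, exists2 g, tilde (@K_ _ _ _ G) g & q g = a;
  fq_ker : forall g, tilde (@K_ _ _ _ G) g ->
    (q g = 1%g <-> sGamma (ram2 F) g) }.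

Definition image_set (gT : finGroupType) (q : Gt -> gT) (S : set Gt) :
    {set gT} :=
  finset (fun a => `[< exists2 g, S g & q g = a >]).

(* [sigma] is the inflation to I_2~ of the parahoric induction of [tau],
   which factors through [q]. *)
Definition is_sigma2 (gT : finGroupType) (q : Gt -> gT)
    (V : vectType C) (tau : Gt -> 'End(V))
    (S : vectType C) (sigma : Gt -> 'End(S)) : Prop :=
  exists (tauf : gT -> 'End(V)) (rho : gT -> 'End(S)),
  [/\ forall g, tilde (@T_ _ _ _ G 0) g -> tauf (q g) = tau g,
      is_parahoric_induction
        (image_set q (tilde (@I_2 _ _ _ G)))
        (image_set q (@Ut_pos _ _ _ _ Gt 0))
        (image_set q (tilde (@T_ _ _ _ G 0)))
        (image_set q (@Ut_neg _ _ _ _ Gt 2))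
        tauf rho
    & forall g, tilde (@I_2 _ _ _ G) g -> sigma g = rho (q g)].

Definition dual (S : vectType C) : vectType C := 'Hom(S, C^o).

Definition contragredient (S : vectType C) (sigma : Gt -> 'End(S)) (g : Gt) :
    'End(dual S) :=
  linfun (fun l : dual S => (l \o sigma (g^-1)%g)%VF : dual S).

Section HeckeAlgebra.
Variables (S : vectType C) (sigma : Gt -> 'End(S)).
Variable I : (Gt -> C) -> C.
Local Notation I2 := (@tilde _ _ _ _ Gt (@I_2 _ _ _ G)).
Local Notation sv := (contragredient sigma).

Definition hecke : set (Gt -> 'End(dual S)) :=
  [set f | Cc_smooth f /\
     forall k1 g k2, I2 k1 -> I2 k2 ->
       f (k1 * g * k2)%g = (sv k1 \o f g \o sv k2)%VF].

Definition convolution (f1 f2 : Gt -> 'End(dual S)) : Gt -> 'End(dual S) :=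
  fun g => vint I (fun h => (f1 h \o f2 (h^-1 * g)%g)%VF).

Definition hecke_unit (f : Gt -> 'End(dual S)) : Prop :=
  hecke f /\
  forall f', hecke f' -> convolution f f' = f' /\ convolution f' f = f'.

Definition hecke_invertible (f : Gt -> 'End(dual S)) : Prop :=
  hecke f /\
  exists one f', [/\ hecke_unit one, hecke f', convolution f f' = one
                   & convolution f' f = one].

(* the subspace (H_2)_w of functions supported on I_2~ n I_2~, n representing
   w *)
Definition hecke_supp (act : G -> E -> E) (w : E -> E) :
    set (Gt -> 'End(dual S)) :=
  [set f | hecke f /\
     exists2 n, represents act n w
     & forall g, ~ (exists k1 k2, [/\ I2 k1, I2 k2 & g = (k1 * n * k2)%g]) ->
         f g = 0].

Definition spans_hecke_supp (act : G -> E -> E) (w : E -> E)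
    (f : Gt -> 'End(dual S)) : Prop :=
  hecke_supp act w f /\
  forall f', hecke_supp act w f' -> exists c : C, f' = fun g => c *: f g.

End HeckeAlgebra.
End Hecke.

(* Main.v *)
Require Import Defs.
From HB Require Import structures.
From mathcomp Require Import all_boot all_order all_algebra all_fingroup all_field.
From mathcomp Require Import boolp classical_sets reals complex.
From mathcomp Require Import ring lra zify.

Set Implicit Arguments.
Unset Strict Implicit.
Unset Printing Implicit Defensive.

Import Order.TTheory GRing.Theory Num.Theory.
Local Open Scope ring_scope.

(* [I_2] plays the role of an Iwahori subgroup for the even affine roots
   a + 2m, whose reflections generate W_af.  Let U be the subgroup of the simple
   affine root a_s.  Then I_2 = U T_0 J, where J is generated by the subgroups of
   the other positive even affine roots and the torus elements congruent to 1
   modulo the square of the uniformizer, and conjugation by a representative n_s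
   of s maps J into I_2.  Hence n I_2 n_s is contained in I_2 n n_s I_2 as soon as
   n maps a_s to a positive affine root.  When the lengths add up this applies to
   every letter of a reduced word of w_2, so that I_2 n_1 I_2 n_2 I_2 = I_2 n_1 n_2 I_2:
   the convolution is supported on the double coset of w_1 w_2 and is therefore
   a multiple of t_{w_1 w_2}.  If the multiple vanishes and t_{w_1} is invertible,
   associativity gives t_{w_2} = 0.

   An arbitrary representative n in N(T) is controlled through its adjoint
   action: it permutes the root lines, and comparing the affine actions of
   w_a(t) and n w_a(t) n^-1 for t = 1 and for t the uniformizer shows that it
   permutes the affine roots as act n does.  Hecke functions are invariant under the
   image of Gamma(2e), which makes all the integrals finite sums. *)

(** * Integers of a dyadic field *)

Section TwoAdicIntegers.
Variables (K : fieldType) (abs : K -> rat) (hK : is_Q2 abs).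

(** The torus part of J is fixed by two opposite constraints. Moving x_a(t) past x_{-a}(y) creates
    the torus element h_a(1 + ty), and for positive even affine roots the product ty is divisible by
    the square of the uniformizer, so J must contain such elements. Conversely, conjugating h_b(c)
    by x_a(t) produces a factor x_a((1 - c^k) t); for an arbitrary unit c it would only lie in U,
    whereas c congruent to 1 modulo the square of the uniformizer pushes it into the next even
    affine root a_s + 2, which belongs to J. Exponent 2 is thus both the congruence level and the
    step between even affine roots.

    The records give no generators of N(T), so [act n] does not by itself describe conjugation by n.
    The missing link is the valuation of the scalar by which Ad n moves a root vector.

    Compactness has to be derived as well: Gamma(2e) lies in a translate of a compact set outside
    which some nonzero Hecke function vanishes. This is why t_{w_1} = 0 is a separate case. *)

Lemma abs0 : abs 0 = 0. Proof. exact/(Q2_eq0 hK). Qed.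

Lemma abs_ratr (q : rat) : abs ((numq q)%:~R / (denq q)%:~R) = abs2_rat q.
Proof. exact: Q2_rat hK q. Qed.

Lemma abs1 : abs 1 = 1.
Proof. by have := abs_ratr 1; rewrite /= divr1. Qed.

Lemma absN x : abs (- x) = abs x.
Proof.
rewrite -mulN1r (Q2_mul hK); have := abs_ratr (-1).
by rewrite numqN denqN /= divr1 mulrN1z => ->; rewrite mul1r.
Qed.

Lemma abs_ge0 x : 0 <= abs x.
Proof.
by have := Q2_ultra hK x (- x); rewrite subrr abs0 absN maxxx.
Qed.

Lemma abs2 : abs 2%:R = 2%:R^-1.
Proof. by have := abs_ratr 2%:R; rewrite /= divr1 => ->. Qed.

Lemma absX x n : abs (x ^+ n) = abs x ^+ n.
Proof.
by elim: n => [|n IH]; rewrite ?expr0 ?abs1 // !exprS (Q2_mul hK) IH.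
Qed.

(** The absolute value of a positive integer is a nonzero power of 2, so the characteristic is
    zero. *)
Lemma Q2_natr_neq0 n : n.+1%:R != 0 :> K.
Proof.
apply/eqP => h; have := abs_ratr n.+1%:R.
have -> : n.+1%:R = n.+1%:~R :> rat by [].
rewrite numq_int denq_int divr1 -[_%:~R]/(n.+1%:R) h abs0 /abs2_rat.
rewrite intr_eq0 eqz_nat /= => /esym/eqP.
by rewrite mulf_eq0 invr_eq0 !expf_eq0 !andbF.
Qed.

Lemma abs_sum_le (I : Type) (r : seq I) (P : pred I) (f : I -> K) B :
  0 <= B -> (forall i, P i -> abs (f i) <= B) -> abs (\sum_(i <- r | P i) f i) <= B.
Proof.
move=> B0 h; elim/big_rec: _ => [|i x Pi IH]; first by rewrite abs0.
by apply: le_trans (Q2_ultra hK _ _) _; rewrite ge_max h.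
Qed.

(* The unused argument carries the hypothesis to the instances declared below. *)
Definition abs_le1 of is_Q2 abs : {pred K} := fun x => abs x <= 1.

Lemma abs_le1_subring : subring_closed (abs_le1 hK).
Proof.
split; first by rewrite unfold_in abs1.
  move=> x y; rewrite !unfold_in => hx hy.
  by apply: le_trans (Q2_ultra hK _ _) _; rewrite absN ge_max hx.
move=> x y; rewrite !unfold_in => hx hy; rewrite (Q2_mul hK).
by rewrite -[1]mulr1 ler_pM ?abs_ge0.
Qed.
HB.instance Definition _ := GRing.isSubringClosed.Build K (abs_le1 hK) abs_le1_subring.

Definition abs_le1_type := {x : K | abs_le1 hK x}.
HB.instance Definition _ := SubType.on abs_le1_type.
HB.instance Definition _ := Choice.on abs_le1_type.
HB.instance Definition _ := [SubChoice_isSubComNzRing of abs_le1_type by <:].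

Variable F : fieldExtType K.
Local Notation O := (@integers K abs F).

Definition abs_le1_emb : abs_le1_type -> F := in_alg F \o val.
HB.instance Definition _ := GRing.RMorphism.on abs_le1_emb.

(** A polynomial whose coefficients have absolute value at most 1 lifts to the subring
    [abs_le1_type]; the closure properties of integral elements over a ring then apply to O. *)
Lemma integersE (x : F) : O x <-> integralOver abs_le1_emb x.
Proof.
split=> [[p [mon hp] hx]|[p mon hx]].
  have hz i : p`_i \in abs_le1 hK by rewrite unfold_in.
  have E : p = map_poly (val : abs_le1_type -> K) (\poly_(i < size p) Sub p`_i (hz i)).
    apply/polyP => i; rewrite coef_map_id0 // coef_poly.
    by case: ltnP => [_|/(nth_default 0) ->] /=; rewrite ?SubK.
  exists (\poly_(i < size p) Sub p`_i (hz i)).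
    rewrite monicE; apply/eqP/val_inj; move: mon; rewrite {1}E monicE.
    by rewrite lead_coef_map_inj // => [/eqP //|]; exact: val_inj.
  by rewrite /abs_le1_emb map_poly_comp -E.
exists (map_poly val p).
  by split=> [|i]; rewrite ?monic_map // coef_map; exact: (valP p`_i).
by rewrite -map_poly_comp.
Qed.

Lemma integers1 : O 1. Proof. exact/integersE/integral1. Qed.
Lemma integers0 : O 0. Proof. exact/integersE/integral0. Qed.
Lemma integersD x y : O x -> O y -> O (x + y).
Proof. by move=> /integersE hx /integersE hy; apply/integersE/integral_add. Qed.
Lemma integersM x y : O x -> O y -> O (x * y).
Proof. by move=> /integersE hx /integersE hy; apply/integersE/integral_mul. Qed.
Lemma integersN x : O x -> O (- x).
Proof. by move=> /integersE hx; apply/integersE/integral_opp. Qed.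

(** Since 1/2 has absolute value 2, the leading term of a monic polynomial of degree n+1 has
    absolute value 2^(n+1) there, while the other terms together are bounded by 2^n. This will force
    e > 0. *)
Lemma integers_half : ~ O 2%:R^-1.
Proof.
case=> p [mon hp]; have -> : 2%:R^-1 = in_alg F 2%:R^-1.
  by rewrite fmorphV rmorph_nat.
rewrite /root horner_map fmorph_eq0 => /eqP hx.
set x := 2%:R^-1 in hx.
have ax : abs x = 2%:R.
  have : abs (x * 2%:R) = 1 by rewrite mulVf ?abs1 ?Q2_natr_neq0.
  by rewrite (Q2_mul hK) abs2 => /(canRL (mulfVK _)) ->; rewrite ?mul1r ?invr_eq0 ?invrK.
move: hx; rewrite horner_coef.
case E : (size p) => [|n]; first by rewrite (polySpred (monic_neq0 mon)) in E.
have lc : p`_n = 1 by move/monicP: mon; rewrite lead_coefE E.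
rewrite big_ord_recr /= lc mul1r => /eqP; rewrite addr_eq0 eq_sym eqr_oppLR.
case: n E lc => [|n] E lc.
  by rewrite big_ord0 expr0 oppr0 oner_eq0.
move/eqP=> h; have : abs (x ^+ n.+1) <= 2%:R ^+ n.
  rewrite h absN; apply: abs_sum_le => [|i _]; first by rewrite exprn_ge0.
  rewrite (Q2_mul hK) absX ax -[leRHS]mul1r ler_pM ?abs_ge0 ?exprn_ge0 //.
  by rewrite ler_eXn2l // -ltnS.
by rewrite absX ax ler_eXn2l // ltnn.
Qed.

(** A power of 2 clears the denominators of the minimal polynomial of x. This is what bounds
    valuations later. *)
Lemma integers_clear (x : F) : exists m, O (2%:R ^+ m * x).
Proof.
have /polyOver1P[p Ep] := minPolyOver 1%AS x.
have mon : p \is monic by have := monic_minPoly 1%AS x; rewrite Ep map_monic.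
have : root (map_poly (in_alg F) p) x by rewrite -Ep root_minPoly.
rewrite /root horner_coef size_map_poly => /eqP hx.
(* The finitely many coefficients are bounded by a natural number m, and m < 2^m. *)
have [m hm] : exists m, forall i, abs p`_i * 2%:R^-1 ^+ m <= 1.
  have [m hm] : exists m : nat, forall i, (i < size p)%N -> abs p`_i <= m%:R.
    elim: (size p) => [|n [m hm]]; first by exists 0%N.
    exists (maxn m (Num.truncn (abs p`_n)).+1) => i;
      rewrite ltnS leq_eqVlt => /orP[/eqP->|/hm h].
      by apply/ltW/(lt_le_trans (truncnS_gt _)); rewrite ler_nat leq_maxr.
    by apply: le_trans h _; rewrite ler_nat leq_maxl.
  exists m => i; case: (ltnP i (size p)) => [/hm h|/(nth_default 0) ->]; last first.
    by rewrite abs0 mul0r.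
  rewrite exprVn ler_pdivrMr ?exprn_gt0 // mul1r; apply: le_trans h _.
  by rewrite -natrX ler_nat ltnW // ltn_expl.
pose s := 2%:R ^+ m : K.
have as1 : abs s <= 1 by rewrite absX abs2 exprn_ile1 // ?invr_ge0 ?ler0n // invf_le1.
exists m; pose n := (size p).-1.
have En : size p = n.+1 by rewrite /n polySpred ?monic_neq0.
(* This is s^n p(X / s): it is monic with root s x, and every lower coefficient contains a factor
   s. *)
exists (\poly_(i < n.+1) (p`_i * s ^+ (n - i))).
  split=> [|i].
    have lc : p`_n = 1 by move/monicP: mon; rewrite lead_coefE.
    rewrite monicE lead_coef_poly ?lc ?subnn ?mulr1 //; exact: oner_neq0.
  rewrite coef_poly; case: ltnP => [|_]; last by rewrite abs0.
  rewrite ltnS leq_eqVlt => /orP[/eqP->|lt].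
    have lc : p`_n = 1 by move/monicP: mon; rewrite lead_coefE.
    by rewrite subnn lc mulr1 abs1.
  have -> : (n - i = (n - i).-1.+1)%N by rewrite prednK // subn_gt0.
  rewrite exprS mulrA (Q2_mul hK) -[1]mulr1 ler_pM ?abs_ge0 //.
    by rewrite (Q2_mul hK) absX abs2.
  by rewrite absX exprn_ile1 // abs_ge0.
rewrite /root horner_coef size_map_poly.
have -> : \sum_(i < size (\poly_(i < n.+1) (p`_i * s ^+ (n - i)))) (map_poly (in_alg F)
  (\poly_(i < n.+1) (p`_i * s ^+ (n - i))))`_i * (2%:R ^+ m * x) ^+ i = 2%:R ^+ m ^+ n
    * \sum_(i < size p) (map_poly (in_alg F) p)`_i * x ^+ i.
  rewrite En (_ : size _ = n.+1); last first.
    rewrite size_poly_eq // subnn mulr1; move/monicP: mon; rewrite lead_coefE => ->.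
    exact: oner_neq0.
  rewrite mulr_sumr; apply: eq_bigr => i _.
  have Ei : in_alg F (p`_i * s ^+ (n - i)) = in_alg F p`_i * 2%:R ^+ m ^+ (n - i).
    by rewrite rmorphM !rmorphXn rmorph_nat.
  rewrite !coef_map coef_poly ltn_ord exprMn; move: Ei; rewrite /= => ->.
  have -> : (2%:R ^+ m ^+ n : F) = 2%:R ^+ m ^+ (n - i) * 2%:R ^+ m ^+ i.
    by rewrite -exprD subnK // -ltnS.
  by move: (_%:A) => c; ring.
by rewrite hx mulr0.
Qed.

End TwoAdicIntegers.

(** * Units and valuation in a dyadic field *)

Section Dyadic.
Variable F : dyadic_field.
Local Notation O := (@O_F F).
Local Notation U := (@O_units F).
Local Notation pi := (dy_unif F).
Local Notation e := (dy_ram F).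
Let hK := @dy_Q2P F.

Lemma O_0 : O 0. Proof. exact: integers0 hK _. Qed.
Lemma O_1 : O 1. Proof. exact: integers1 hK _. Qed.
Lemma O_D x y : O x -> O y -> O (x + y). Proof. exact: integersD hK _ _ _. Qed.
Lemma O_M x y : O x -> O y -> O (x * y). Proof. exact: integersM hK _ _ _. Qed.
Lemma O_N x : O x -> O (- x). Proof. exact: integersN hK _ _. Qed.
Lemma O_X x n : O x -> O (x ^+ n).
Proof. by move=> hx; elim: n => [|n IH]; rewrite ?expr0 ?exprS;
  [exact: O_1|exact: O_M]. Qed.
Lemma O_nat n : O n%:R.
Proof. by elim: n => [|n IH]; [exact: O_0|rewrite -addn1 natrD; apply: O_D O_1]. Qed.

Lemma pi_neq0 : pi != 0. Proof. by case: (dy_unifP F). Qed.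

Lemma O_nonunit x : O x -> ~ U x -> exists2 y, O y & x = pi * y.
Proof. by move=> hx nx; apply/(proj2 (dy_unifP F)). Qed.

Lemma pi_nonunit y : O y -> O (pi * y) /\ ~ U (pi * y).
Proof. by move=> hy; apply/(proj2 (dy_unifP F)); exists y. Qed.

Lemma O_pi : O pi. Proof. by case: (pi_nonunit O_1); rewrite mulr1. Qed.

Lemma pi_mul_neq1 y : O y -> pi * y <> 1.
Proof.
move=> /pi_nonunit[_ h] E; apply: h; rewrite E.
by split; rewrite ?oner_neq0 ?invr1 //; exact: O_1.
Qed.

Lemma F_natr_neq0 n : n.+1%:R != 0 :> F.
Proof. by rewrite -(rmorph_nat (in_alg F)) fmorph_eq0 (Q2_natr_neq0 hK). Qed.

Lemma ram_gt0 : (0 < e)%N.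
Proof.
rewrite lt0n; apply/eqP => e0.
have [|y hy E] := (proj2 (dy_ramP (1 : F))).
  by exists 1; [exact: O_1|rewrite e0 expr0 mulr1].
apply: (integers_half hK (F := F)); suff -> : 2%:R^-1 = y by [].
by apply: (mulfI (F_natr_neq0 1)); rewrite -E mulfV // F_natr_neq0.
Qed.

Lemma U_neq0 x : U x -> x != 0. Proof. by case. Qed.
Lemma U_O x : U x -> O x. Proof. by case. Qed.
Lemma U_1 : U 1. Proof. by split; rewrite ?oner_neq0 ?invr1 //; exact: O_1. Qed.
Lemma U_M x y : U x -> U y -> U (x * y).
Proof. by case=> ? ? ? [? ? ?]; split; rewrite ?mulf_neq0 ?invfM //; exact: O_M. Qed.
Lemma U_V x : U x -> U x^-1.
Proof. by case=> ? ? ?; split; rewrite ?invr_eq0 ?invrK. Qed.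
Lemma U_N x : U x -> U (- x).
Proof. by case=> ? ? ?; split; rewrite ?oppr_eq0 ?invrN //; exact: O_N. Qed.
Lemma U_Xz x (m : int) : U x -> U (x ^ m).
Proof.
move=> hx; have hX n : U (x ^+ n).
  by elim: n => [|n IH]; rewrite ?expr0 ?exprS; [exact: U_1|exact: U_M].
by case: m => n; rewrite ?NegzE -?exprnP // -exprnN; apply/U_V/hX.
Qed.

(** By [dy_unifP] a nonunit is divisible by the uniformizer, so divide as often as possible. The
    process stops: some 2^m / x is integral and 2^m is associate to pi^(e m), hence a factor pi^k of
    x with k > e m would make the uniformizer divide 1. *)
Lemma O_val x : O x -> x != 0 -> exists k u, U u /\ x = pi ^+ k * u.
Proof.
move=> hx nx; have [m hm] := integers_clear hK (x^-1).
have [|y hy Ey] := (proj1 (dy_ramP (2%:R : F))).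
  by exists 1; [exact: O_1|rewrite mulr1].
have [|y' hy' Ey'] := (proj2 (dy_ramP (pi ^+ e))).
  by exists 1; [exact: O_1|rewrite mulr1].
have bound k z : O z -> x = pi ^+ k * z -> (k <= e * m)%N.
  move=> hz Ex; rewrite leqNgt; apply/negP => lt.
  apply: (@pi_mul_neq1 (pi ^+ (k - e * m).-1 * z * (2%:R ^+ m / x) * y' ^+ m)).
    by do !apply: O_M => //; apply: O_X => //; exact: O_pi.
  rewrite !mulrA -exprS prednK ?subn_gt0 //.
  have pn : pi ^+ (e * m) != 0 by rewrite expf_neq0 // pi_neq0.
  have Ep : pi ^+ (e * m) = 2%:R ^+ m * y' ^+ m by rewrite -exprMn -Ey' -exprM.
  apply: (mulfI pn); rewrite mulr1 [in RHS]Ep !mulrA -exprD subnKC ?(ltnW lt) // -Ex.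
  by field.
pose P k := `[< exists2 z, O z & x = pi ^+ k * z >].
have exP : exists k, P k.
  by exists 0%N; apply/asboolP; exists x; rewrite // expr0 mul1r.
have ubP k : P k -> (k <= e * m)%N by move=> /asboolP[z]; exact: bound.
case: (ex_maxnP exP ubP) => k /asboolP[z hz Ez] max; exists k, z; split=> //.
apply: contrapT => /(O_nonunit hz)[w hw Ew].
have : P k.+1 by apply/asboolP; exists w; rewrite // exprSr -mulrA -Ew.
by move/max; rewrite ltnn.
Qed.

Lemma F_val x : x != 0 -> exists (k : int) u, U u /\ x = pi ^ k * u.
Proof.
move=> nx; have [m hm] := integers_clear hK x.
have n2 : 2%:R ^+ m != 0 :> F by rewrite expf_neq0 // F_natr_neq0.
have [k [u [hu Eu]]] := O_val hm (mulf_neq0 n2 nx).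
have [l [v [hv Ev]]] := O_val (O_X m (O_nat 2)) n2.
exists (k%:Z - l%:Z), (u / v); split; first exact/U_M/U_V.
apply: (mulfI n2); rewrite Eu {1}Ev expfzDr ?pi_neq0 // -exprnP -invr_expz -exprnP.
have p0 : pi ^+ l != 0 by rewrite expf_neq0 // pi_neq0.
have v0 := U_neq0 hv.
by field; rewrite p0 v0.
Qed.

(** Otherwise the uniformizer divides both x and 1 + x, hence 1. *)
Lemma O_ideal_unit k x : (0 < k)%N -> O_ideal k x -> U (1 + x).
Proof.
case: k => // k _ [y hy ->]; have hz : O (pi ^+ k * y) by apply: O_M => //;
  apply/O_X/O_pi.
have h : O (1 + pi ^+ k.+1 * y) by rewrite exprS -mulrA; apply: O_D O_1 (O_M O_pi hz).
apply: contrapT => /(O_nonunit h)[w hw E].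
apply: (@pi_mul_neq1 (w - pi ^+ k * y)); first by apply: O_D => //; apply: O_N.
by rewrite mulrBr -E exprS mulrA addrK.
Qed.

End Dyadic.

(** * Roots *)

Section Dot.
Variables (R : realType) (n : nat).
Implicit Types u v w a : 'rV[R]_n.

Lemma dotC u v : dot u v = dot v u.
Proof. by apply: eq_bigr => i _; rewrite mulrC. Qed.
Lemma dotDl u v w : dot (u + v) w = dot u w + dot v w.
Proof. by rewrite -big_split; apply: eq_bigr => i _; rewrite mxE mulrDl. Qed.
Lemma dotZl c u v : dot (c *: u) v = c * dot u v.
Proof. by rewrite mulr_sumr; apply: eq_bigr => i _; rewrite mxE mulrA. Qed.
Lemma dotNl u v : dot (- u) v = - dot u v.
Proof. by rewrite -scaleN1r dotZl mulN1r. Qed.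
Lemma dot0l v : dot 0 v = 0.
Proof. by rewrite -(scale0r 0) dotZl mul0r. Qed.
Lemma dotDr u v w : dot w (u + v) = dot w u + dot w v.
Proof. by rewrite dotC dotDl !(dotC w). Qed.
Lemma dotZr c u v : dot u (c *: v) = c * dot u v.
Proof. by rewrite dotC dotZl dotC. Qed.
Lemma dotNr u v : dot u (- v) = - dot u v.
Proof. by rewrite dotC dotNl dotC. Qed.
Lemma dot_suml (I : Type) (r : seq I) (P : pred I) (f : I -> 'rV[R]_n) v :
  dot (\sum_(i <- r | P i) f i) v = \sum_(i <- r | P i) dot (f i) v.
Proof.
by elim/big_rec2: _ => [|i x y _ <-]; rewrite ?dot0l ?dotDl.
Qed.
Lemma dot_sumr (I : Type) (r : seq I) (P : pred I) (f : I -> 'rV[R]_n) v :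
  dot v (\sum_(i <- r | P i) f i) = \sum_(i <- r | P i) dot v (f i).
Proof. by rewrite dotC dot_suml; apply: eq_bigr => i _; rewrite dotC. Qed.

Lemma dot_ge0 v : 0 <= dot v v.
Proof. by apply: sumr_ge0 => i _; rewrite -expr2 sqr_ge0. Qed.
Lemma dot_eq0 v : (dot v v == 0) = (v == 0).
Proof.
apply/eqP/eqP => [|->]; last by rewrite dot0l.
move/eqP; rewrite psumr_eq0 => [/allP h|i _]; last by rewrite -expr2 sqr_ge0.
apply/rowP => i; rewrite mxE; apply/eqP.
by have := h i (mem_index_enum i); rewrite /= mulf_eq0 orbb.
Qed.
Lemma dot_inj u v : (forall w, dot u w = dot v w) -> u = v.
Proof.
move=> h; apply/eqP; rewrite -subr_eq0 -dot_eq0 dotDl dotNl h.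
by rewrite subrr.
Qed.

Lemma reflectionD a u v : reflection a (u + v) = reflection a u + reflection a v.
Proof. by rewrite /reflection dotDr scalerDl opprD addrACA. Qed.
Lemma reflectionZ a c v : reflection a (c *: v) = c *: reflection a v.
Proof. by rewrite /reflection dotZr scalerBr !scalerA. Qed.

Lemma dot_coroot a : a != 0 -> dot a (coroot a) = 2%:R.
Proof. by move=> na; rewrite dotZr divfK // dot_eq0. Qed.

Lemma reflectionK a : a != 0 -> involutive (reflection a).
Proof.
move=> na v; rewrite /reflection dotDr dotNr dotZr dot_coroot //.
rewrite -addrA -opprD -scalerDl; set c := (X in X *: _).
have -> : c = 0 by rewrite /c; ring.
by rewrite scale0r subr0.
Qed.

Lemma dot_reflection a u v : dot (reflection a u) v = dot u (reflection a v).
Proof.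
by rewrite /reflection dotDl dotDr dotNl dotNr !dotZl !dotZr (dotC u a); ring.
Qed.

Definition affine a (k : int) v : R := dot a v + k%:~R.

Lemma affine_inj a b k l : affine a k =1 affine b l -> a = b /\ k = l.
Proof.
move=> h; have kl : k = l.
  by apply/eqP; rewrite -(eqr_int R); have := h 0;
    rewrite /affine !(dotC _ 0) !dot0l !add0r => ->.
split=> //; apply: dot_inj => w; have := h w; rewrite /affine kl.
exact: addIr.
Qed.

Lemma affineN a k v : - affine a k v = affine (- a) (- k) v.
Proof. by rewrite /affine dotNl opprD rmorphN. Qed.
Lemma affineD a b k l v : affine a k v + affine b l v = affine (a + b) (k + l) v.
Proof. by rewrite /affine dotDl rmorphD /= addrACA. Qed.
End Dot.

Section Roots.
Variables (R : realType) (Phi : root_system R).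
Local Notation E := 'rV[R]_(rk Phi).
Implicit Types (a b : E).
Local Notation rts := (Defs.roots Phi).

Lemma root_neq0 a : a \in rts -> a != 0.
Proof. by move=> ha; apply: contraNneq (roots_neq0 Phi) => <-. Qed.

Lemma root_opp a : a \in rts -> - a \in rts.
Proof.
move=> ha; have := roots_refl ha ha.
rewrite /reflection /coroot scalerA mulrCA divff ?dot_eq0 ?root_neq0 // mulr1.
by rewrite scaler_nat mulr2n opprD addrA subrr add0r.
Qed.

(* The integer <b, a^v>. *)
Definition pairing a b : int := Num.floor (dot b (coroot a)).

Lemma pairingE a b : a \in rts -> b \in rts ->
  (pairing a b)%:~R = dot b (coroot a).
Proof. by move=> ha hb; rewrite floorK // roots_int. Qed.

Lemma pairing_dot a b : a \in rts -> b \in rts ->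
  (pairing a b)%:~R = 2%:R * dot a b / dot a a.
Proof. by move=> ha hb; rewrite pairingE // dotZr (dotC b); ring. Qed.

Lemma pairing_refl a b : a \in rts -> b \in rts ->
  reflection a b = b - a *~ pairing a b.
Proof.
move=> ha hb; rewrite /reflection -scaler_int pairing_dot // /coroot scalerA.
by congr (_ - _ *: _); ring.
Qed.

Lemma pairing_eq (k : int) a b : a \in rts -> b \in rts ->
  2%:R * dot a b / dot a a = k%:~R -> pairing a b = k.
Proof. by move=> ha hb; rewrite -pairing_dot // => /intr_inj. Qed.

Variant pairing_spec a b : int -> Prop :=
| PairSame of b = a : pairing_spec a b 2
| PairOpp of b = - a : pairing_spec a b (-2)
| PairZero of a + b \notin rts & - a + b \notin rts & a + b != 0 & - a + b != 0 :
    pairing_spec a b 0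
| PairNeg of a + b \in rts & - a + b \notin rts & a + b != 0 & - a + b != 0 :
    pairing_spec a b (-1)
| PairPos of - a + b \in rts & a + b \notin rts & a + b != 0 & - a + b != 0 :
    pairing_spec a b 1.

(** When b is not a or -a, the norms of a + b and b - a are positive, which leaves the values -1, 0,
    1. All roots have the same length, so comparing norms shows that a + b is a root exactly for the
    value -1 and b - a exactly for 1. Every later commutator and adjoint computation splits along
    these five cases. *)
Lemma pairingP a b : a \in rts -> b \in rts -> pairing_spec a b (pairing a b).
Proof.
move=> ha hb; have dE := roots_simply_laced ha hb.
have d0 : 0 < dot a a by rewrite lt_def dot_ge0 dot_eq0 root_neq0.
have dn : dot a a != 0 by rewrite gt_eqF.
have pE := pairing_dot ha hb.
case: (eqVneq b a) => [Eb|nba].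
  have -> : pairing a b = 2.
    by apply: pairing_eq => //; rewrite Eb mulfK.
  exact: PairSame.
case: (eqVneq b (- a)) => [Eb|nbna].
  have -> : pairing a b = -2.
    by apply: pairing_eq => //; rewrite Eb dotNr mulrN mulNr mulfK.
  exact: PairOpp.
have n1 : a + b != 0 by apply: contra nbna; rewrite addrC addr_eq0.
have n2 : - a + b != 0 by apply: contra nba; rewrite addrC subr_eq0.
have s1 : 0 < dot (a + b) (a + b) by rewrite lt_def dot_ge0 dot_eq0 n1.
have s2 : 0 < dot (- a + b) (- a + b) by rewrite lt_def dot_ge0 dot_eq0 n2.
have r1 : a + b \in rts -> pairing a b = -1.
  move=> h; apply: pairing_eq => //.
  have := roots_simply_laced ha h; rewrite dotDl !dotDr -dE (dotC b a) => h1.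
  have {}h1 : 2%:R * dot a b = - dot a a by lra.
  by rewrite h1 mulNr divff.
have r2 : - a + b \in rts -> pairing a b = 1.
  move=> h; apply: pairing_eq => //.
  have := roots_simply_laced ha h;
    rewrite dotDl !dotDr !dotNl !dotNr -dE (dotC b a) => h1.
  have {}h1 : 2%:R * dot a b = dot a a by lra.
  by rewrite h1 divff.
have quotient_map1 : pairing a b = -1 -> a + b \in rts.
  by move=> h; have := roots_refl ha hb; rewrite pairing_refl // h mulrN1z opprK addrC.
have q2 : pairing a b = 1 -> - a + b \in rts.
  by move=> h; have := roots_refl ha hb; rewrite pairing_refl // h mulr1z addrC.
have lo : (-2 < pairing a b)%R.
  rewrite -(ltr_int R) pE ltr_pdivlMr //.
  by move: s1; rewrite dotDl !dotDr -dE (dotC b a); lra.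
have hi : (pairing a b < 2)%R.
  rewrite -(ltr_int R) pE ltr_pdivrMr //.
  by move: s2; rewrite dotDl !dotDr !dotNl !dotNr -dE (dotC b a); lra.
have [h|[h|h]] : pairing a b = -1 \/ pairing a b = 0 \/ pairing a b = 1 by lia.
- rewrite h; apply: PairNeg => //; first exact: quotient_map1.
  by apply/negP => /r2; rewrite h.
- by rewrite h; apply: PairZero => //; apply/negP; [move/r1|move/r2]; rewrite h.
- rewrite h; apply: PairPos => //; first exact: q2.
  by apply/negP => /r1; rewrite h.
Qed.

Lemma pairingN a b : a \in rts -> b \in rts -> pairing (- a) b = - pairing a b.
Proof.
move=> ha hb; apply: (@intr_inj R); rewrite rmorphN /= !pairing_dot ?root_opp //.
by rewrite !dotNl dotNr opprK !mulrN mulNr.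
Qed.

End Roots.

(** * Even affine roots *)

Section AffineRoots.
Variables (R : realType) (Phi : root_system R).
Local Notation E := 'rV[R]_(rk Phi).
Local Notation rts := (Defs.roots Phi).
Local Notation I := (option 'I_(rk Phi)).
Local Notation smp := (@Defs.simple R Phi).
Local Notation low := (lowest Phi).
Local Notation alc := (@alcove R Phi).
Local Notation gen := (@coxeter_gen R Phi).
Implicit Types (a : E) (b : E -> R) (f g : E -> E).

Definition aroot b : Prop :=
  exists a (m : int), a \in rts /\ b = affine a (2 * m).

Definition sroot (j : I) : E := if j is Some i then smp i else low.
Definition sconst (j : I) : int := if j is Some _ then 0 else 2.
Definition saff (j : I) : E -> R := affine (sroot j) (sconst j).

Lemma sroot_root j : sroot j \in rts.
Proof. by case: j => [i|]; [exact: simple_root|exact: lowest_root]. Qed.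

Lemma saff_aroot j : aroot (saff j).
Proof.
exists (sroot j); case: j => [i|]; [exists 0|exists 1]; split=> //;
  by [exact: simple_root|exact: lowest_root].
Qed.

Lemma coxeter_genE j v : gen j v = v - saff j v *: coroot (sroot j).
Proof.
case: j => [i|]; first by rewrite /saff /affine /= addr0 /reflection.
rewrite -[gen None v]/(@w_af R Phi v) /w_af /reflection.
by rewrite scalerDl scaler_int [in RHS]opprD [RHS]addrA.
Qed.

Lemma saff_gen j v : saff j (gen j v) = - saff j v.
Proof.
rewrite coxeter_genE {1}/saff /affine dotDr dotNr dotZr.
rewrite dot_coroot ?root_neq0 ?sroot_root //.
rewrite -/(affine _ _ _) addrAC -/(affine _ _ _) -/(saff j v); ring.
Qed.

Lemma genK j : involutive (gen j).
Proof.
by move=> v; rewrite [LHS]coxeter_genE saff_gen coxeter_genE scaleNr opprK subrK.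
Qed.

Definition positive b : Prop := forall v, alc v -> 0 < b v.
Definition negative b : Prop := forall v, alc v -> b v < 0.

(** The algebraic form of positivity on the alcove: coefficients, unlike signs, can be compared
    through [saff_indep]. *)
Definition nat_comb b : Prop :=
  exists c : I -> nat, forall v, b v = \sum_j (c j)%:R * saff j v.

Lemma nat_combD b1 b2 b : nat_comb b1 -> nat_comb b2 ->
  (forall v, b v = b1 v + b2 v) -> nat_comb b.
Proof.
move=> [c1 h1] [c2 h2] h; exists (fun j => (c1 j + c2 j)%N) => v.
by rewrite h h1 h2 -big_split; apply: eq_bigr => j _ /=; rewrite natrD mulrDl.
Qed.

Lemma nat_comb_saff j : nat_comb (saff j).
Proof.
exists (fun i => (i == j : nat)) => v.
by rewrite (bigD1 j) //= eqxx mul1r big1 ?addr0 // => i /negPf ->; rewrite mul0r.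
Qed.

Lemma nat_comb_span a : nat_span smp a -> nat_comb (affine a 0).
Proof.
case=> m ->; exists (fun j => if j is Some i then m i else 0%N) => v.
rewrite /affine addr0 dot_suml (bigD1 None) //= mul0r add0r.
rewrite (reindex_omap Some id) /=; last by case.
rewrite [RHS](eq_bigl xpredT) => [|i]; last by rewrite eqxx.
apply: eq_bigr => i _; rewrite /saff /affine /= addr0.
by rewrite -scaler_nat dotZl.
Qed.

Lemma simple_sum_inj (c d : 'I_(rk Phi) -> R) :
  \sum_i c i *: smp i = \sum_i d i *: smp i -> c =1 d.
Proof.
have sumE (x : 'I_(rk Phi) -> R) : \sum_i x i *: smp i = (\row_i x i) *m \matrix_i smp i.
  by rewrite mulmx_sum_row; under [in RHS]eq_bigr do rewrite mxE rowK.
rewrite !sumE => /(congr1 (mulmx^~ (invmx (\matrix_i smp i)))).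
rewrite !(mulmxK (simple_free Phi)) => /rowP h i.
by have := h i; rewrite !mxE.
Qed.

Lemma nat_span_anti a : nat_span smp a -> nat_span smp (- a) -> a = 0.
Proof.
move=> [m Em] [k Ek].
have h : \sum_i (m i + k i)%:R *: smp i = \sum_i 0 *: smp i.
  rewrite [RHS]big1 => [|i _]; last by rewrite scale0r.
  transitivity (a + - a); last exact: subrr.
  rewrite Ek [X in X + _]Em -big_split /=.
  by apply: eq_bigr => i _; rewrite natrD scalerDl !scaler_nat.
rewrite Em big1 // => i _.
have /eqP := simple_sum_inj h i; rewrite pnatr_eq0 addn_eq0 => /andP[/eqP -> _].
by rewrite mulr0n.
Qed.

(** [lowestP] at the root [- low] puts [- (low + low)] in the span; were [low] in the span too, it
    would vanish by [nat_span_anti]. *)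
Lemma nat_spanN_low : nat_span smp (- low).
Proof.
have [hl|//] := simple_base (lowest_root Phi).
have h := lowestP (root_opp (lowest_root Phi)).
have hh : nat_span smp (- (low + low)) by rewrite opprD.
have [m Em] := hl; have h2 : nat_span smp (low + low).
  exists (fun i => (m i + m i)%N); rewrite {1 2}Em -big_split.
  by apply: eq_bigr => i _; rewrite /= mulrnDr.
by have /eqP := nat_span_anti h2 hh;
  rewrite -mulr2n -scaler_nat scaler_eq0 pnatr_eq0 /= (negPf (root_neq0 (lowest_root
    Phi))).
Qed.

(** The constant 2 is (low + 2) + (- low), that is [saff None] plus a nonnegative combination of
    simple roots. *)
Lemma nat_comb_2 n : nat_comb (affine 0 (2 * n%:Z)).
Proof.
elim: n => [|n IH].
  by exists (fun=> 0%N) => v; rewrite big1 /affine ?dot0l ?addr0 // => j _; rewrite mul0r.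
have h2 := nat_combD (nat_comb_saff None) (nat_comb_span nat_spanN_low).
apply: (nat_combD (b1 := affine 0 2) _ IH) => [|v]; last first.
  by rewrite affineD addr0; congr affine; lia.
by apply: h2 => v; rewrite affineD /= subrr.
Qed.

(** For m >= 1 write a + 2m as (low + 2) + (a - low) + 2(m - 1). *)
Lemma nat_comb_aroot a (m : int) : a \in rts ->
  1 <= m \/ m = 0 /\ nat_span smp a -> nat_comb (affine a (2 * m)).
Proof.
move=> ha [m1|[-> hs]]; last exact: nat_comb_span.
have [n ->] : exists n : nat, m = n.+1%:Z.
  by exists `|m - 1|%N; lia.
have h := nat_combD (nat_comb_saff None) (nat_comb_span (lowestP ha)).
apply: (nat_combD (b1 := affine a 2) _ (nat_comb_2 n)) => [|v]; last first.
  by rewrite affineD addr0; congr affine; lia.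
by apply: h => v; rewrite affineD /= addrC subrK.
Qed.

Lemma aroot_sign b : aroot b -> nat_comb b \/ nat_comb (fun v => - b v).
Proof.
move=> [a [m [ha ->]]]; have ha' := root_opp ha.
have hN : nat_comb (affine (- a) (2 * - m)) -> nat_comb (fun v => - affine a (2 * m) v).
  by move=> [c hc]; exists c => v; rewrite -hc affineN mulrN.
have [m1|[m1|m0]] : 1 <= m \/ m <= -1 \/ m = 0 by lia.
- by left; apply: nat_comb_aroot => //; left.
- by right; apply/hN/nat_comb_aroot => //; left; lia.
- case: (simple_base ha) => hs; [left|right; apply: hN];
    by apply: nat_comb_aroot => //; right; rewrite m0 ?oppr0.
Qed.

Lemma arootN b : aroot b -> aroot (fun v => - b v).
Proof.
move=> [a [m [ha ->]]]; exists (- a), (- m); split; first exact: root_opp.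
by apply/funext => v; rewrite affineN mulrN.
Qed.

Lemma aroot_neq0 b : aroot b -> exists v, b v != 0.
Proof.
move=> [a [m [ha ->]]]; apply: contrapT => h.
have {}h v : affine a (2 * m) v = 0 by apply/eqP/negPn/negP => ?; apply: h; exists v.
have [|E _] := @affine_inj R _ a 0 (2 * m) 0.
  by move=> v; rewrite h /affine dot0l addr0.
by have := root_neq0 ha; rewrite E eqxx.
Qed.

Lemma saff_pos j : positive (saff j).
Proof.
move=> v [h1 h2]; case: j => [i|]; rewrite /saff /affine /= ?addr0 //.
by rewrite -ltrBlDr sub0r.
Qed.

(** All [saff j] are positive on the alcove, so the combination could vanish there only if every
    coefficient did; then b would be the zero function, which [aroot_neq0] excludes. *)
Lemma nat_comb_pos b : aroot b -> nat_comb b -> positive b.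
Proof.
move=> /aroot_neq0[u hu] [c h] v hv; rewrite h lt_def sumr_ge0 ?andbT => [|j _];
  last first.
  by rewrite mulr_ge0 // ltW // saff_pos.
rewrite psumr_eq0 => [|j _]; last by rewrite mulr_ge0 // ltW // saff_pos.
apply: contra hu => /allP h0; rewrite h big1 // => j _.
have := h0 j (mem_index_enum j); rewrite /= mulf_eq0 (gt_eqF (saff_pos _ hv)) orbF.
by move/eqP ->; rewrite mul0r.
Qed.

Lemma aroot_pos_neg b : aroot b -> positive b \/ negative b.
Proof.
move=> hb; case: (aroot_sign hb) => [/(nat_comb_pos hb)|/(nat_comb_pos (arootN hb)) h].
  by left.
by right=> v /h; rewrite oppr_gt0.
Qed.

Lemma alcove_nonempty : exists v, alc v.
Proof.
have [m Em] := nat_spanN_low.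
(* The point is chosen so that all simple roots take the value 1/(s+1), where s is the height of
   [- low]; then [low] takes the value -s/(s+1), which is above -1. *)
pose s : R := \sum_i (m i)%:R.
have s0 : 0 <= s by apply: sumr_ge0.
pose d : R := (s + 1)^-1.
have d0 : 0 < d by rewrite invr_gt0 ltr_wpDl.
pose v : E := (invmx (\matrix_i smp i) *m (\col_i d))^T.
have hv i : dot (smp i) v = d.
  have -> : dot (smp i) v = (\matrix_i smp i *m v^T) i 0.
    by rewrite mxE; apply: eq_bigr => k _; rewrite !mxE.
  by rewrite trmxK mulKVmx ?simple_free // mxE.
exists v; split=> [i|]; first by rewrite hv.
have -> : dot low v = - (s * d).
  rewrite -[low]opprK Em dotNl dot_suml mulr_suml; congr (- _).
  by apply: eq_bigr => i _; rewrite -scaler_nat dotZl hv.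
rewrite ltrN2; apply: (@lt_trans _ _ 1); last by rewrite ltr1n.
by rewrite ltr_pdivrMr ?ltr_wpDl // mul1r ltrDl.
Qed.

Lemma positive_not_negative b : positive b -> negative b -> False.
Proof.
by have [v hv] := alcove_nonempty; move=> /(_ v hv) h1 /(_ v hv) /(lt_trans h1);
  rewrite ltxx.
Qed.

Lemma positive_nat_comb b : aroot b -> positive b -> nat_comb b.
Proof.
move=> hb hp; case: (aroot_sign hb) => // /(nat_comb_pos (arootN hb)) h.
by case: (positive_not_negative hp) => v /h; rewrite oppr_gt0.
Qed.

(** Only [saff None] has a nonzero constant term, so evaluation at 0 isolates its coefficient; the
    others vanish because the simple roots are free. *)
Lemma saff_indep (z : I -> R) : (forall v, \sum_j z j * saff j v = 0) -> forall j, z j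
  = 0.
Proof.
move=> h.
have sumS (g : I -> R) : \sum_j g j = g None + \sum_i g (Some i).
  rewrite (bigD1 None) //=; congr (_ + _).
  rewrite (reindex_omap Some id) /=; last by case.
  by apply: eq_bigl => i; rewrite eqxx.
have z0 : z None = 0.
  have := h 0; rewrite sumS big1 => [|i _];
    last by rewrite /saff /affine (dotC _ 0) dot0l addr0 mulr0.
  rewrite /saff /affine (dotC _ 0) dot0l add0r addr0 => /eqP.
  by rewrite mulf_eq0 (_ : (_%:~R == 0) = false) ?orbF => [/eqP|]; rewrite ?intr_eq0.
have hs : \sum_i z (Some i) *: smp i = \sum_i 0 *: smp i.
  rewrite [RHS]big1 => [|i _]; last by rewrite scale0r.
  apply: dot_inj => w; have := h w; rewrite sumS z0 mul0r add0r dot0l dot_suml => hw.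
  rewrite -[RHS]hw; apply: eq_bigr => i _; rewrite dotZl.
  by rewrite /saff /affine /= addr0.
by case=> [i|//]; have := simple_sum_inj hs i.
Qed.

Lemma saff_genE i j v :
  saff i (gen j v) = saff i v - dot (sroot i) (coroot (sroot j)) * saff j v.
Proof.
rewrite coxeter_genE {1}/saff /affine dotDr dotNr dotZr addrAC; congr (_ - _).
exact: mulrC.
Qed.

(* A simple reflection only changes one coordinate of a positive affine root,
   so it makes it negative only if the other coordinates vanish. *)
Lemma simple_refl_negative j b : aroot b -> positive b ->
  aroot (b \o gen j) -> negative (b \o gen j) -> b = saff j.
Proof.
move=> hb hp hg hn.
have [c hc] := positive_nat_comb hb hp.
have [|d hd] := positive_nat_comb (arootN hg); first by move=> v /hn; rewrite oppr_gt0.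
have c0 i : i != j -> c i = 0%N.
  pose x := \sum_i (c i)%:R * dot (sroot i) (coroot (sroot j)).
  (* Add the expansions of [b \o gen j] and of its negative. The reflection alters only the
     coordinate at j, by x, so at every other index independence yields c + d = 0. *)
  have h v : \sum_k ((c k + d k)%:R - (if k == j then x else 0)) * saff k v = 0.
    transitivity (\sum_i ((c i)%:R * saff i v + (d i)%:R * saff i v) - x * saff j v).
      rewrite [X in _ - X](_ : _ = \sum_i (if i == j then x else 0) * saff i v);
        last first.
        by rewrite (bigD1 j) //= eqxx big1 ?addr0 // => k /negPf ->; rewrite mul0r.
      by rewrite -sumrB; apply: eq_bigr => k _; rewrite natrD; ring.
    rewrite big_split /= -hd /= hc mulr_suml -addrA -opprD -big_split /= -sumrB.
    by apply: big1 => k _; rewrite saff_genE; ring.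
  move=> nij; have /eqP := saff_indep h i; rewrite (negPf nij) subr0 pnatr_eq0.
  by rewrite addn_eq0 => /andP[/eqP].
have Eb v : b v = (c j)%:R * saff j v.
  by rewrite hc (bigD1 j) //= big1 ?addr0 // => i /c0 ->; rewrite mul0r.
have [a [m [ha Ea]]] := hb.
have Eaff v : b v = dot ((c j)%:R *: sroot j) v + (c j)%:R * (sconst j)%:~R.
  by rewrite Eb /saff /affine dotZl mulrDr.
have a_eq : a = (c j)%:R *: sroot j.
  have k0 : (2 * m)%:~R = (c j)%:R * (sconst j)%:~R :> R.
    by have := Eaff 0; rewrite Ea /affine !(dotC _ 0) !dot0l !add0r.
  by apply: dot_inj => w; have := Eaff w; rewrite Ea /affine k0 => /addIr.
have [cj|cj] := roots_reduced (sroot_root j) (etrans (congr1 (fun a => a \in rts) (esym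
  a_eq)) ha).
  by apply/funext => v; rewrite Eb cj mul1r.
by exfalso; have := ler0n R (c j); rewrite cj oppr_ge0 ler10.
Qed.

(** A class containing [W_ea] in which only the parity of the pairings of the translation with the
    roots is recorded. The explicit adjoint [L'] makes closure under composition and inverses, and
    the action on affine roots, direct computations. *)
Definition even_isometry f : Prop :=
  exists (L L' : E -> E) (y : E),
  [/\ [/\ forall u v, L (u + v) = L u + L v, forall c v, L (c *: v) = c *: L v,
      cancel L L', cancel L' L & forall u v, dot (L u) v = dot u (L' v)],
      forall a, a \in rts -> L a \in rts, forall a, a \in rts -> L' a \in rts,
      forall a, a \in rts -> exists k : int, dot a y = (2 * k)%:~R
    & f = fun v => L v + y].

Lemma inverseD (L L' : E -> E) : cancel L L' ->
  (forall u v, L (u + v) = L u + L v) -> cancel L' L ->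
  forall u v, L' (u + v) = L' u + L' v.
Proof. by move=> K h K' u v; apply: (can_inj K); rewrite h !K'. Qed.

Lemma even_isometry_comp f g :
  even_isometry f -> even_isometry g -> even_isometry (f \o g).
Proof.
move=> [L [L' [y [[hD hZ hK hK' hdot] hr hr' hy ->]]]].
move=> [M [M' [z [[gD gZ gK gK' gdot] gr gr' gz ->]]]].
exists (L \o M), (M' \o L'), (L z + y); split.
- split=> /= *; rewrite ?gD ?hD ?gZ ?hZ ?hdot ?gdot //; exact: can_comp.
- by move=> a /gr /hr.
- by move=> a /hr' /gr'.
- move=> a ha; have [k hk] := hy a ha; have [l hl] := gz _ (hr' _ ha).
  by exists (l + k); rewrite dotDr hk dotC hdot dotC hl -rmorphD -mulrDr.
- by apply/funext => v /=; rewrite hD addrA.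
Qed.

Lemma even_isometry_inv f : even_isometry f ->
  exists g, [/\ even_isometry g, cancel f g & cancel g f].
Proof.
move=> [L [L' [y [[hD hZ hK hK' hdot] hr hr' hy ->]]]].
have D' := inverseD hK hD hK'.
have Z' c v : L' (c *: v) = c *: L' v by apply: (can_inj hK); rewrite hZ !hK'.
exists (fun v => L' v + L' (- y)); split.
- exists L', L, (L' (- y)); split=> //.
    by split=> // u v; rewrite dotC -hdot dotC.
  move=> a ha; have [k hk] := hy _ (hr _ ha); exists (- k).
  by rewrite -hdot dotNr hk mulrN rmorphN.
- by move=> v; rewrite -D' addrK hK.
- by move=> v; rewrite -D' hK' subrK.
Qed.

(** Pulling a + 2m back along v -> L v + y gives L' a + (2m + <a, y>), and <a, y> is even. *)
Lemma aroot_comp b f : even_isometry f -> aroot b -> aroot (b \o f).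
Proof.
move=> [L [L' [y [[hD hZ hK hK' hdot] hr hr' hy ->]]]] [a [m [ha ->]]].
have [k hk] := hy a ha; exists (L' a), (k + m); split; first exact: hr'.
apply/funext => v; rewrite /affine /= dotDr hk (dotC a) hdot dotC.
by rewrite mulrDr rmorphD addrA.
Qed.

Lemma weyl_isometry w : @weyl R Phi w -> exists L',
  [/\ [/\ forall u v, w (u + v) = w u + w v, forall c v, w (c *: v) = c *: w v,
      cancel w L', cancel L' w & forall u v, dot (w u) v = dot u (L' v)],
      forall a, a \in rts -> w a \in rts & forall a, a \in rts -> L' a \in rts].
Proof.
elim=> [|a {}w ha _ [L' [[hD hZ hK hK' hd] hr hr']]]; first by exists id.
have na := root_neq0 ha; have aK := reflectionK na.
exists (L' \o reflection a); split=> /=.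
- split=> /= *; rewrite ?hD ?reflectionD ?hZ ?reflectionZ ?dot_reflection ?hd //.
  + exact: can_comp.
  + exact: can_comp.
- by move=> b hb; apply/roots_refl/hr.
- by move=> b hb; apply/hr'/roots_refl.
Qed.

Lemma W_ea_isometry w : W_ea w -> even_isometry w.
Proof.
move=> [u [y [/weyl_isometry[L' [h hr hr']] [_ hy] ->]]].
by exists u, L', y.
Qed.

Lemma weyl_reflection a : a \in rts -> @weyl R Phi (reflection a).
Proof. by move=> ha; have := weyl_refl ha (@weyl_id R Phi). Qed.

Lemma weyl_comp u v : @weyl R Phi u -> @weyl R Phi v -> @weyl R Phi (u \o v).
Proof. by elim=> [//|a w ha _ IH] hv; apply: weyl_refl ha (IH hv). Qed.

Lemma coroot_latticeD y z :
  @coroot_lattice R Phi y -> @coroot_lattice R Phi z -> @coroot_lattice R Phi (y + z).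
Proof.
move=> [m ->] [n ->]; exists (fun a => m a + n a).
by rewrite -big_split; apply: eq_bigr => a _; rewrite /= mulrzDr.
Qed.

Lemma coroot_lattice_coroot a (k : int) : a \in rts ->
  @coroot_lattice R Phi (coroot a *~ k).
Proof.
move=> ha; exists (fun c : E => if c == a then k else 0).
rewrite (bigD1_seq a) ?roots_uniq //= eqxx big1_seq ?addr0 // => b /andP[/negPf -> _].
exact: mulr0z.
Qed.

Lemma coroot_lattice_int a y : a \in rts -> @coroot_lattice R Phi y ->
  exists k : int, dot a y = k%:~R.
Proof.
move=> ha [n ->]; exists (\sum_(b <- rts) pairing b a * n b).
rewrite dot_sumr rmorph_sum /= !big_seq; apply: eq_bigr => b hb.
by rewrite -scaler_int dotZr rmorphM /= pairingE // mulrC.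
Qed.

Lemma even_lattice_weyl w y : @weyl R Phi w -> @even_lattice R Phi y ->
  @even_lattice R Phi (w y).
Proof.
move=> hw hy; elim: hw => [//|a {}w ha _ [h1 h2]].
rewrite /=; move: (w y) h1 h2 => z h1 h2.
have [k hk] := coroot_lattice_int ha h1.
have [l hl] := h2 a ha.
split.
  by rewrite /reflection /= hk scaler_int -mulrNz;
    apply/(coroot_latticeD h1)/coroot_lattice_coroot.
move=> b hb; have [m hm] := h2 b hb; exists (m - l * pairing a b).
rewrite /reflection /= dotDr dotNr dotZr hm hl -pairingE //.
by rewrite -rmorphM -rmorphB /=; congr _%:~R; ring.
Qed.

Lemma even_latticeD y z : @even_lattice R Phi y -> @even_lattice R Phi z ->
  @even_lattice R Phi (y + z).
Proof.
move=> [h1 h2] [h3 h4]; split; first exact: coroot_latticeD.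
move=> a ha; have [k hk] := h2 a ha; have [l hl] := h4 a ha.
by exists (k + l); rewrite dotDr hk hl -rmorphD mulrDr.
Qed.

Lemma W_ea_comp f g : @W_ea R Phi f -> @W_ea R Phi g -> W_ea (f \o g).
Proof.
move=> [u [y [hu hy ->]]] [v [z [hv hz ->]]].
exists (u \o v), (u z + y); split; first exact: weyl_comp.
  exact/even_latticeD/hy/even_lattice_weyl.
have [L' [[hD _ _ _ _] _ _]] := weyl_isometry hu.
by apply/funext => x /=; rewrite hD addrA.
Qed.

Lemma gen_W_ea j : @W_ea R Phi (gen j).
Proof.
case: j => [i|] /=.
  exists (reflection (smp i)), 0; split; first exact/weyl_reflection/simple_root.
    split; first by exists (fun=> 0); rewrite big1.
    by move=> a _; exists 0; rewrite dotC dot0l.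
  by apply/funext => v; rewrite addr0.
exists (reflection low), (coroot low *~ (-2)); split.
- exact/weyl_reflection/lowest_root.
- split; first exact/coroot_lattice_coroot/lowest_root.
  move=> a ha; exists (- pairing low a).
  rewrite -scaler_int dotZr -pairingE ?lowest_root // -rmorphM /=.
  by congr _%:~R; ring.
- by apply/funext => v; rewrite /w_af mulrNz.
Qed.

End AffineRoots.

(** * Lengths *)

Section Coxeter.
Variables (R : realType) (Phi : root_system R).
Local Notation E := 'rV[R]_(rk Phi).
Local Notation I := (option 'I_(rk Phi)).
Local Notation alc := (@alcove R Phi).
Local Notation gen := (@coxeter_gen R Phi).
Local Notation wval := (@word_value R Phi).
Local Notation saff := (@saff R Phi).
Implicit Types (b : E -> R) (f g : E -> E) (s t : seq I).

Lemma word_cat s t v : wval (s ++ t) v = wval s (wval t v).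
Proof. by elim: s => //= j s IH; rewrite IH. Qed.

Lemma word_rcons s j v : wval (rcons s j) v = wval s (gen j v).
Proof. by rewrite -cats1 word_cat. Qed.

Lemma word_revK s : cancel (wval s) (wval (rev s)).
Proof.
elim: s => [//|j s IH] v; rewrite rev_cons word_rcons /= -[coxeter_gen _ _]/(gen j _).
by rewrite genK IH.
Qed.

Lemma word_revK' s : cancel (wval (rev s)) (wval s).
Proof. by move=> v; rewrite -{1}(revK s) word_revK. Qed.

Lemma gen_isometry j : @even_isometry R Phi (gen j).
Proof. exact/W_ea_isometry/gen_W_ea. Qed.

Lemma word_W_ea s : @W_ea R Phi (wval s).
Proof.
elim: s => [|j s IH]; last exact: W_ea_comp (gen_W_ea j) IH.
exists id, 0; split; first exact: weyl_id.
  split; first by exists (fun=> 0); rewrite big1.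
  by move=> a _; exists 0; rewrite dotC dot0l.
by apply/funext => v; rewrite addr0.
Qed.

Lemma word_isometry s : @even_isometry R Phi (wval s).
Proof. exact/W_ea_isometry/word_W_ea. Qed.

(** An isometry conjugates the reflection in a hyperplane into the reflection in its image; the
    hypothesis says that f carries the wall of [saff i] to that of [saff j]. *)
Lemma gen_conj i j f : even_isometry f ->
  (forall v, saff j (f v) = saff i v) -> forall v, gen j (f v) = f (gen i v).
Proof.
move=> [L [L' [y [[hD hZ hK hK' hdot] hr hr' hy ->]]]] h v.
have EL : sroot j = L (sroot i).
  apply: (can_inj hK'); rewrite hK.
  pose k := saff j y; have hk : k = (sconst i)%:~R.
    have := h 0; rewrite /saff /affine (dotC (sroot i)) dot0l add0r => <-.
    by have := hZ 0 0; rewrite !scale0r => ->; rewrite add0r.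
  apply: dot_inj => w; have := h w; rewrite /saff /affine -hk /k /saff /affine.
  rewrite dotDr (dotC (sroot j) (L w)) hdot dotC -addrA; exact: addIr.
have LB c u w : L (u - c *: w) = L u - c *: L w by rewrite -scaleNr hD hZ scaleNr.
rewrite !coxeter_genE h LB EL addrAC; congr (_ - _ *: _ + _).
by rewrite /coroot hZ hdot hK.
Qed.

(* The reflection [gen x] at which the inversion of [saff j] occurs is deleted. *)
Lemma exchange s j : @negative R Phi (fun v => saff j (wval (rev s) v)) ->
  exists2 s', size s = (size s').+1 & wval s' =1 wval s \o gen j.
Proof.
elim: s => [|x s IH] hn.
  by case: (positive_not_negative (@saff_pos R Phi j)).
have ha : @aroot R Phi (saff j \o wval (rev s)).
  exact/aroot_comp/saff_aroot/word_isometry.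
have E : (saff j \o wval (rev s)) \o gen x = fun v => saff j (wval (rev (x :: s)) v).
  by apply/funext => v; rewrite rev_cons word_rcons.
case: (aroot_pos_neg ha) => [hp|/IH[s' sz hs']]; last first.
  by exists (x :: s') => [|v]; rewrite /= ?sz // hs'.
have sE : saff j \o wval (rev s) = saff x.
  apply: (simple_refl_negative ha hp); first by rewrite E;
    apply/aroot_comp/saff_aroot/word_isometry.
  by move=> v hv; rewrite E; exact: hn.
exists s => // v; rewrite /= -[coxeter_gen _ _]/(gen x _).
have hc := gen_conj (word_isometry (rev s)) (fun v => congr1 (@^~ v) sE).
have := hc (wval s v); rewrite word_revK => hc'.
by rewrite hc' word_revK' genK.
Qed.

Definition alcove_stable f : Prop := forall v, alc (f v) <-> alc v.

(** Freeness of the action of W_af on alcoves. If the word s followed by j stabilises the alcove,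
    then [saff j] is negative after the inverse of s; by [exchange] the letter j cancels against a
    letter of s, and the word gets shorter by two. *)
Lemma word_alcove_stable_id n s : (size s <= n)%N ->
  alcove_stable (wval s) -> wval s =1 id.
Proof.
elim: n s => [|n IH] s; first by rewrite leqn0 size_eq0 => /eqP ->.
case/lastP: s => [//|s j]; rewrite size_rcons ltnS => hs st.
have hn : @negative R Phi (fun v => saff j (wval (rev s) v)).
  move=> v hv; have := @saff_pos R Phi j (wval (rev (rcons s j)) v).
  rewrite -st word_revK' => /(_ hv); rewrite rev_rcons /= -[coxeter_gen _ _]/(gen j _).
  by rewrite saff_gen oppr_gt0.
have [s' sz hs'] := exchange hn.
have Es : wval (rcons s j) =1 wval s' by move=> v; rewrite word_rcons hs'.
move=> v; rewrite Es; apply: IH => [|u].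
  by rewrite (leq_trans _ hs) // sz.
by rewrite -Es; exact: st.
Qed.

Lemma Omega_stable f : @Omega R Phi f -> alcove_stable f.
Proof.
move=> [/W_ea_isometry/even_isometry_inv[g [_ K _]] h] v; split=> [|hv].
  by rewrite -[X in X (f v)]h => -[u hu /(can_inj K) <-].
by rewrite -[X in X (f v)]h; exists v.
Qed.

(* The alcove stabiliser permutes the simple affine roots: [w' s_j w] makes some
   simple affine root negative. *)
Lemma Omega_conj w j : @Omega R Phi w ->
  exists i, forall v, gen j (w v) = w (gen i v).
Proof.
move=> hw; have st := Omega_stable hw; have wI := W_ea_isometry (proj1 hw).
have [w' [w'I K K']] := even_isometry_inv wI.
pose r v := w' (gen j (w v)).
have rI : @even_isometry R Phi r.
  by apply: even_isometry_comp w'I _; apply: even_isometry_comp wI; exact: gen_isometry.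
have st' : alcove_stable w' by move=> v; rewrite -st K'.
(* [saff j \o w] is positive on the alcove, hence a nonnegative combination of the simple affine
   roots. If all of these stayed positive after r, it would be nonnegative at [r v]; but its value
   there is minus that at v. *)
have [i hi] : exists i, ~ @positive R Phi (saff i \o r).
  apply: contrapT => h.
  have {}h i : @positive R Phi (saff i \o r) by apply: contrapT => ?; apply: h; exists i.
  have pw : @positive R Phi (saff j \o w) by move=> v hv; apply/saff_pos/st.
  have aw := aroot_comp wI (saff_aroot j).
  have [c hc] := positive_nat_comb aw pw.
  have [v hv] := @alcove_nonempty R Phi.
  have : 0 <= saff j (w (r v)).
    have := hc (r v); rewrite /= => ->; apply: sumr_ge0 => k _.
    by rewrite mulr_ge0 // ltW // h.
  rewrite /r K' saff_gen oppr_ge0 leNgt => /negP; apply; exact: pw.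
have [//|hn] := aroot_pos_neg (aroot_comp rI (saff_aroot i)).
exists i; apply: gen_conj wI _.
have ai : @aroot R Phi (saff i \o w') by exact/aroot_comp/saff_aroot.
have E : saff i \o w' = saff j.
  apply: simple_refl_negative => //.
  - by move=> v hv; apply/saff_pos/st'.
  - by apply: aroot_comp ai; exact: gen_isometry.
  - by move=> v hv; have := hn (w' v); rewrite /r /= K'; apply; apply/st'.
by move=> v; rewrite -E /= K.
Qed.

Lemma Omega_conj_word w s : @Omega R Phi w ->
  exists2 s', size s' = size s & forall v, wval s (w v) = w (wval s' v).
Proof.
move=> hw; elim: s => [|j s [s' sz hs']]; first by exists [::].
have [i hi] := Omega_conj j hw.
by exists (i :: s') => [|v]; rewrite /= ?sz // hs' hi.
Qed.

(* Every letter of [t] lengthens the product to its left, starting from [f]. *)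
Fixpoint increasing f t : Prop :=
  if t is j :: t' then
    (forall g, cancel f g -> cancel g f -> @positive R Phi (saff j \o g)) /\
    increasing (f \o gen j) t'
  else True.

(** If a letter of t failed to lengthen, [exchange] would delete a letter of s together with it and
    give a shorter word for the whole product. The factor f does not disturb signs since it
    preserves the alcove. *)
Lemma increasing_reduced f s t : alcove_stable f -> even_isometry f ->
  (forall z, wval z =1 wval (s ++ t) -> (size s + size t <= size z)%N) ->
  increasing (f \o wval s) t.
Proof.
move=> st fI; elim: t s => [//|j t IH] s min; split.
  move=> g K K'.
  have [f' [f'I Kf Kf']] := even_isometry_inv fI.
  have Eg : g =1 wval (rev s) \o f'.
    by move=> v; rewrite -{2}(K' v) /= Kf word_revK.
  have st' : alcove_stable f' by move=> v; rewrite -st Kf'.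
  have ha : @aroot R Phi (saff j \o wval (rev s)).
    exact/aroot_comp/saff_aroot/word_isometry.
  have [hp v hv|hn] := aroot_pos_neg ha; first by rewrite /= Eg; apply/hp/st'.
  have [s' sz hs'] := exchange hn.
  have /min : wval (s' ++ t) =1 wval (s ++ j :: t).
    by move=> v; rewrite !word_cat hs'.
  by rewrite size_cat sz /=; lia.
have -> : (f \o wval s) \o gen j = f \o wval (rcons s j).
  by apply/funext => v; rewrite /= word_rcons.
apply: IH => z hz; have := min z; rewrite -cats1 -catA in hz.
by rewrite size_rcons /= addSnnS; apply.
Qed.

(** The alcove stabiliser e2 of w2 is moved to the left of the word of w1, which keeps its size.
    Then w1 w2 is e1 e2 followed by the concatenation of two words of sizes l1 and l2, and
    additivity of lengths says that this concatenation is reduced. *)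
Lemma length_additive w1 w2 l1 l2 :
  @length_ea R Phi w1 l1 -> @length_ea R Phi w2 l2 ->
  @length_ea R Phi (w1 \o w2) (l1 + l2) ->
  exists w t, [/\ @Omega R Phi w, w2 = w \o wval t & increasing (w1 \o w) t].
Proof.
move=> [e1 [u1 [he1 _ E1 [[s1 sz1 hs1] _]]]].
move=> [e2 [u2 [he2 _ E2 [[t sz2 ht] _]]]].
move=> [e [u [he _ E [[z szz hz] min]]]].
exists e2, t; split; rewrite ?ht //.
have [s sz hs] := Omega_conj_word s1 he2.
have -> : w1 \o e2 = (e1 \o e2) \o wval s.
  by apply/funext => v; rewrite E1 /= -hs1 hs.
have e1I := W_ea_isometry (proj1 he1); have e2I := W_ea_isometry (proj1 he2).
have st1 := Omega_stable he1; have st2 := Omega_stable he2.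
have st := Omega_stable he.
apply: increasing_reduced => [v||y hy]; first by rewrite /= st1 st2.
  exact: even_isometry_comp.
rewrite sz sz1 sz2; apply: min; apply/funext => v.
have [e' [_ K K']] := even_isometry_inv (W_ea_isometry (proj1 he)).
have Ew x : e (u x) = e1 (e2 (wval y x)).
  have := congr1 (@^~ x) E; rewrite /= => <-.
  by rewrite E1 E2 /= -hs1 -ht hs hy word_cat.
(* The decomposition e u of w1 w2 comes with its own e. The quotient of u by the word y equals e^-1
   e1 e2, which stabilises the alcove; being the value of a word, it is the identity. So y is a word
   for u and [min] applies. *)
have Ez x : wval (z ++ rev y) x = e' (e1 (e2 x)).
  rewrite word_cat hz; apply: (can_inj K); rewrite Ew K'.
  by rewrite word_revK'.
have := @word_alcove_stable_id _ (z ++ rev y) (leqnn _).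
have stz : alcove_stable (wval (z ++ rev y)).
  by move=> x; rewrite Ez -st K' st1 st2.
by move=> /(_ stz (wval y v)); rewrite word_cat word_revK hz.
Qed.

End Coxeter.

(** * The adjoint action *)

Section MatrixExponential.
Variables (F : fieldType) (n : nat).
Hypothesis F0 : forall m, m.+1%:R != 0 :> F.
Implicit Types A B C D : 'M[F]_n.

Lemma fact_neq0 k : (k`!)%:R != 0 :> F.
Proof. by have := fact_gt0 k; case: (k`!). Qed.

Definition mexp A (t : F) : 'M[F]_n := \sum_(k < n) (t ^+ k / (k`!)%:R) *: (A ^+ k).

Lemma mexp_widen A t m : A ^+ n = 0 -> (n <= m)%N ->
  mexp A t = \sum_(k < m) (t ^+ k / (k`!)%:R) *: (A ^+ k).
Proof.
move=> hA hm; rewrite /mexp (big_ord_widen m (fun k => (t ^+ k / (k`!)%:R) *: (A ^+ k))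
  hm).
rewrite [RHS](bigID (fun k : 'I_m => (k < n)%N)) /= [X in _ = _ + X]big1 ?addr0 // => k.
rewrite -leqNgt => h; have -> : A ^+ k = 0 by rewrite -(subnK h) exprD hA mulr0.
by rewrite scaler0.
Qed.

(** Left multiplication by A is right multiplication plus ad A, and these commute: this is the
    binomial expansion, cut off because (ad A)^3 kills B. Where the predecessors of k truncate, the
    coefficients are zero. *)
Lemma expr_comm2 A B C D k : A *m B = B *m A + C -> A *m C = C *m A + D ->
  A *m D = D *m A ->
  A ^+ k *m B = B *m A ^+ k + k%:R *: (C *m A ^+ k.-1)
                + 'C(k, 2)%:R *: (D *m A ^+ k.-2).
Proof.
move=> hB hC hD; elim: k => [|k IH].
  by rewrite !expr0 !scale0r !addr0 mul1mx mulmx1.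
rewrite exprS -[A * _]/(A *m _) -mulmxA IH !mulmxDr -!scalemxAr !mulmxA hB hC hD.
rewrite !mulmxDl -!mulmxA -!addrA; congr (_ + _).
have S1 : k%:R *: (C *m (A *m A ^+ k.-1)) = k%:R *: (C *m A ^+ k).
  by case: k {IH} => [|k]; rewrite ?scale0r // -[A *m _]/(A * _) -exprS.
have S2 : 'C(k, 2)%:R *: (D *m (A *m A ^+ k.-2)) = 'C(k, 2)%:R *: (D *m A ^+ k.-1).
  case: k {IH S1} => [|[|k]]; rewrite ?bin0n ?bin1 ?scale0r //.
  by rewrite -[A *m _]/(A * _) -exprS.
rewrite !scalerDr S1 S2 /= binS bin1 (addnC 'C(k, 2)) !natrD !scalerDl -!addrA.
by rewrite [LHS]addrA; congr (_ + _); rewrite -[X in X + _]scale1r -scalerDl -natr1 addrC.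
Qed.

(** Conjugation by exp(tA) is exp(t ad A), which stops at second order here. *)
Lemma mexp_comm2 A B C D t : A ^+ n = 0 ->
  A *m B = B *m A + C -> A *m C = C *m A + D -> A *m D = D *m A ->
  mexp A t *m B = (B + t *: C + (t ^+ 2 / 2%:R) *: D) *m mexp A t.
Proof.
move=> hA hB hC hD.
(* With n + 2 terms, removing the first one or two and shifting the index still leaves at least the
   n terms of the exponential. *)
rewrite {1}(mexp_widen t hA (leq_addl 2 n)) mulmx_suml.
transitivity (\sum_(k < n.+2) ((t ^+ k / (k`!)%:R) *: (B *m A ^+ k)
   + (t ^+ k / (k`!)%:R * k%:R) *: (C *m A ^+ k.-1)
   + (t ^+ k / (k`!)%:R * 'C(k, 2)%:R) *: (D *m A ^+ k.-2))).
  by apply: eq_bigr => k _; rewrite -scalemxAl (expr_comm2 _ hB hC hD) !scalerDr !scalerA.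
rewrite !big_split /= !mulmxDl; congr (_ + _ + _).
- rewrite (mexp_widen t hA (leq_addl 2 n)) mulmx_sumr.
  by apply: eq_bigr => k _; rewrite -scalemxAr.
- rewrite big_ord_recl /= mulr0 scale0r add0r (mexp_widen t hA (leq_addl 1 n)) mulmx_sumr.
  apply: eq_bigr => k _; rewrite /bump /= add1n -scalemxAl -scalemxAr scalerA.
  congr (_ *: _); rewrite factS natrM exprS.
  move: (F0 k) (fact_neq0 k); move: (k.+1%:R) ((k`!)%:R) => x y hx hy.
  by field; rewrite hx hy.
- rewrite !big_ord_recl /= !mulr0 !scale0r !add0r (mexp_widen t hA (leqnn n)) mulmx_sumr.
  apply: eq_bigr => k _; rewrite /bump /= !add1n -scalemxAl -scalemxAr scalerA.
  congr (_ *: _); have bin2' : ('C(k.+2, 2)%:R * 2%:R = k.+2%:R * k.+1%:R :> F).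
    by rewrite -!natrM mulnC -(mul_bin_diag k.+2 1) bin1.
  have -> : 'C(k.+2, 2)%:R = k.+2%:R * k.+1%:R / 2%:R :> F.
    by rewrite -bin2' mulfK ?F0.
  rewrite !factS !natrM !exprS; move: (F0 k) (F0 k.+1) (fact_neq0 k).
  move: (k.+1%:R) (k.+2%:R) ((k`!)%:R) (F0 1) => x z y h2 hx hz hy.
  by field; rewrite hx hy hz h2.
Qed.

End MatrixExponential.

(** * Adjoint formulas for root, Weyl and torus elements *)

Section Adjoint.
Variables (R : realType) (Phi : root_system R) (F : fieldType).
Hypothesis F0 : forall m, m.+1%:R != 0 :> F.
Variable G : chevalley_group Phi F.
Local Notation E := 'rV[R]_(rk Phi).
Local Notation rts := (Defs.roots Phi).
Local Notation M := 'M[F]_(chev_dim G).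
Local Notation x_ := (@chev_x R Phi F G).
Implicit Types (a b : E) (g : G) (X Y : M) (t u : F).

Definition root_mx a : M := map_mx intr (root_vec G a).
Local Notation e_ := root_mx.
Definition lie X Y : M := X *m Y - Y *m X.
Definition cartan_mx a : M := locked (lie (e_ a) (e_ (- a))).
Local Notation h_ := cartan_mx.
Lemma cartan_mxE a : h_ a = lie (e_ a) (e_ (- a)).
Proof. by rewrite /cartan_mx -lock. Qed.
Definition Ad g X : M := chev_mx g *m X *m chev_mx g^-1%g.

Lemma chev_mxV g : chev_mx g *m chev_mx g^-1%g = 1%:M.
Proof. by rewrite -chev_mxM mulgV chev_mx1. Qed.
Lemma chev_mxV' g : chev_mx g^-1%g *m chev_mx g = 1%:M.
Proof. by rewrite -chev_mxM mulVg chev_mx1. Qed.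

Lemma AdM g g' X : Ad (g * g')%g X = Ad g (Ad g' X).
Proof. by rewrite /Ad invgM !chev_mxM !mulmxA. Qed.
Lemma Ad1 X : Ad 1%g X = X.
Proof. by rewrite /Ad invg1 chev_mx1 mul1mx mulmx1. Qed.
Lemma AdK g : cancel (Ad g) (Ad g^-1%g).
Proof. by move=> X; rewrite -AdM mulVg Ad1. Qed.
Lemma AdVK g : cancel (Ad g^-1%g) (Ad g).
Proof. by move=> X; rewrite -AdM mulgV Ad1. Qed.
Lemma AdD g X Y : Ad g (X + Y) = Ad g X + Ad g Y.
Proof. by rewrite /Ad mulmxDr mulmxDl. Qed.
Lemma AdZ g t X : Ad g (t *: X) = t *: Ad g X.
Proof. by rewrite /Ad -scalemxAr -scalemxAl. Qed.
Lemma AdN g X : Ad g (- X) = - Ad g X.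
Proof. by rewrite -scaleN1r AdZ scaleN1r. Qed.
Lemma Ad0 g : Ad g 0 = 0.
Proof. by have := AdZ g 0 0; rewrite !scale0r. Qed.
Lemma Ad_mul g X Y : Ad g (X *m Y) = Ad g X *m Ad g Y.
Proof.
by rewrite /Ad !mulmxA -(mulmxA _ (chev_mx g^-1%g)) chev_mxV' mulmx1.
Qed.
Lemma Ad_lie g X Y : Ad g (lie X Y) = lie (Ad g X) (Ad g Y).
Proof. by rewrite /lie AdD AdN !Ad_mul. Qed.
Lemma Ad_sum g (I : Type) (r : seq I) (P : pred I) (f : I -> M) :
  Ad g (\sum_(i <- r | P i) f i) = \sum_(i <- r | P i) Ad g (f i).
Proof. by apply: (big_morph (Ad g)) => [X Y|]; rewrite ?AdD ?Ad0. Qed.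
Lemma Ad_eq0 g X : (Ad g X == 0) = (X == 0).
Proof. by rewrite -{1}(Ad0 g) (inj_eq (can_inj (AdK g))). Qed.

Lemma lieZl t X Y : lie (t *: X) Y = t *: lie X Y.
Proof. by rewrite /lie -scalemxAl -scalemxAr scalerBr. Qed.
Lemma lieZr t X Y : lie X (t *: Y) = t *: lie X Y.
Proof. by rewrite /lie -scalemxAl -scalemxAr scalerBr. Qed.
Lemma lieC X Y : lie X Y = - lie Y X.
Proof. by rewrite /lie opprB. Qed.
Lemma liexx X : lie X X = 0.
Proof. exact: subrr. Qed.
Lemma lie0l X : lie 0 X = 0.
Proof. by have := lieZl 0 0 X; rewrite !scale0r. Qed.
Lemma jacobi X Y Z : lie X (lie Y Z) = lie (lie X Y) Z + lie Y (lie X Z).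
Proof.
rewrite /lie !mulmxBl !mulmxBr !mulmxA !opprB.
move: (X *m Y *m Z) (X *m Z *m Y) (Y *m Z *m X) (Z *m Y *m X) (Y *m X *m Z) (Z *m X *m Y).
by move=> *; apply/matrixP => i j; rewrite !mxE; ring.
Qed.

Lemma lie_map (A B : 'M[int]_(chev_dim G)) :
  lie (map_mx intr A) (map_mx intr B) = map_mx intr (bracket A B).
Proof. by rewrite /lie /bracket map_mxB !map_mxM. Qed.

Definition chev_sign a b : F := (chev_c G a b)%:~R.

Lemma chev_sign_neq0 a b : a \in rts -> b \in rts -> a + b \in rts -> chev_sign a b != 0.
Proof.
move=> ha hb hab; rewrite /chev_sign; case: (chev_c_sign G ha hb hab) => ->.
  exact: oner_neq0.
by rewrite mulrN1z oppr_eq0 oner_neq0.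
Qed.

Lemma lie_root a b : a \in rts -> b \in rts -> a + b \in rts ->
  lie (e_ a) (e_ b) = chev_sign a b *: e_ (a + b).
Proof.
move=> ha hb hab; rewrite lie_map (chev_bracket_root G ha hb hab).
by apply/matrixP => i j; rewrite !mxE rmorphM.
Qed.

Lemma lie_root0 a b : a \in rts -> b \in rts -> a + b \notin rts -> a + b != 0 ->
  lie (e_ a) (e_ b) = 0.
Proof.
by move=> ha hb hab h0; rewrite lie_map (chev_bracket0 G ha hb hab h0) map_mx0.
Qed.

Lemma lie_cartan a b : a \in rts -> b \in rts ->
  lie (h_ a) (e_ b) = (pairing a b)%:~R *: e_ b.
Proof.
move=> ha hb; rewrite cartan_mxE !lie_map.
rewrite (chev_bracket_cartan G ha hb (pairingE ha hb)).
by apply/matrixP => i j; rewrite !mxE rmorphM.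
Qed.

Lemma h_opp a : h_ (- a) = - h_ a.
Proof. by rewrite !cartan_mxE opprK lieC. Qed.

Lemma pairingxx a : a \in rts -> pairing a a = 2.
Proof.
move=> ha; case: (pairingP ha ha) => //.
- move=> Ea; have : 2%:R *: a == 0 by rewrite scaler_nat mulr2n {2}Ea subrr.
  by rewrite scaler_eq0 pnatr_eq0 /= (negPf (root_neq0 ha)).
all: by move=> _ _ _; rewrite addNr eqxx.
Qed.

Lemma pairingxN a b : a \in rts -> b \in rts -> pairing a (- b) = - pairing a b.
Proof.
move=> ha hb; apply: (@intr_inj R); rewrite rmorphN /= !pairing_dot ?root_opp //.
by rewrite !dotNr mulrN mulNr.
Qed.

Lemma pairingD a b c : a \in rts -> b \in rts -> c \in rts -> b + c \in rts ->
  pairing a (b + c) = pairing a b + pairing a c.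
Proof.
move=> ha hb hc hbc; apply: (@intr_inj R); rewrite rmorphD /= !pairing_dot //.
by rewrite dotDr; ring.
Qed.

Lemma e_exp a k : map_mx intr (root_vec G a ^+ k) = e_ a ^+ k.
Proof.
by elim: k => [|k IH]; rewrite ?expr0 ?map_mx1 // !exprS -IH map_mxM.
Qed.

Lemma e_nilpotent a : a \in rts -> e_ a ^+ chev_dim G = 0.
Proof. by move=> ha; rewrite -e_exp (chev_nilpotent G ha) map_mx0. Qed.

(** Admissibility makes the integer division in [divided_power] exact, so over F it becomes division
    by k!. *)
Lemma chev_x_mexp a t : a \in rts -> chev_mx (x_ a t) = mexp (e_ a) t.
Proof.
move=> ha; rewrite chev_xE //; apply: eq_bigr => k _; rewrite -e_exp -scalerA;
  congr (_ *: _).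
apply/matrixP => i j; rewrite !mxE.
have /dvdzP[z hz] := chev_admissible k i j ha; rewrite hz mulzK; last first.
  by rewrite eqz_nat -lt0n fact_gt0.
by rewrite rmorphM /= mulrC -mulrA divff ?mulr1 // fact_neq0.
Qed.

Lemma Ad_x a t X Y Z : a \in rts -> lie (e_ a) X = Y -> lie (e_ a) Y = Z ->
  lie (e_ a) Z = 0 -> Ad (x_ a t) X = X + t *: Y + (t ^+ 2 / 2%:R) *: Z.
Proof.
have lieE A B C : lie A B = C -> A *m B = B *m A + C by move=> <-; rewrite addrC subrK.
move=> ha /lieE hX /lieE hY /lieE; rewrite addr0 => hZ.
rewrite /Ad (chev_x_mexp t ha) (mexp_comm2 F0 t (e_nilpotent ha) hX hY hZ).
by rewrite -mulmxA -(chev_x_mexp t ha) chev_mxV mulmx1.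
Qed.

Lemma Ad_x0 a t X : a \in rts -> lie (e_ a) X = 0 -> Ad (x_ a t) X = X.
Proof.
move=> ha h; rewrite (Ad_x t ha h _ (Z := 0)) ?scaler0 ?addr0 //.
all: by rewrite lieC lie0l oppr0.
Qed.

Lemma Ad_x1 a t X Y : a \in rts -> lie (e_ a) X = Y -> lie (e_ a) Y = 0 ->
  Ad (x_ a t) X = X + t *: Y.
Proof.
move=> ha h h'; rewrite (Ad_x t ha h h') ?scaler0 ?addr0 //.
by rewrite lieC lie0l oppr0.
Qed.

Lemma Ad_x_same a t : a \in rts -> Ad (x_ a t) (e_ a) = e_ a.
Proof. by move=> ha; apply: Ad_x0 (liexx _). Qed.

Lemma lie_e_h a b : a \in rts -> b \in rts ->
  lie (e_ a) (h_ b) = - (pairing b a)%:~R *: e_ a.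
Proof. by move=> ha hb; rewrite lieC lie_cartan // scaleNr. Qed.

Lemma Ad_x_h a b t : a \in rts -> b \in rts ->
  Ad (x_ a t) (h_ b) = h_ b - (t * (pairing b a)%:~R) *: e_ a.
Proof.
move=> ha hb; rewrite (Ad_x1 t ha (lie_e_h ha hb)) ?lieZr ?liexx ?scaler0 //.
by rewrite scaleNr scalerN scalerA.
Qed.

Lemma Ad_x_opp a t : a \in rts ->
  Ad (x_ a t) (e_ (- a)) = e_ (- a) + t *: h_ a - t ^+ 2 *: e_ a.
Proof.
move=> ha; rewrite (Ad_x t ha (esym (cartan_mxE a)) (lie_e_h ha ha)) ?lieZr ?liexx
  ?scaler0 //.
rewrite pairingxx // scalerA; congr (_ + _).
rewrite mulrN scaleNr; congr (- (_ *: _)).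
by rewrite divfK // (F0 1).
Qed.

Lemma Ad_x_fix a b t : a \in rts -> b \in rts -> a + b \notin rts -> a + b != 0 ->
  Ad (x_ a t) (e_ b) = e_ b.
Proof. by move=> *; apply/Ad_x0/lie_root0. Qed.

Lemma pairing_m1 a b : a \in rts -> b \in rts -> pairing a b = -1 ->
  [/\ a + b \in rts, a + b != 0, - a + b \notin rts & - a + b != 0].
Proof. by move=> ha hb; case: (pairingP ha hb). Qed.

Lemma pairing_1 a b : a \in rts -> b \in rts -> pairing a b = 1 ->
  [/\ - a + b \in rts, - a + b != 0, a + b \notin rts & a + b != 0].
Proof. by move=> ha hb; case: (pairingP ha hb). Qed.

Lemma Ad_x_move a b t : a \in rts -> b \in rts -> pairing a b = -1 ->
  Ad (x_ a t) (e_ b) = e_ b + (t * chev_sign a b) *: e_ (a + b).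
Proof.
move=> ha hb hp; have [hab _ _ _] := pairing_m1 ha hb hp.
have p : pairing a (a + b) = 1 by rewrite pairingD // pairingxx // hp.
have [_ _ h1 h2] := pairing_1 ha hab p.
by rewrite (Ad_x1 t ha (lie_root ha hb hab)) ?scalerA // lieZr lie_root0 ?scaler0.
Qed.

(** The Jacobi identity for -a, a and b, in which [e_{-a}, e_b] = 0. The relation is kept multiplied
    by e_b because e_b != 0 is only established in [e_neq0]. *)
Lemma chev_sign_inverse a b : a \in rts -> b \in rts -> pairing a b = -1 ->
  (chev_sign a b * chev_sign (- a) (a + b)) *: e_ b = e_ b.
Proof.
move=> ha hb hp; have [hab _ h1 h2] := pairing_m1 ha hb hp.
have hNa := root_opp ha.
have := jacobi (e_ (- a)) (e_ a) (e_ b).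
rewrite (lie_root0 hNa hb h1 h2) [lie _ 0]lieC lie0l oppr0 addr0.
rewrite lie_root // lieZr lie_root ?addKr // scalerA => ->.
by rewrite [lie (e_ (- a)) _]lieC -cartan_mxE -[- h_ a]scaleN1r lieZl lie_cartan // hp
  scalerA rmorphN1 mulN1r opprK scale1r.
Qed.

(* Locked, so that rewriting with group laws does not unfold them. *)
Definition chev_w a t : G := locked (w_elt x_ a t).
Definition chev_h a t : G := locked (h_elt x_ a t).
Local Notation w_ := chev_w.
Local Notation hh := chev_h.

Lemma chev_wE a t : w_ a t = w_elt x_ a t. Proof. by rewrite /chev_w -lock. Qed.
Lemma chev_h_elt a t : hh a t = h_elt x_ a t. Proof. by rewrite /chev_h -lock. Qed.
Lemma chev_hE a t : hh a t = (w_ a t * w_ a (- 1))%g.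
Proof. by rewrite chev_h_elt !chev_wE. Qed.

Lemma Ad_wE a t X : Ad (w_ a t) X = Ad (x_ a t) (Ad (x_ (- a) (- t^-1)) (Ad (x_ a t) X)).
Proof. by rewrite chev_wE /w_elt !AdM. Qed.

Lemma Ad_w_same a t : a \in rts -> t != 0 ->
  Ad (w_ a t) (e_ a) = - t ^- 2 *: e_ (- a).
Proof.
move=> ha t0; have hNa := root_opp ha.
rewrite Ad_wE Ad_x_same //; have := Ad_x_opp (- t^-1) hNa; rewrite opprK => ->.
rewrite h_opp !(AdD, AdN, AdZ) Ad_x_same // Ad_x_opp // Ad_x_h // pairingxx //.
move: (h_ a) (e_ a) (e_ (- a)) => X Y Z; apply/matrixP => i j; rewrite !mxE.
by rewrite -[2%:~R]/(2%:R); field.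
Qed.

Lemma Ad_w_opp a t : a \in rts -> t != 0 ->
  Ad (w_ a t) (e_ (- a)) = - t ^+ 2 *: e_ a.
Proof.
move=> ha t0; have hNa := root_opp ha.
rewrite Ad_wE Ad_x_opp // !(AdD, AdN, AdZ) (Ad_x_same _ hNa) Ad_x_h //.
have := Ad_x_opp (- t^-1) hNa; rewrite opprK => ->.
rewrite pairingxN // pairingxx // h_opp !(AdD, AdN, AdZ) Ad_x_same // Ad_x_opp //
  Ad_x_h // pairingxx //.
move: (h_ a) (e_ a) (e_ (- a)) => X Y Z; apply/matrixP => i j; rewrite !mxE.
by rewrite !rmorphN -[2%:~R]/(2%:R); field.
Qed.

Lemma Ad_w_0 a b t : a \in rts -> b \in rts -> pairing a b = 0 ->
  Ad (w_ a t) (e_ b) = e_ b.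
Proof.
move=> ha hb; case: (pairingP ha hb) => // h1 h2 h3 h4 _.
by rewrite Ad_wE !Ad_x_fix // root_opp.
Qed.

Lemma Ad_w_m1 a b t : a \in rts -> b \in rts -> t != 0 -> pairing a b = -1 ->
  Ad (w_ a t) (e_ b) = (t * chev_sign a b) *: e_ (a + b).
Proof.
move=> ha hb t0 hp; have [hab n1 h1 h2] := pairing_m1 ha hb hp.
have hNa := root_opp ha.
have p : pairing a (a + b) = 1 by rewrite pairingD // pairingxx // hp.
have [_ _ h3 h4] := pairing_1 ha hab p.
have p' : pairing (- a) (a + b) = -1 by rewrite pairingN // p.
rewrite Ad_wE (Ad_x_move t ha hb hp) AdD AdZ (Ad_x_fix _ hNa) // (Ad_x_move _ hNa hab p').
rewrite addKr scalerDr !scalerA addrCA.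
have -> : t * chev_sign a b * (- t^-1 * chev_sign (- a) (a + b)) = - (chev_sign a b *
  chev_sign (- a) (a + b)).
  by field.
by rewrite scaleNr chev_sign_inverse // addrC subrr add0r AdZ Ad_x_fix.
Qed.

Lemma Ad_w_1 a b t : a \in rts -> b \in rts -> t != 0 -> pairing a b = 1 ->
  Ad (w_ a t) (e_ b) = (- t^-1 * chev_sign (- a) b) *: e_ (- a + b).
Proof.
move=> ha hb t0 hp; have [hab n1 h1 h2] := pairing_1 ha hb hp.
have hNa := root_opp ha.
have p' : pairing (- a) b = -1 by rewrite pairingN // hp.
have p : pairing a (- a + b) = -1 by rewrite pairingD // pairingxN // pairingxx // hp.
have := chev_sign_inverse hNa hb p'; rewrite opprK => hc.
rewrite Ad_wE Ad_x_fix // (Ad_x_move _ hNa hb p') AdD AdZ Ad_x_fix // (Ad_x_move _ ha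
  hab p).
rewrite addNKr scalerDr !scalerA addrA addrAC.
have -> : - t^-1 * chev_sign (- a) b * (t * chev_sign a (- a + b)) = - (chev_sign (- a)
  b * chev_sign a (- a + b)).
  by field.
by rewrite scaleNr hc subrr add0r.
Qed.

Lemma Ad_w a b t : a \in rts -> b \in rts -> t != 0 ->
  exists2 c, c != 0 & Ad (w_ a t) (e_ b) = c *: e_ (reflection a b).
Proof.
move=> ha hb t0; rewrite pairing_refl //.
case E : _ / (pairingP ha hb) => [Eb|Eb|h1 h2 h3 h4|h1 h2 h3 h4|h1 h2 h3 h4].
- exists (- t ^- 2); first by rewrite oppr_eq0 invr_eq0 expf_neq0.
  by rewrite Eb Ad_w_same // mulrz_nat mulr2n opprD addrA subrr add0r.
- exists (- t ^+ 2); first by rewrite oppr_eq0 expf_neq0.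
  by rewrite Eb Ad_w_opp // mulrNz opprK mulrz_nat mulr2n addrA addNr add0r.
- by exists 1; rewrite ?oner_neq0 // Ad_w_0 // mulr0z subr0 scale1r.
- exists (t * chev_sign a b); first by rewrite mulf_neq0 // chev_sign_neq0.
  by rewrite Ad_w_m1 // mulrN1z opprK addrC.
- exists (- t^-1 * chev_sign (- a) b).
    by rewrite mulf_neq0 ?oppr_eq0 ?invr_eq0 // chev_sign_neq0 // root_opp.
  by rewrite Ad_w_1 // mulr1z addrC.
Qed.

Lemma Ad_h a b t : a \in rts -> b \in rts -> t != 0 ->
  Ad (hh a t) (e_ b) = t ^ pairing a b *: e_ b.
Proof.
move=> ha hb t0; have hNa := root_opp ha.
have n0 : (- 1 : F) != 0 by rewrite oppr_eq0 oner_neq0.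
rewrite chev_hE AdM.
case E : _ / (pairingP ha hb) => [Eb|Eb|h1 h2 h3 h4|h1 h2 h3 h4|h1 h2 h3 h4].
- rewrite Eb Ad_w_same // AdZ Ad_w_opp // scalerA; congr (_ *: _);
  rewrite -[t ^ 2]/(t ^+ 2).
  by field; rewrite oner_neq0.
- rewrite Eb Ad_w_opp // AdZ Ad_w_same // scalerA; congr (_ *: _).
  by rewrite -[t ^ -2]/(t ^- 2); field; rewrite ?oner_neq0.
- by rewrite !Ad_w_0 // expr0z scale1r.
- rewrite Ad_w_m1 // AdZ.
  have p : pairing a (a + b) = 1 by rewrite pairingD // pairingxx // E.
  rewrite Ad_w_1 // addKr scalerA -[X in _ = _ *: X](chev_sign_inverse ha hb) //
    scalerA; congr (_ *: _).
  by rewrite exprN1; field; rewrite ?oner_neq0.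
- rewrite Ad_w_1 // AdZ.
  have p : pairing a (- a + b) = -1 by rewrite pairingD // pairingxN // pairingxx // E.
  have p' : pairing (- a) b = -1 by rewrite pairingN // E.
  have := chev_sign_inverse hNa hb p'; rewrite opprK => hc.
  rewrite Ad_w_m1 // addNKr scalerA -[X in _ = _ *: X]hc scalerA; congr (_ *: _).
  by rewrite expr1z; field; rewrite ?oner_neq0.
Qed.

End Adjoint.

(** * The normaliser of the torus *)

(** Independence of simultaneous eigenvectors. No single operator has to separate all the
    eigenvalues, so the operator used for a pair of indices depends on the pair. *)
Lemma eigenvectors_free (K : fieldType) (V : lmodType K) (S : Type) (I : eqType)
    (D : S -> V -> V) (lam : S -> I -> K) (v : I -> V) (L : seq I) :
  (forall s c x y, D s (c *: x + y) = c *: D s x + D s y) ->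
  (forall s i, D s (v i) = lam s i *: v i) ->
  (forall i j, i \in L -> j \in L -> i != j -> exists s, lam s i != lam s j) ->
  uniq L -> \sum_(i <- L) v i = 0 -> forall i, i \in L -> v i = 0.
Proof.
move=> hD; have D0 s : D s 0 = 0 by have := hD s (-1) 0 0;
  rewrite !scaler0 !addr0 scaleN1r addNr.
have DZ s c x : D s (c *: x) = c *: D s x by rewrite -[c *: x]addr0 hD D0 !addr0.
have DD s x y : D s (x + y) = D s x + D s y by rewrite -[x]scale1r hD !scale1r.
elim: L v => [//|i0 L IH] v hv dist /andP[ni0 uL] hs.
have DS s : D s (\sum_(i <- i0 :: L) v i) = \sum_(i <- i0 :: L) D s (v i).
  by apply: (big_morph (D s)) => [x y|]; rewrite ?DD.
have vL i : i \in L -> v i = 0.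
  move=> iL; have ni : i != i0 by apply: contraNneq ni0 => <-.
  have := dist i i0; rewrite !in_cons iL eqxx orbT => /(_ isT isT ni)[s hs'].
  have h1 : \sum_(j <- L) (lam s j - lam s i0) *: v j = 0.
    have : \sum_(j <- i0 :: L) (lam s j - lam s i0) *: v j = 0.
      transitivity (D s (\sum_(i <- i0 :: L) v i) - lam s i0 *: \sum_(i <- i0 :: L) v i).
        rewrite DS scaler_sumr -sumrB; apply: eq_bigr => j _.
        by rewrite hv scalerBl.
      by rewrite hs D0 scaler0 subr0.
    by rewrite big_cons subrr scale0r add0r.
  have /eqP : (lam s i - lam s i0) *: v i = 0.
    apply: (IH (fun j => (lam s j - lam s i0) *: v j)) => // [s' j|j k jL kL jk].
      by rewrite DZ hv !scalerA mulrC.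
    by apply: dist; rewrite ?in_cons ?jL ?kL ?orbT.
  by rewrite scaler_eq0 subr_eq0 (negPf hs') => /eqP.
move=> i; rewrite in_cons => /orP[/eqP ->|/vL //].
by move: hs; rewrite big_cons big_seq big1 ?addr0 // => j /vL.
Qed.

Section NormalizerTorus.
Variables (R : realType) (Phi : root_system R) (F : fieldType).
Hypothesis F0 : forall m, m.+1%:R != 0 :> F.
Variable G : chevalley_group Phi F.
Local Notation E := 'rV[R]_(rk Phi).
Local Notation rts := (Defs.roots Phi).
Local Notation M := 'M[F]_(chev_dim G).
Local Notation x_ := (@chev_x R Phi F G).
Local Notation e_ := (@root_mx R Phi F G).
Local Notation h_ := (@cartan_mx R Phi F G).
Local Notation w_ := (@chev_w R Phi F G).
Local Notation hh := (@chev_h R Phi F G).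
Implicit Types (a b : E) (g n s : G) (X Y : M) (t u : F).

Lemma int_eq0 (k : int) : (k%:~R == 0 :> F) = (k == 0).
Proof.
by case: k => [[|k]|k]; rewrite ?NegzE ?rmorphN /= ?oppr_eq0 ?eqxx // (negPf (F0 _)).
Qed.

Lemma int_mx_eq0 (A : 'M[int]_(chev_dim G)) :
  (map_mx intr A == 0 :> M) = (A == 0).
Proof.
apply/eqP/eqP => [/matrixP h|->]; last exact: map_mx0.
by apply/matrixP => i j; have /eqP := h i j; rewrite !mxE int_eq0 => /eqP.
Qed.

Lemma dot_pairing0 a b : a \in rts -> b \in rts -> pairing a b = 0 -> dot a b = 0.
Proof.
move=> ha hb hp; have /eqP := pairing_dot ha hb; rewrite hp eq_sym !mulf_eq0 invr_eq0.
by rewrite dot_eq0 (negPf (root_neq0 ha)) orbF pnatr_eq0 /= => /eqP.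
Qed.

Lemma root_separates a b : a != b -> exists2 c, c \in rts & dot c a != dot c b.
Proof.
move=> nab; apply: contrapT => h; case/eqP: nab.
apply: dot_inj => w; have [c ->] := roots_span w.
rewrite !dot_sumr !big_seq; apply: eq_bigr => r hr; rewrite !dotZr; congr (_ * _).
rewrite dotC (dotC b); apply/eqP/negPn/negP => ?; by apply: h; exists r.
Qed.

(** If e_b = 0 then h_b = 0, so <c, b^v> e_c = 0 and b is orthogonal to every c with e_c != 0. By
    irreducibility one vanishing root vector makes all vanish; then all weights are zero and cannot
    generate the weight lattice. *)
Lemma e_neq0 a : a \in rts -> e_ a != 0.
Proof.
move=> ha; apply/negP => ea0.
have hall : forall b, b \in rts -> e_ b == 0.
  apply: (@roots_irreducible _ Phi (fun b => e_ b == 0)); first by exists a.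
  move=> b c hb hc /eqP eb nec; apply: dot_pairing0 => //; apply/eqP.
  have := lie_cartan G hb hc; rewrite cartan_mxE eb !lie0l => /esym/eqP.
  by rewrite scaler_eq0 (negPf nec) orbF int_eq0.
have H0 i : bracket (root_vec G (Defs.simple i)) (root_vec G (- Defs.simple i)) = 0.
  have : root_vec G (Defs.simple i) == 0 by rewrite -int_mx_eq0 hall // simple_root.
  by rewrite /bracket => /eqP ->; rewrite mul0mx mulmx0 subrr.
have [k [c [l [hl h]]]] := chev_simply_connected G (fun=> 1).
have l0 j i : l j i = 0.
  have [v v0 /(_ i)] := hl j; rewrite H0 mul0mx => /esym/matrixP hv.
  apply/eqP; apply: contraNT v0 => l0; apply/eqP/matrixP => p q.
  by have /eqP := hv p q; rewrite !mxE mulf_eq0 (negPf l0) => /eqP.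
have r0 : (0 < rk Phi)%N := ltnW (rk_ge2 Phi).
have := h (Ordinal r0); rewrite big1 // => j _; by rewrite l0 mulr0.
Qed.

Lemma h_neq0 a : a \in rts -> h_ a != 0.
Proof.
move=> ha; apply/negP => /eqP h0; have := lie_cartan G ha ha.
rewrite h0 lie0l pairingxx // => /esym/eqP; rewrite scaler_eq0 (negPf (e_neq0 ha)) orbF.
by rewrite int_eq0.
Qed.

Lemma Ad_scale_inverse g a b c c' : a \in rts -> b \in rts ->
  Ad g (e_ a) = c *: e_ b -> Ad g (e_ (- a)) = c' *: e_ (- b) -> c * c' = 1.
Proof.
move=> ha hb hc hc'.
have c0 : c != 0.
  by have := e_neq0 ha; rewrite -(Ad_eq0 g) hc scaler_eq0 negb_or => /andP[].
(* Transporting [h_a, e_a] = 2 e_a by Ad g yields 2 c (c c') = 2 c. *)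
have := congr1 (Ad g) (lie_cartan G ha ha).
rewrite AdZ cartan_mxE !Ad_lie hc hc' !(lieZl, lieZr) -cartan_mxE lie_cartan //
  !pairingxx // !scalerA.
move/eqP; rewrite -subr_eq0 -scalerBl scaler_eq0 (negPf (e_neq0 hb)) orbF.
rewrite subr_eq0 => /eqP h; apply: (mulfI c0); rewrite mulr1.
apply: (mulIf (F0 1)); move: h; rewrite -[2%:~R]/(2%:R) => h.
by ring: h.
Qed.

(** The set [torus], over a field that need not be dyadic. *)
Definition split_torus : classical_sets.set G :=
  Defs.generated (fun g => exists a t, [/\ a \in rts, t != 0 & g = h_elt x_ a t]).

Definition torus_char s (z : E -> F) : Prop :=
  (forall b, b \in rts -> z b != 0 /\ Ad s (e_ b) = z b *: e_ b).

Lemma torus_charP s : split_torus s -> exists z, torus_char s z.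
Proof.
move=> hs; apply: (hs (fun s => exists z, torus_char s z)); first split.
- exists (fun=> 1) => b hb; by rewrite oner_neq0 Ad1 scale1r.
- move=> g g' [z hz] [z' hz']; exists (fun b => z b * z' b) => b hb.
  have [z0 Ez] := hz b hb; have [z0' Ez'] := hz' b hb.
  by rewrite mulf_neq0 // AdM Ez' AdZ Ez scalerA mulrC.
- move=> g [z hz]; exists (fun b => (z b)^-1) => b hb.
  have [z0 Ez] := hz b hb; rewrite invr_eq0 z0; split=> //.
  by apply: (can_inj (AdK g)); rewrite AdVK AdZ Ez scalerA mulVf // scale1r.
- move=> g [a [t [ha t0 ->]]]; exists (fun b => t ^ pairing a b) => b hb.
  by rewrite expfz_neq0 // -chev_h_elt (Ad_h F0).
Qed.

Lemma torus_h s b : split_torus s -> b \in rts -> Ad s (h_ b) = h_ b.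
Proof.
move=> /torus_charP[z hz] hb; have [z0 Ez] := hz b hb.
have [z0' Ez'] := hz _ (root_opp hb).
rewrite cartan_mxE Ad_lie Ez Ez' lieZl lieZr scalerA.
by rewrite (Ad_scale_inverse hb hb Ez Ez') scale1r.
Qed.

Lemma torus_chev_h a t : a \in rts -> t != 0 -> split_torus (hh a t).
Proof. by rewrite chev_h_elt => ha t0 K hK; apply; exists a, t. Qed.

Lemma generated_subgroup (H : groupType) (A : classical_sets.set H) : is_subgroup
  (Defs.generated A).
Proof.
split=> [K [K1 _ _] _ //|g h hg hh K hK sA|g hg K hK sA].
  by case: (hK) => _ KM _; apply: KM; [exact: hg|exact: hh].
by case: (hK) => _ _; apply; exact: hg.
Qed.

Lemma torus_subgroup : is_subgroup split_torus.
Proof. exact: generated_subgroup. Qed.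

(** The coefficients are not unique, since the h_b for b running through all roots are dependent;
    below, the whole Cartan part is therefore treated as one vector. *)
Definition in_lie X : Prop := exists c d : E -> F,
  X = \sum_(b <- rts) (c b *: e_ b + d b *: h_ b).

Lemma in_lieD t X Y : in_lie X -> in_lie Y -> in_lie (t *: X + Y).
Proof.
move=> [c [d ->]] [c' [d' ->]].
exists (fun b => t * c b + c' b), (fun b => t * d b + d' b).
rewrite scaler_sumr -big_split; apply: eq_bigr => b _ /=.
by rewrite !scalerDl scalerDr !scalerA addrACA.
Qed.

Lemma in_lie_single (c d : F) a : a \in rts -> in_lie (c *: e_ a + d *: h_ a).
Proof.
move=> ha; exists (fun b => if b == a then c else 0), (fun b => if b == a then d else 0).
rewrite (bigD1_seq a) ?roots_uniq //= eqxx big1_seq ?addr0 // => b /andP[/negPf -> _].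
by rewrite !scale0r addr0.
Qed.

Lemma in_lie_e a : a \in rts -> in_lie (e_ a).
Proof. by move=> /(in_lie_single 1 0); rewrite scale1r scale0r addr0. Qed.
Lemma in_lie_h a : a \in rts -> in_lie (h_ a).
Proof. by move=> /(in_lie_single 0 1); rewrite scale1r scale0r add0r. Qed.
Lemma in_lie0 : in_lie 0.
Proof.
exists (fun=> 0), (fun=> 0); rewrite big1 // => b _; by rewrite !scale0r addr0.
Qed.
Lemma in_lie_Ad g X : in_lie X -> in_lie (Ad g X).
Proof.
have hgen a t Y : a \in rts -> in_lie Y -> in_lie (Ad (x_ a t) Y).
  move=> ha [c [d ->]]; rewrite Ad_sum big_seq.
  elim/big_rec: _ => [|b Z hb IH]; first exact: in_lie0.
  rewrite AdD !AdZ -addrA; apply: in_lieD; last apply: in_lieD IH.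
    have hE k Z' : in_lie Z' -> in_lie (e_ b + k *: Z').
      by move=> ?; rewrite addrC; apply/in_lieD/in_lie_e.
    case E : _ / (pairingP ha hb) => [Eb|Eb|h1 h2 h3 h4|h1 h2 h3 h4|h1 h2 h3 h4].
    - by rewrite Eb (Ad_x_same F0) //; exact: in_lie_e.
    - rewrite Eb (Ad_x_opp F0) // -scaleNr addrAC addrC; apply: in_lieD;
      first exact: in_lie_h.
      by rewrite addrC; apply: in_lieD; [exact: in_lie_e|rewrite -Eb; exact: in_lie_e].
    - by rewrite (Ad_x_fix F0) //; exact: in_lie_e.
    - by rewrite (Ad_x_move F0) //; apply/hE/in_lie_e.
    - by rewrite (Ad_x_fix F0) //; exact: in_lie_e.
  rewrite (Ad_x_h F0) // -scaleNr addrC; apply: in_lieD;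
    [exact: in_lie_e|exact: in_lie_h].
move=> hX; have [s [hs ->]] := chev_generated g.
elim: s hs => [|[a t] s IH] hs; first by rewrite big_nil Ad1.
rewrite big_cons AdM; apply: hgen; first by apply: (hs (a, t)); rewrite mem_head.
by apply: IH => y hy; apply: hs; rewrite in_cons hy orbT.
Qed.

(** In characteristic zero 2 is not a root of unity, so the elements h_r(2) are enough to tell the
    weights of the torus apart. *)
Lemma two_expz (k l : int) : (2%:R : F) ^ k = 2%:R ^ l -> k = l.
Proof.
have n2 : (2%:R : F) != 0 := F0 1.
have hpos m : (2%:R : F) ^ m.+1%:Z <> 1.
  rewrite -exprnP -natrX => /eqP; rewrite -subr_eq0 -(natrB _ (expn_gt0 2 _)).
  have : (1 < 2 ^ m.+1)%N by rewrite -[1%N]/(2 ^ 0)%N ltn_exp2l.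
  by rewrite -subn_gt0; case: (_ - _)%N => // p _; rewrite (negPf (F0 p)).
move=> h; have {}h : (2%:R : F) ^ (k - l) = 1.
  by rewrite expfzDr // h -expfzDr // subrr expr0z.
apply/eqP; rewrite -subr_eq0; apply/eqP; case: (k - l) h => [[|m]|m] // h.
  by case: (hpos m).
case: (hpos m); apply: (mulIf (_ : 2%:R ^ (Negz m) != 0)); first by rewrite expfz_neq0.
by rewrite -expfzDr // h mulr1 NegzE subrr expr0z.
Qed.

Lemma torus_conj n s : Defs.normalizer split_torus n -> split_torus s ->
  split_torus (n^-1 * s * n)%g.
Proof. by move=> hn hs; apply/hn; rewrite !mulgA mulgV mul1g mulgK. Qed.

Lemma normalizerV n : Defs.normalizer split_torus n ->
  Defs.normalizer split_torus n^-1%g.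
Proof.
move=> hn g; split=> [hg|h]; first by rewrite invgK; exact: torus_conj.
by move/hn: h; rewrite invgK !mulgA mulgV mul1g mulgK.
Qed.

Lemma Ad_conj n s X : Ad s (Ad n X) = Ad n (Ad (n^-1 * s * n)%g X).
Proof. by rewrite -!AdM !mulgA mulgV mul1g. Qed.

(** Since n^-1 s n is in the torus for s in the torus, Ad n e_a is an eigenvector of each s. The
    elements h_r(2) separate the roots from each other and from the weight 0, so it lies in a single
    weight space. *)
Lemma normalizer_root n a : Defs.normalizer split_torus n -> a \in rts ->
  exists b c, [/\ b \in rts, c != 0 & Ad n (e_ a) = c *: e_ b].
Proof.
move=> hn ha; set X := Ad n (e_ a).
have X0 : X != 0 by rewrite Ad_eq0 e_neq0.
have [c [d EX]] : in_lie X by exact/in_lie_Ad/in_lie_e.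
pose v (i : option E) := if i is Some b then c b *: e_ b else \sum_(b <- rts) d b *: h_ b.
pose L := None :: map Some rts.
have EXv : X = \sum_(i <- L) v i.
  by rewrite EX big_split big_cons big_map addrC.
pose S := {b : E | b \in rts}.
pose D (r : S) (Y : M) := Ad (hh (val r) 2%:R) Y.
pose lam (r : S) (i : option E) : F := if i is Some b then 2%:R ^ pairing (val r) b
  else 1.
have n2 : (2%:R : F) != 0 := F0 1.
have hv r i : i \in L -> D r (v i) = lam r i *: v i.
  rewrite in_cons => /orP[/eqP ->|/mapP[b hb ->]] /=.
    rewrite scale1r /D Ad_sum !big_seq; apply: eq_bigr => b hb.
    by rewrite AdZ torus_h //; apply: torus_chev_h n2; exact: (valP r).
  by rewrite /D AdZ (Ad_h F0) ?(valP r) // !scalerA mulrC.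
have dist i j : i \in L -> j \in L -> i != j -> exists r, lam r i != lam r j.
  have nz b : b \in rts -> exists r, lam r None != lam r (Some b).
    move=> hb; exists (exist _ b hb); rewrite /lam /= pairingxx //.
    by apply/eqP; rewrite -(expr0z 2%:R) => /two_expz.
  rewrite !in_cons => /orP[/eqP ->|/mapP[b hb ->]] /orP[/eqP ->|/mapP[b' hb' ->]] //.
  - by move=> _; exact: nz.
  - by move=> _; have [r hr] := nz b hb; exists r; rewrite eq_sym.
  - move=> nb; have [|r hr hd] := @root_separates b b';
    first by apply: contra nb => /eqP ->.
    exists (exist _ r hr); apply: contra hd => /eqP /two_expz /= h.
    have := congr1 (fun k : int => k%:~R : R) h; rewrite !pairing_dot //.
    have dr : dot r r != 0 by rewrite dot_eq0 root_neq0.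
    have two0 : (2%:R : R) != 0 by rewrite pnatr_eq0.
    by move/(mulIf (invr_neq0 dr))/(mulfI two0) => ->.
have uL : uniq L.
  by rewrite /= map_inj_uniq ?roots_uniq ?andbT; [apply/negP => /mapP[]|exact: Some_inj].
have hX r : exists chi, D r X = chi *: X.
  have [|z hz] := @torus_charP (n^-1 * hh (val r) 2%:R * n)%g.
    by apply: torus_conj hn _; apply: torus_chev_h n2; exact: (valP r).
  by exists (z a); rewrite /D /X Ad_conj (proj2 (hz a ha)) AdZ.
have hall r chi : D r X = chi *: X -> forall i, i \in L -> (lam r i - chi) *: v i = 0.
  move=> hchi.
  (* [eigenvectors_free] wants the eigenvector equation at every index, whence the value 0 off
     [L]. *)
  pose v' i := if i \in L then (lam r i - chi) *: v i else 0.
  have : forall i, i \in L -> v' i = 0.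
    apply: (eigenvectors_free (D := D) (lam := lam)) dist uL _ => [s k Y Z|s i|].
    - by rewrite /D AdD AdZ.
    - rewrite /v'; case: ifP => [iL|_]; last by rewrite /D Ad0 scaler0.
      by rewrite {1}/D AdZ -/(D s (v i)) hv // !scalerA mulrC.
    - transitivity (D r X - chi *: X); last by rewrite hchi subrr.
      rewrite EXv /D Ad_sum scaler_sumr -sumrB !big_seq; apply: eq_bigr => i iL.
      by rewrite /v' iL scalerBl -hv.
  by move=> h i iL; have := h i iL; rewrite /v' iL.
have [i iL vi0] : exists2 i, i \in L & v i != 0.
  apply: contrapT => h; case/eqP: X0; rewrite EXv big_seq big1 // => i iL.
  by apply/eqP/negPn/negP => ?; apply: h; exists i.
have EXi : X = v i.
  rewrite EXv (bigD1_seq i) //= big1_seq ?addr0 // => j /andP[nji jL].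
  have [r hr] := dist _ _ jL iL nji; have [chi hchi] := hX r.
  have /eqP := hall _ _ hchi _ iL;
    rewrite scaler_eq0 (negPf vi0) orbF subr_eq0 => /eqP E1.
  have /eqP := hall _ _ hchi _ jL; rewrite scaler_eq0 -E1 subr_eq0 (negPf hr) /=.
  by move/eqP.
move: iL vi0 EXi; rewrite in_cons => /orP[/eqP ->|/mapP[b hb ->]] /= vi0 EXi; last first.
  by exists b, (c b); split=> //; move: vi0; rewrite scaler_eq0 negb_or => /andP[].
(* The weight 0 is impossible: the torus would fix X, while n h_a(2) n^-1 multiplies it by 4. *)
have : Ad (n * hh a 2%:R * n^-1)%g X = X.
  rewrite {1}EXi Ad_sum EXi !big_seq; apply: eq_bigr => b hb.
  by rewrite AdZ torus_h //; exact: (proj1 (hn _) (torus_chev_h ha n2)).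
rewrite /X (AdM (n * _)%g) (AdM n) AdK (Ad_h F0) // pairingxx // AdZ => /eqP.
rewrite -subr_eq0 -{2}[Ad n _]scale1r -scalerBl scaler_eq0 (negPf X0) orbF.
rewrite -[_ ^ _]/(2%:R ^+ 2) (_ : _ - _ = 3%:R) ?(negPf (F0 2)) //; ring.
Qed.

(** Ad n h_a is nonzero, fixed by the torus and proportional to [e_b, e_{b'}]. If b + b' were a
    root, h_{b+b'}(2) would multiply this bracket by 4; if it were nonzero and not a root, the
    bracket would vanish. *)
Lemma normalizer_root_opp n a b c :
  Defs.normalizer split_torus n -> a \in rts -> b \in rts -> c != 0 ->
  Ad n (e_ a) = c *: e_ b -> Ad n (e_ (- a)) = c^-1 *: e_ (- b).
Proof.
move=> hn ha hb c0 hc.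
have [b' [c' [hb' c0' hc']]] := normalizer_root hn (root_opp ha).
have nh : Ad n (h_ a) != 0 by rewrite Ad_eq0 h_neq0.
have Eh : Ad n (h_ a) = (c * c') *: lie (e_ b) (e_ b').
  by rewrite cartan_mxE Ad_lie hc hc' lieZl lieZr scalerA.
have Eb : b' = - b.
  apply/eqP; rewrite -addr_eq0 addrC; apply/negPn/negP => nbb.
  case hbb : (b + b' \in rts); last first.
    by case/eqP: nh; rewrite Eh lie_root0 ?hbb // scaler0.
  have : Ad (hh (b + b') 2%:R) (Ad n (h_ a)) = Ad n (h_ a).
    by rewrite Ad_conj torus_h //; apply: torus_conj hn _; exact: torus_chev_h.
  have EL : Ad (hh (b + b') 2%:R) (lie (e_ b) (e_ b')) = 2%:R ^ 2 *: lie (e_ b) (e_ b').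
    by rewrite lie_root // AdZ (Ad_h F0) // pairingxx // !scalerA mulrC.
  rewrite {1}Eh AdZ EL scalerA mulrC -scalerA -Eh.
  move/eqP; rewrite -subr_eq0 -{2}[Ad n _]scale1r -scalerBl scaler_eq0 (negPf nh) orbF.
  by rewrite -[_ ^ _]/(2%:R ^+ 2) (_ : _ - _ = 3%:R) ?(negPf (F0 2)) //; ring.
rewrite Eb in hc'; rewrite hc'; congr (_ *: _).
by apply: (mulfI c0); rewrite (Ad_scale_inverse ha hb hc hc') divff.
Qed.

Lemma conj_chev_x g a b c t : a \in rts -> b \in rts -> Ad g (e_ a) = c *: e_ b ->
  (g * x_ a t * g^-1)%g = x_ b (c * t).
Proof.
move=> ha hb hc; apply: (chev_mx_inj (c := G)).
rewrite !chev_mxM -/(Ad g _) !(chev_x_mexp F0) // /mexp Ad_sum; apply: eq_bigr => k _.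
rewrite AdZ; have -> : Ad g (e_ a ^+ k) = c ^+ k *: e_ b ^+ k.
  elim: (nat_of_ord k) => [|m IH]; first by rewrite !expr0 scale1r /Ad mulmx1 chev_mxV.
  by rewrite exprS Ad_mul IH hc -scalemxAl -scalemxAr scalerA !exprS.
by rewrite scalerA exprMn; congr (_ *: _); rewrite mulrC mulrA.
Qed.

Lemma conj_chev_w g a b c t : a \in rts -> b \in rts -> c != 0 -> 
  Ad g (e_ a) = c *: e_ b -> Ad g (e_ (- a)) = c^-1 *: e_ (- b) ->
  (g * w_ a t * g^-1)%g = w_ b (c * t).
Proof.
move=> ha hb c0 hc hc'; have h1 := conj_chev_x _ ha hb hc.
have h2 := conj_chev_x _ (root_opp ha) (root_opp hb) hc'.
rewrite !chev_wE /w_elt invfM -mulrN -h1 -h2.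
by rewrite !mulgA !mulgVK.
Qed.

End NormalizerTorus.

(** * Root subgroups and the affine action *)

Section RootSubgroups.
Variables (R : realType) (F : dyadic_field) (Phi : root_system R).
Variables (G : chevalley_group Phi F) (Gt : double_cover G).
Local Notation E := 'rV[R]_(rk Phi).
Local Notation rts := (Defs.roots Phi).
Local Notation x_ := (@chev_x R Phi F G).
Local Notation e_ := (@root_mx R Phi F G).
Local Notation w_ := (@chev_w R Phi F G).
Local Notation hh := (@chev_h R Phi F G).
Local Notation O := (@O_F F).
Local Notation U := (@O_units F).
Local Notation pi := (dy_unif F).
Local Notation T0 := (@T_ R F Phi G 0).
Local Notation I2 := (@I_2 R F Phi G).
Local Notation N := (Defs.normalizer (@torus R F Phi G)).
Let F0 := F_natr_neq0 F.
Implicit Types (a b : E) (g n s : G) (t u c : F).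

Lemma cov_pr1 : cov_pr (1%g : Gt) = 1%g.
Proof. by apply: (mulgI (cov_pr (1%g : Gt))); rewrite -cov_prM !mulg1. Qed.

Lemma cov_prV (g : Gt) : cov_pr g^-1%g = (cov_pr g)^-1%g.
Proof. by apply: (mulgI (cov_pr g)); rewrite -cov_prM !mulgV cov_pr1. Qed.

Lemma cov_pr_eps : cov_pr (cov_eps Gt) = 1%g.
Proof. by apply/cov_ker; right. Qed.

(** The relations are part of the data of the cover and are projected to G; the Hilbert symbol
    disappears because [cov_eps] lies in the kernel. *)
Lemma x_D a t u : a \in rts -> x_ a (t + u) = (x_ a t * x_ a u)%g.
Proof. by move=> ha; rewrite -!(cov_pr_x Gt) // -cov_prM cov_xD. Qed.

Lemma x_0 a : a \in rts -> x_ a 0 = 1%g.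
Proof. by move=> ha; apply: (mulgI (x_ a 0)); rewrite -x_D // addr0 mulg1. Qed.

Lemma x_N a t : a \in rts -> x_ a (- t) = (x_ a t)^-1%g.
Proof. by move=> ha; apply: (mulgI (x_ a t)); rewrite -x_D // subrr x_0 // mulgV. Qed.

Lemma cov_pr_w a t : a \in rts -> cov_pr (w_elt (@cov_x _ _ _ _ Gt) a t) = w_ a t.
Proof. by move=> ha; rewrite chev_wE /w_elt !cov_prM !cov_pr_x ?root_opp. Qed.

Lemma cov_pr_h a t : a \in rts -> cov_pr (h_elt (@cov_x _ _ _ _ Gt) a t) = hh a t.
Proof. by move=> ha; rewrite chev_hE /h_elt cov_prM !cov_pr_w. Qed.

Lemma chev_hM a t u : a \in rts -> t != 0 -> u != 0 ->
  (hh a t * hh a u)%g = hh a (t * u).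
Proof.
move=> ha t0 u0; rewrite -!cov_pr_h // -cov_prM cov_hilbert // cov_prM.
by case: asboolP => _; rewrite ?cov_pr1 ?cov_pr_eps mul1g.
Qed.

Lemma chev_h1 a : a \in rts -> hh a 1 = 1%g.
Proof.
move=> ha; apply: (mulgI (hh a 1)); rewrite chev_hM ?oner_neq0 //.
by rewrite mulr1 mulg1.
Qed.

Lemma chev_hV a t : a \in rts -> t != 0 -> (hh a t)^-1%g = hh a t^-1.
Proof.
move=> ha t0; apply: (mulgI (hh a t)).
by rewrite chev_hM ?invr_eq0 // divff // chev_h1 // mulgV.
Qed.

Lemma chev_wN a t : a \in rts -> w_ a (- t) = (w_ a t)^-1%g.
Proof.
move=> ha; have hNa := root_opp ha.
by rewrite !chev_wE /w_elt invrN opprK !invgM -!x_N // opprK mulgA.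
Qed.

Lemma chev_w_h a t : a \in rts -> w_ a t = (hh a t * w_ a 1)%g.
Proof. by move=> ha; rewrite chev_hE chev_wN // mulgVK. Qed.

Lemma conj_chev_h g a b c t : a \in rts -> b \in rts -> c != 0 -> t != 0 ->
  Ad g (e_ a) = c *: e_ b -> Ad g (e_ (- a)) = c^-1 *: e_ (- b) ->
  (g * hh a t * g^-1)%g = hh b t.
Proof.
move=> ha hb c0 t0 hc hc'.
have -> : (g * hh a t * g^-1 = (g * w_ a t * g^-1) * (g * w_ a (-1) * g^-1))%g.
  by rewrite chev_hE !mulgA mulgVK.
rewrite !(conj_chev_w F0 _ ha hb c0 hc hc') mulrN1 chev_wN // (chev_w_h (c * t) hb)
  (chev_w_h c hb) invgM mulgA mulgK.
by rewrite chev_hV // chev_hM ?mulf_neq0 ?invr_eq0 // mulrAC divff // mul1r.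
Qed.

Lemma conj_chev_h_x a b c t : a \in rts -> b \in rts -> c != 0 ->
  (hh a c * x_ b t * (hh a c)^-1)%g = x_ b (c ^ pairing a b * t).
Proof. by move=> ha hb c0; apply: (conj_chev_x F0) => //; exact: Ad_h. Qed.

(* In SL_2: [1 t; 0 1][1 0; y 1] = [1 0; y/c 1][1 ct; 0 1] diag(c, 1/c), c = 1 + ty. *)
Lemma x_x_opp a t y : a \in rts -> 1 + t * y != 0 ->
  (x_ a t * x_ (- a)%R y = x_ (- a)%R (y / (1 + t * y))
     * x_ a ((1 + t * y) * t) * hh a (1 + t * y))%g.
Proof.
move=> ha c0; have hNa := root_opp ha.
case: (eqVneq y 0) => [-> |y0].
  by rewrite mulr0 addr0 mul0r mul1r chev_h1 // !x_0 // !mulg1 mul1g.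
set c := 1 + t * y; pose y' := y / c.
have y0' : y' != 0 by rewrite mulf_neq0 ?invr_eq0.
have xw z : z != 0 -> x_ (- a) z = (x_ a z^-1 * w_ a (- z^-1) * x_ a z^-1)%g.
  move=> z0; rewrite chev_wE /w_elt invrN invrK opprK x_N // !mulgA mulgV mul1g.
  by rewrite mulgVK.
have E1 : t + y^-1 = y'^-1 by rewrite /y' /c; field; rewrite y0 c0.
rewrite -/y' (xw _ y0) !mulgA -x_D // E1.
have E2 : x_ a y'^-1 = (x_ (- a)%R y' * x_ a (- y'^-1) * w_ a y'^-1)%g.
  by rewrite (xw _ y0') x_N // mulgK chev_wN // mulgVK.
rewrite E2 -!mulgA; congr (_ * _)%g.
have E3 : (w_ a y'^-1 * w_ a (- y^-1) = hh a c)%g.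
  rewrite chev_wN // (chev_w_h y'^-1 ha) (chev_w_h y^-1 ha) invgM mulgA mulgK chev_hV
    ?invr_eq0 // chev_hM ?invr_eq0 //.
  by congr chev_h; rewrite invrK /y'; field; rewrite ?y0 ?oner_neq0 ?c0.
rewrite (mulgA (w_ a _)) E3.
have -> : (hh a c * x_ a y^-1 = x_ a (c ^ 2 * y^-1) * hh a c)%g.
  by rewrite -(pairingxx ha) -conj_chev_h_x // mulgVK.
rewrite mulgA -x_D //; congr (x_ a _ * _)%g.
by rewrite -[c ^ 2]/(c ^+ 2) /y' /c; field; rewrite y0 c0.
Qed.

Lemma w_torus_normalizer a t : a \in rts -> t != 0 -> N (w_ a t).
Proof.
move=> ha t0.
have dir u g : u != 0 -> torus g -> torus (w_ a u * g * (w_ a u)^-1)%g.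
  move=> u0 hg; apply: (hg (fun g => torus (w_ a u * g * (w_ a u)^-1)%g)).
    have [T1 TM TV] := torus_subgroup G; split.
    - by rewrite mulg1 mulgV.
    - move=> g1 g2 h1 h2; have := TM _ _ h1 h2.
      by rewrite !mulgA mulgVK.
    - by move=> g1 /TV; rewrite !invgM invgK mulgA.
  move=> _ [b [v [hb v0 ->]]].
  have [c c0 hc] := Ad_w F0 G ha hb u0.
  have [c' c0' hc'] := Ad_w F0 G ha (root_opp hb) u0.
  have Er : reflection a (- b) = - reflection a b by rewrite -scaleN1r reflectionZ
    scaleN1r.
  rewrite Er in hc'; have hr := roots_refl ha hb.
  have Ec : c' = c^-1.
    by apply: (mulfI c0); rewrite (Ad_scale_inverse F0 hb hr hc hc') divff.
  rewrite Ec in hc'; rewrite -chev_h_elt (conj_chev_h hb hr c0 v0 hc hc').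
  exact: torus_chev_h.
move=> g; split=> [|h]; first exact: dir.
have := dir (- t) _ _ h; rewrite oppr_eq0 chev_wN // invgK => /(_ t0).
by rewrite !mulgA mulVg mul1g mulgVK.
Qed.

Lemma torus_normalizer g : torus g -> N g.
Proof.
have [_ TM TV] := torus_subgroup G.
move=> hg h; split=> hgh; first exact: TM _ _ (TM _ _ hg hgh) (TV _ hg).
have := TM _ _ (TM _ _ (TV _ hg) hgh) hg.
by rewrite !mulgA mulVg mul1g mulgVK.
Qed.

Lemma N_M n n' : N n -> N n' -> N (n * n')%g.
Proof. by move=> hn hn' g; rewrite hn' hn invgM !mulgA. Qed.

Lemma chev_h_N a t : a \in rts -> t != 0 -> N (hh a t).
Proof. by move=> ha t0; exact: torus_normalizer (torus_chev_h ha t0). Qed.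

Lemma T0_subgroup : is_subgroup T0. Proof. exact: generated_subgroup. Qed.
Lemma I2_subgroup : is_subgroup I2. Proof. exact: generated_subgroup. Qed.

Lemma T0_chev_h a u : a \in rts -> U u -> T0 (hh a u).
Proof. by rewrite chev_h_elt => ha hu K hK; apply; exists a, u. Qed.

Variable act : G -> E -> E.
Hypothesis hact : is_affine_action act.

Lemma act_id : act 1%g = id.
Proof. by apply: (act_T0 hact); case: T0_subgroup. Qed.

Lemma act_pi a (k : int) : a \in rts ->
  act (hh a (pi ^ k)) = fun v => v - k%:~R *: coroot a.
Proof.
move=> ha; have p0 := pi_neq0 F.
have actX (m : nat) : act (hh a (pi ^ m%:Z)) = fun v => v - m%:R *: coroot a.
  elim: m => [|m IH].
    by rewrite expr0z chev_h1 // act_id; apply/funext => v; rewrite scale0r subr0.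
  have N1 := chev_h_N ha p0; have N2 := chev_h_N ha (expfz_neq0 m p0).
  rewrite exprSz -chev_hM ?expfz_neq0 // (Defs.actM hact N1 N2) IH chev_h_elt (act_h
    hact) //.
  by apply/funext => v /=; rewrite -addrA -opprD -natr1 scalerDl scale1r.
case: k => m; first exact: actX.
have q0 := expfz_neq0 m.+1 p0; have q0' := expfz_neq0 (Negz m) p0.
have := congr1 act (chev_hM ha q0 q0').
rewrite -expfzDr // {2}NegzE subrr expr0z chev_h1 // act_id.
rewrite (Defs.actM hact (chev_h_N ha q0) (chev_h_N ha q0')) actX NegzE => h.
apply/funext => v; have := congr1 (@^~ v) h; rewrite /= => /eqP.
by rewrite subr_eq => /eqP ->; rewrite rmorphN scaleNr opprK.
Qed.

(** Write w_a(t) = h_a(t) w_a(1): the unit part of t acts trivially and its valuation translates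
    along the coroot, which gives the reflection in the zero set of a + k. *)
Lemma act_wE a (k : int) u : a \in rts -> U u ->
  act (w_ a (pi ^ k * u)) = fun v => v - affine a k v *: coroot a.
Proof.
move=> ha hu; have p0 := expfz_neq0 k (pi_neq0 F); have u0 := U_neq0 hu.
have w1N := w_torus_normalizer ha (oner_neq0 F).
have N1 := chev_h_N ha p0; have N2 := chev_h_N ha u0.
rewrite chev_w_h // -chev_hM // -mulgA (Defs.actM hact N1 (N_M N2 w1N)).
rewrite (Defs.actM hact N2 w1N) (act_T0 hact (T0_chev_h ha hu)) chev_wE (act_w hact) //
  act_pi //.
by apply/funext => v /=; rewrite /reflection /affine scalerDl opprD addrA.
Qed.

Lemma act_root n f a : N n -> act n = f -> even_isometry f -> a \in rts ->
  exists b (m : int) c u, [/\ b \in rts, U u, c = pi ^ (2 * m) * u,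
    Ad n (e_ a) = c *: e_ b /\ Ad n (e_ (- a)) = c^-1 *: e_ (- b)
    & forall v, dot a v = affine b (2 * m) (f v)].
Proof.
move=> hn hf hfI ha.
have [b [c [hb c0 hc]]] := normalizer_root F0 hn ha.
have hc' := normalizer_root_opp F0 hn ha hb c0 hc.
have [k [u [hu Ec]]] := F_val c0.
have [L [L' [y [[hD hZ hK hK' hdot] hr hr' hy Ef]]]] := hfI.
have key l v : f (v - affine a l v *: coroot a) = f v - affine b (k + l) (f v) *:
  coroot b.
  have l0 := expfz_neq0 l (pi_neq0 F).
  have : (n * w_ a (pi ^ l * 1) = w_ b (pi ^ (k + l) * u) * n)%g.
    have -> : pi ^ (k + l) * u = c * (pi ^ l * 1).
      by rewrite Ec expfzDr ?pi_neq0 //; ring.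
    by rewrite -(conj_chev_w F0 _ ha hb c0 hc hc') mulgVK.
  have N1 : N (w_ a (pi ^ l * 1)) by apply: w_torus_normalizer; rewrite // mulr1.
  have N2 : N (w_ b (pi ^ (k + l) * u)).
    by apply: w_torus_normalizer; rewrite // mulf_neq0 ?expfz_neq0 ?pi_neq0 // U_neq0.
  move/(congr1 (act^~ v)); rewrite (Defs.actM hact hn N1) (Defs.actM hact N2 hn) /=.
  by rewrite hf !act_wE //; exact: U_1.
have key' l v : affine a l v *: L (coroot a) = affine b (k + l) (f v) *: coroot b.
  have := key l v; rewrite Ef -scaleNr hD hZ scaleNr addrAC => /addrI /oppr_inj.
  by [].
(* At v = 0 the right side for l = 0 vanishes, and the one for l = 1 exceeds it by exactly
   [coroot b]. *)
have EL : L (coroot a) = coroot b.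
  have := key' 1 0; have := key' 0 0; rewrite !addr0 /affine !rmorphD /= !(dotC a) dot0l.
  by rewrite !add0r scale0r scale1r addrA => h ->; rewrite scalerDl -h add0r scale1r.
have cb0 : coroot b != 0.
  rewrite scaler_eq0 mulf_eq0 invr_eq0 dot_eq0 pnatr_eq0 /= (negPf (root_neq0 hb)) //.
have Ed v : dot a v = affine b k (f v).
  have /eqP := key' 0 v; rewrite EL addr0 -subr_eq0 -scalerBl scaler_eq0 (negPf cb0) orbF.
  by rewrite subr_eq0 /affine addr0 => /eqP.
have [l hl] := hy b hb.
(* Evaluation at 0 gives k = - <b, y>, and y pairs evenly with the roots: this is where the
   valuation of c becomes even. *)
have Ek : k = 2 * - l.
  apply: (@intr_inj R); have := Ed 0; rewrite Ef /affine.
  have -> : L 0 = 0 by have := hZ 0 0; rewrite !scale0r.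
  rewrite (dotC a) dot0l add0r hl => /eqP; rewrite eq_sym addrC addr_eq0 => /eqP ->.
  by rewrite mulrN rmorphN.
by exists b, (- l), c, u; rewrite -Ek.
Qed.

Definition U_root a (k : int) g : Prop := exists2 y, O y & g = x_ a (pi ^ k * y).

Lemma U_root_conj n f a (m : int) : N n -> act n = f -> even_isometry f -> a \in rts ->
  exists b (m' : int), [/\ b \in rts, forall v, affine a (2 * m) v = affine b (2 * m')
    (f v)
    & forall g, U_root a (2 * m) g -> U_root b (2 * m') (n * g * n^-1)%g].
Proof.
move=> hn hf hfI ha.
have [b [k [c [u [hb hu Ec [hc _] hv]]]]] := act_root hn hf hfI ha.
exists b, (k + m); split=> // [v|_ [y hy ->]].
  by rewrite {1}/affine hv /affine -addrA -rmorphD mulrDr.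
exists (u * y); first exact: O_M (U_O hu) hy.
rewrite (conj_chev_x F0 _ ha hb hc) Ec mulrDr expfzDr ?pi_neq0 //; congr x_; ring.
Qed.

End RootSubgroups.

(** * The group I_2 *)

Section Iwahori.
Variables (R : realType) (F : dyadic_field) (Phi : root_system R).
Variables (G : chevalley_group Phi F) (Gt : double_cover G).
Local Notation E := 'rV[R]_(rk Phi).
Local Notation I := (option 'I_(rk Phi)).
Local Notation rts := (Defs.roots Phi).
Local Notation x_ := (@chev_x R Phi F G).
Local Notation e_ := (@root_mx R Phi F G).
Local Notation w_ := (@chev_w R Phi F G).
Local Notation hh := (@chev_h R Phi F G).
Local Notation O := (@O_F F).
Local Notation U := (@O_units F).
Local Notation pi := (dy_unif F).
Local Notation T0 := (@T_ R F Phi G 0).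
Local Notation I2 := (@I_2 R F Phi G).
Local Notation N := (Defs.normalizer (@torus R F Phi G)).
Local Notation U_root := (@U_root R F Phi G).
Local Notation pos := (@positive R Phi).
Local Notation saff := (@saff R Phi).
Local Notation sroot := (@sroot R Phi).
Local Notation gen := (@coxeter_gen R Phi).
Let F0 := F_natr_neq0 F.
Implicit Types (a b : E) (g n s u : G) (t c : F) (j : I).

Lemma aroot_affine a (m : int) : a \in rts -> @aroot R Phi (affine a (2 * m)).
Proof. by move=> ha; exists a, m. Qed.

(** These bounds match the generators U_0 and U_2^- of I_2: the level 2m is at least 0 for positive
    roots and at least 2 for negative ones. *)
Lemma positive_affine a (m : int) : a \in rts -> pos (affine a (2 * m)) ->
  nat_span (@Defs.simple R Phi) a /\ 0 <= m \/ nat_span (@Defs.simple R Phi) (- a) /\ 1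
    <= m.
Proof.
move=> ha hp; have ha' := root_opp ha.
have neg : ~ nat_comb (Phi := Phi) (affine (- a) (2 * - m)).
  move=> /(nat_comb_pos (aroot_affine _ ha')) hn.
  apply: (positive_not_negative hp) => v /hn.
  by rewrite mulrN -affineN oppr_gt0.
case: (simple_base ha) => hs; [left|right]; split=> //.
  case: (leP 0 m) => // hm; case: neg; apply: nat_comb_aroot => //; left; lia.
case: (leP 1 m) => // hm; case: neg; apply: nat_comb_aroot => //.
have [->|hm0] := eqVneq m 0; first by right; rewrite oppr0.
left; lia.
Qed.

Lemma positive_span a : a \in rts -> nat_span (@Defs.simple R Phi) a -> pos (affine a 0).
Proof.
move=> ha hs; rewrite -[0](mulr0 2); apply: nat_comb_pos; first exact: aroot_affine.
exact: nat_comb_span.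
Qed.

Lemma positive_ge1 a (m : int) : a \in rts -> 1 <= m -> pos (affine a (2 * m)).
Proof.
move=> ha hm; apply: nat_comb_pos; first exact: aroot_affine.
by apply: nat_comb_aroot => //; left.
Qed.

Lemma O_expz (k : int) : 0 <= k -> O (pi ^ k).
Proof. by case: k => // k _; rewrite -exprnP; apply/O_X/O_pi. Qed.

Lemma O_ideal_expz (k : nat) y : O y -> O_ideal k (pi ^ k%:Z * y).
Proof. by move=> hy; exists y. Qed.

Lemma U_root_le a (k l : int) g : l <= k -> U_root a k g -> U_root a l g.
Proof.
move=> hkl [y hy ->]; exists (pi ^ (k - l) * y).
  by apply: O_M => //; apply: O_expz; rewrite subr_ge0.
by rewrite mulrA -expfzDr ?pi_neq0 // addrC subrK.
Qed.

Lemma U_root_M a (k : int) g g' : a \in rts ->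
  U_root a k g -> U_root a k g' -> U_root a k (g * g')%g.
Proof.
move=> ha [y hy ->] [z hz ->]; exists (y + z); first exact: O_D.
by rewrite -(x_D Gt) // mulrDr.
Qed.

Lemma U_root_V a (k : int) g : a \in rts -> U_root a k g -> U_root a k g^-1%g.
Proof.
move=> ha [y hy ->]; exists (- y); first exact: O_N.
by rewrite -(x_N Gt) // mulrN.
Qed.

Lemma U_root_1 a (k : int) : a \in rts -> U_root a k 1%g.
Proof. by move=> ha; exists 0; rewrite ?mulr0 ?(x_0 Gt) //; exact: O_0. Qed.

Lemma I2_root a (m : int) g : a \in rts -> pos (affine a (2 * m)) ->
  U_root a (2 * m) g -> I2 g.
Proof.
move=> ha hp hg K hK sK; apply: sK.
have [[hs hm]|[hs hm]] := positive_affine ha hp.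
  left; left; have [y hy ->] : U_root a 0 g by apply: U_root_le hg; lia.
  by move=> K' hK'; apply; exists a, (pi ^ 0 * y); split=> //; apply: (@O_ideal_expz 0).
right; have [y hy ->] : U_root a 2 g by apply: U_root_le hg; lia.
move=> K' hK'; apply; exists a, (pi ^ 2 * y); split=> //; last exact: (@O_ideal_expz 2).
by split=> //; exact: root_opp.
Qed.

Lemma I2_T0 g : T0 g -> I2 g.
Proof. by move=> hg K hK sK; apply: sK; left; right. Qed.

Lemma I2_ind (P : G -> Prop) : is_subgroup P -> (forall g, T0 g -> P g) ->
  (forall a (m : int) g, a \in rts -> pos (affine a (2 * m)) -> U_root a (2 * m) g -> P
    g) ->
  forall g, I2 g -> P g.
Proof.
move=> hP hT hU g; apply=> // {}g [[hg|/hT //]|hg];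
  apply: hg => // _ [a [t [ha [y hy ->] ->]]].
  have [har hs] := ha; apply: (hU a 0) => //; first by rewrite mulr0;
    exact: positive_span.
  by exists y; rewrite // mulr0 expr0z.
have [har hs] := ha; have {}har : a \in rts by rewrite -[a]opprK root_opp.
by apply: (hU a 1) => //; [exact: positive_ge1|exists y].
Qed.

Lemma T0_root s : T0 s -> forall b, b \in rts -> exists2 z, U z & Ad s (e_ b) = z *: e_ b.
Proof.
move=> ht; apply: (ht (fun s => forall b, b \in rts -> exists2 z, U z & Ad s (e_ b) = z
  *: e_ b)).
  split=> [b hb|g g' h h' b hb|g h b hb].
  - by exists 1; [exact: U_1|rewrite Ad1 scale1r].
  - have [z hz E1] := h b hb; have [z' hz' E2] := h' b hb.
    exists (z' * z); first exact: U_M.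
    by rewrite AdM E2 AdZ E1 scalerA.
  - have [z hz E1] := h b hb; exists z^-1; first exact: U_V.
    apply: (can_inj (AdK g)); rewrite AdVK AdZ E1 scalerA mulVf ?scale1r //.
    exact: U_neq0.
move=> _ [a [u [ha hu ->]]] b hb; exists (u ^ pairing a b); first exact: U_Xz.
by rewrite -chev_h_elt Ad_h // U_neq0.
Qed.

Lemma T0_conj_root s a (k : int) g : T0 s -> a \in rts -> U_root a k g ->
  U_root a k (s * g * s^-1)%g.
Proof.
move=> ht ha [y hy ->]; have [z hz Ez] := T0_root ht ha.
exists (z * y); first exact: O_M (U_O hz) hy.
by rewrite (conj_chev_x F0 _ ha ha Ez); congr x_; ring.
Qed.

Lemma T0_conj_chev_h s a c : T0 s -> a \in rts -> c != 0 -> (s * hh a c * s^-1)%g = hh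
  a c.
Proof.
move=> ht ha c0; have [z hz Ez] := T0_root ht ha.
have [z' hz' Ez'] := T0_root ht (root_opp ha).
have z0 := U_neq0 hz.
apply: (conj_chev_h Gt ha ha z0 c0 Ez); rewrite Ez'; congr (_ *: _).
by apply: (mulfI z0); rewrite (Ad_scale_inverse F0 ha ha Ez Ez') divff.
Qed.

(** The condition met by 1 + ty in [x_x_opp] when t and y come from opposite roots in I_2. *)
Definition cong2 c : Prop := O_ideal 2 (c - 1).

Lemma cong2_U c : cong2 c -> U c.
Proof. by move=> /(O_ideal_unit (isT : (0 < 2)%N)); rewrite addrC subrK. Qed.

Lemma cong2M c d : cong2 c -> cong2 d -> cong2 (c * d).
Proof.
move=> hc [z hz Ed]; have [y hy Ec] := hc; exists (c * z + y).
  exact: O_D (O_M (U_O (cong2_U hc)) hz) hy.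
by rewrite mulrDr -Ec mulrCA -Ed; ring.
Qed.

Lemma cong2V c : cong2 c -> cong2 c^-1.
Proof.
move=> hc; have hU := cong2_U hc; have [y hy Ec] := hc; exists (- (c^-1 * y)).
  exact/O_N/O_M/hy/U_O/U_V.
have c0 := U_neq0 hU.
by rewrite mulrN mulrCA -Ec; field.
Qed.

Lemma cong2Xz c (k : int) : cong2 c -> cong2 (c ^ k).
Proof.
move=> hc; have hX (n : nat) : cong2 (c ^+ n).
  elim: n => [|p IH]; last by rewrite exprS; exact: cong2M.
  by exists 0; rewrite ?mulr0 ?expr0 ?subrr //; exact: O_0.
by case: k => p; rewrite ?NegzE -?exprnP // -exprnN; exact: cong2V.
Qed.

(** * The factorisation of I_2 at a simple affine root *)

Section Simple.
Variable j : I.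

(* All positive affine root subgroups but that of the simple affine root [j];
   the torus part is restricted to make it normalised by that subgroup. *)
Definition J_gen g : Prop :=
  (exists a (m : int), [/\ a \in rts, pos (affine a (2 * m)),
      affine a (2 * m) <> saff j & U_root a (2 * m) g]) \/
  (exists a c, [/\ a \in rts, cong2 c & g = hh a c]).
Definition J : G -> Prop := Defs.generated J_gen.
Definition U_j : G -> Prop := U_root (sroot j) (sconst j).

Lemma J_subgroup : is_subgroup J. Proof. exact: generated_subgroup. Qed.

Lemma J_root a (m : int) g : a \in rts -> pos (affine a (2 * m)) ->
  affine a (2 * m) <> saff j -> U_root a (2 * m) g -> J g.
Proof. by move=> *; move=> K hK; apply; left; exists a, m. Qed.

Lemma J_chev_h a c : a \in rts -> cong2 c -> J (hh a c).
Proof. by move=> *; move=> K hK; apply; right; exists a, c. Qed.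

Lemma J_M g g' : J g -> J g' -> J (g * g')%g.
Proof. by have [_ h _] := J_subgroup; exact: h. Qed.

Definition sconst_half : int := if j is Some _ then 0 else 1.
Lemma sconstE : sconst j = 2 * sconst_half.
Proof. by rewrite /sconst_half; case: j. Qed.

Let hr := sroot_root j.

Lemma G_comm_root a b t t' : a \in rts -> b \in rts -> a + b \in rts ->
  exists2 k : int, `|k|%N = 1%N &
    (x_ b t * x_ a t' * (x_ b t)^-1 = x_ a t' * x_ (a + b) (k%:~R * (t * t')))%g.
Proof.
move=> ha hb hab; exists (- chev_c G a b).
  by case: (chev_c_sign G ha hb hab) => ->.
have := congr1 (@cov_pr _ _ _ _ Gt) (cov_comm_root Gt t' (- t) ha hb hab).
rewrite cov_pr_x // commgEl /conjg !cov_prM !(cov_prV, cov_pr_x) // (x_N Gt) // invgK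
  => h.
apply: (mulgI (x_ a t')^-1%g); rewrite !mulgA mulVg mul1g -!mulgA in h *; rewrite h.
by congr x_; rewrite rmorphN; ring.
Qed.

Lemma G_comm1 a b t t' : a \in rts -> b \in rts -> a + b \notin rts -> a + b != 0 ->
  (x_ b t * x_ a t' * (x_ b t)^-1 = x_ a t')%g.
Proof.
move=> ha hb hab h0.
have := congr1 (@cov_pr _ _ _ _ Gt) (cov_comm1 Gt t' (- t) ha hb h0 hab).
rewrite (cov_pr1 Gt) commgEl /conjg !cov_prM !(cov_prV, cov_pr_x) // (x_N Gt) // invgK
  => h.
by apply: (mulgI (x_ a t')^-1%g); rewrite mulVg -h !mulgA.
Qed.

Lemma saffE v : saff j v = affine (sroot j) (2 * sconst_half) v.
Proof. by rewrite -sconstE. Qed.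

Lemma positiveD a b (k l : int) : pos (affine a k) -> pos (affine b l) ->
  pos (affine (a + b) (k + l)).
Proof. by move=> h1 h2 v hv; rewrite -affineD addr_gt0 ?h1 ?h2. Qed.

Lemma pos_saff : pos (affine (sroot j) (2 * sconst_half)).
Proof. by rewrite -sconstE; exact: saff_pos. Qed.

Lemma affine_neq_saff a (m : int) : (a != sroot j) || (m != sconst_half) -> affine a (2
  * m) <> saff j.
Proof.
move=> h E; have [] := @affine_inj _ _ a (sroot j) (2 * m) (2 * sconst_half).
  by move=> v; rewrite E saffE.
move=> Ea Em; move: h; rewrite Ea eqxx /=; apply/negP; rewrite negbK.
by apply/eqP; lia.
Qed.

(** The two elements commute unless a is opposite to [sroot j] or the sum of the two is a root. In
    the latter case the commutator belongs to a sum of positive affine roots, with gradient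
    different from [sroot j]. *)
Lemma U_j_conj_root u a (m : int) g : U_j u -> a \in rts -> pos (affine a (2 * m)) ->
  affine a (2 * m) <> saff j -> U_root a (2 * m) g -> J (u * g * u^-1)%g.
Proof.
move=> [y hy ->] ha hp hne hg; have hg' := hg; have [z hz Eg] := hg'.
rewrite sconstE; set t := pi ^ (2 * sconst_half) * y.
have fix_J : (x_ (sroot j) t * g * (x_ (sroot j) t)^-1)%g = g ->
    J (x_ (sroot j) t * g * (x_ (sroot j) t)^-1)%g.
  by move=> ->; apply: J_root hg.
case: (pairingP hr ha) => [Ea|Ea|h1 h2 h3 h4|h1 h2 h3 h4|h1 h2 h3 h4].
- apply: fix_J; rewrite Eg Ea -(x_D Gt) // addrC (x_D Gt) // mulgK //.
- set q := pi ^ (2 * m) * z; set c := 1 + t * q.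
  (* For opposite gradients the two positive affine roots add up to the constant 2(m + sconst_half),
     which is therefore at least 2. *)
  have hms : 1 <= m + sconst_half.
    have [v hv] := @alcove_nonempty R Phi.
    have := positiveD hp pos_saff hv; rewrite Ea addNr /affine dot0l add0r ltr0z.
    by lia.
  have Etq : t * q = pi ^ (2 * (m + sconst_half)) * (y * z).
    by rewrite /t /q mulrDr (expfzDr _ _ (pi_neq0 F)); ring.
  have [k Ek] : exists k : nat, 2 * (m + sconst_half) = 2 + k%:Z.
    by exists `|(2 * (m + sconst_half) - 2)%R|%N; lia.
  have hcong : cong2 c.
    exists (pi ^ k%:Z * (y * z)); first by apply: O_M; [exact: O_expz|exact: O_M].
    rewrite /c addrAC subrr add0r Etq Ek (expfzDr _ _ (pi_neq0 F)) -[pi ^ 2]/(pi ^+ 2).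
    by rewrite -!mulrA.
  have hU := cong2_U hcong; have c0 := U_neq0 hU.
  (* After [x_x_opp], moving h(c) past x(-t) turns it into x(-c^2 t). It merges with x(c t) into
     x(-c (t q) t), since 1 - c = -t q, and t q pushes this factor beyond [saff j]. *)
  have -> : (x_ (sroot j) t * g * (x_ (sroot j) t)^-1 =
     x_ a (q / c) * (x_ (sroot j) (- (c * (t * q) * t)) * hh (sroot j) c))%g.
    rewrite Eg Ea (x_x_opp Gt hr) -/q -/c // -!mulgA; congr (_ * _)%g.
    rewrite -(x_N Gt) // -[RHS](mulgVK (hh (sroot j) c)) -mulgA.
    have -> : (hh (sroot j) c * x_ (sroot j) (- t) = x_ (sroot j) (c ^ 2 * - t) * hh
      (sroot j) c)%g.
      by rewrite -(pairingxx hr) -conj_chev_h_x // mulgVK.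
    rewrite !mulgA -(x_D Gt) // mulgVK; congr (x_ _ _ * _)%g.
    by rewrite -[c ^ 2]/(c ^+ 2) /c; ring.
  apply: J_M; last apply: J_M.
  + apply: (J_root ha hp hne); exists (z / c); first exact/O_M/U_O/U_V.
    by rewrite /q mulrA.
  + apply: (J_root (m := sconst_half + 1) hr).
    * have -> : 2 * (sconst_half + 1) = 2 * sconst_half + 2 by lia.
      move=> v hv; have := pos_saff hv; rewrite /affine rmorphD /= addrA => h.
      by rewrite addr_gt0 // ltr0z.
    * by apply: affine_neq_saff; apply/orP; right; lia.
    * apply: (@U_root_le _ (2 * sconst_half + 2 * (m + sconst_half))); first by lia.
      exists (- (c * (y * z) * y)).
        by apply/O_N/O_M => //; apply: O_M; [exact: U_O|exact: O_M].
      by rewrite (expfzDr _ _ (pi_neq0 F)) Etq /t; congr x_; ring.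
  + exact: J_chev_h.
- apply: fix_J; rewrite Eg; apply: G_comm1 => //; by rewrite addrC.
- have h1' : a + sroot j \in rts by rewrite addrC.
  rewrite Eg; have [k _ ->] := G_comm_root t (pi ^ (2 * m) * z) ha hr h1'.
  apply: J_M; first by apply: J_root hp hne _ => //; exists z.
  apply: (J_root (m := m + sconst_half) h1').
  + by rewrite mulrDr; apply: positiveD hp pos_saff.
  + apply: affine_neq_saff; apply/orP; left; apply: contraNneq (root_neq0 ha) => h.
    by apply/eqP/(addIr (sroot j)); rewrite h add0r.
  + exists (k%:~R * (y * z)).
      by apply: O_M; [case: (k) => p; rewrite ?NegzE ?rmorphN; [|apply: O_N];
        exact: O_nat|exact: O_M].
    by rewrite mulrDr (expfzDr _ _ (pi_neq0 F)) /t; congr x_; ring.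
- apply: fix_J; rewrite Eg; apply: G_comm1 => //; by rewrite addrC.
Qed.

Lemma J_ind (P : G -> Prop) : is_subgroup P -> (forall g, J_gen g -> P g) ->
  forall g, J g -> P g.
Proof. by move=> hP h g hg; apply: hg. Qed.

Lemma conj_subgroup (K : G -> Prop) u : is_subgroup K ->
  is_subgroup (fun g => K (u * g * u^-1)%g).
Proof.
move=> [K1 KM KV]; split=> [|g h hg hh|g /KV].
- by rewrite mulg1 mulgV.
- by have := KM _ _ hg hh; rewrite !mulgA mulgVK.
- by rewrite !invgM invgK mulgA.
Qed.

(** For a torus generator h_a(c), conjugation adds a factor x((1 - c^k) t); 1 - c^k is divisible by
    the square of the uniformizer, so this factor belongs to the affine root [saff j] + 2. *)
Lemma U_j_conj_J u g : U_j u -> J g -> J (u * g * u^-1)%g.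
Proof.
move=> hu hg; apply: (J_ind (P := fun g => J (u * g * u^-1)%g)) hg;
  first exact/conj_subgroup/J_subgroup.
move=> {}g [[a [m [ha hp hne hg]]]|[a [c [ha hc ->]]]]; first exact: U_j_conj_root hg.
have [y hy ->] := hu.
have c0 := U_neq0 (cong2_U hc).
have -> : (x_ (sroot j) (pi ^ sconst j * y) * hh a c * (x_ (sroot j) (pi ^ sconst j *
  y))^-1 =
   x_ (sroot j) ((1 - c ^ pairing a (sroot j)) * (pi ^ sconst j * y)) * hh a c)%g.
  rewrite mulrBl mul1r (x_D Gt) // -!mulgA; congr (_ * _)%g.
  rewrite -!(x_N Gt) // -[LHS](mulgVK (hh a c)) conj_chev_h_x //; congr (x_ _ _ * _)%g.
  by rewrite mulrN.
apply: J_M; last exact: J_chev_h.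
have [z hz Ez] := cong2Xz (pairing a (sroot j)) hc.
apply: (J_root (m := sconst_half + 1) hr).
- have -> : 2 * (sconst_half + 1) = 2 * sconst_half + 2 by lia.
  move=> v hv; have := pos_saff hv; rewrite /affine rmorphD /= addrA => h.
  by rewrite addr_gt0 // ltr0z.
- by apply: affine_neq_saff; apply/orP; right; lia.
- exists (- (z * y)); first exact/O_N/O_M.
  rewrite mulrDr (expfzDr _ _ (pi_neq0 F)) -sconstE; congr x_.
  by rewrite -opprB Ez -[pi ^ (2 * 1)]/(pi ^+ 2); ring.
Qed.

Lemma T0_conj_J s g : T0 s -> J g -> J (s * g * s^-1)%g.
Proof.
move=> hs hg; apply: (J_ind (P := fun g => J (s * g * s^-1)%g)) hg;
  first exact/conj_subgroup/J_subgroup.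
move=> {}g [[a [m [ha hp hne hg]]]|[a [c [ha hc ->]]]].
  by apply: (J_root ha hp hne); exact: T0_conj_root.
by rewrite T0_conj_chev_h ?(U_neq0 (cong2_U hc)) //; exact: J_chev_h.
Qed.

(** T_0 normalises U_j and J, and U_j normalises J, so the triple products form a subgroup; it
    contains the generators of I_2. *)
Lemma I2_factor g : I2 g -> exists u s z, [/\ U_j u, T0 s, J z & g = (u * s * z)%g].
Proof.
have [_ TM TV] := T0_subgroup G; have [J1 JM JV] := J_subgroup.
have T1 : T0 1%g by case: (T0_subgroup G).
have U1 : U_j 1%g by exact: U_root_1.
apply: (I2_ind (P := fun g => exists u s z, [/\ U_j u, T0 s, J z & g = (u * s * z)%g])).
- split; first by exists 1%g, 1%g, 1%g; rewrite !mulg1.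
  + move=> _ _ [u [s [z [hu hs hz ->]]]] [u' [s' [z' [hu' hs' hz' ->]]]].
    pose p := (u' * s')%g.
    have hzp : J (p^-1 * z * p)%g.
      rewrite /p invgM -!mulgA mulgA -!mulgA.
      have -> : (s'^-1 * (u'^-1 * (z * (u' * s'))) = s'^-1 * (u'^-1 * z * (u'^-1)^-1) *
        (s'^-1)^-1)%g.
        by rewrite !invgK !mulgA.
      by apply: T0_conj_J (TV _ hs') _; apply: U_j_conj_J hz; exact: U_root_V.
    exists (u * (s * u' * s^-1))%g, (s * s')%g, (p^-1 * z * p * z')%g; split.
    * by apply: U_root_M => //; exact: T0_conj_root.
    * exact: TM.
    * exact: JM.
    * by rewrite /p invgM !mulgA mulgVK !mulgK.
  + move=> _ [u [s [z [hu hs hz ->]]]].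
    exists (s^-1 * u^-1 * (s^-1)^-1)%g, s^-1%g, (u * s * z^-1 * (u * s)^-1)%g; split.
    * by apply: T0_conj_root; [exact: TV|exact: hr|exact: U_root_V].
    * exact: TV.
    * have -> : (u * s * z^-1 * (u * s)^-1 = u * (s * z^-1 * s^-1) * u^-1)%g.
        by rewrite invgM !mulgA.
      by apply: U_j_conj_J => //; apply: T0_conj_J => //; exact: JV.
    * by rewrite !invgM invgK !mulgA mulgK mulgVK mulVg mul1g.
- by move=> g1 hg; exists 1%g, g1, 1%g; rewrite mul1g mulg1.
- move=> a m g1 ha hp hg; case: (pselect (affine a (2 * m) = saff j)) => [E|hne].
    exists g1, 1%g, 1%g; rewrite !mulg1; split=> //.
    have [] := @affine_inj _ _ a (sroot j) (2 * m) (sconst j).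
      by move=> v; rewrite E.
    by rewrite /U_j => <- <-.
  by exists 1%g, 1%g, g1; rewrite !mul1g; split=> //; exact: J_root hg.
Qed.

End Simple.
End Iwahori.

(** * Products of double cosets *)

Section DoubleCosets.
Variables (R : realType) (F : dyadic_field) (Phi : root_system R).
Variables (G : chevalley_group Phi F) (Gt : double_cover G).
Local Notation E := 'rV[R]_(rk Phi).
Local Notation I := (option 'I_(rk Phi)).
Local Notation rts := (Defs.roots Phi).
Local Notation hh := (@chev_h R Phi F G).
Local Notation pi := (dy_unif F).
Local Notation T0 := (@T_ R F Phi G 0).
Local Notation I2 := (@I_2 R F Phi G).
Local Notation N := (Defs.normalizer (@torus R F Phi G)).
Local Notation U_root := (@U_root R F Phi G).
Local Notation J := (@J R F Phi G).
Local Notation pos := (@positive R Phi).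
Local Notation saff := (@saff R Phi).
Local Notation sroot := (@sroot R Phi).
Local Notation gen := (@coxeter_gen R Phi).
Let F0 := F_natr_neq0 F.
Implicit Types (a b : E) (g n s u : G) (t c : F) (j : I) (f : E -> E).

Variable act : G -> E -> E.
Hypothesis hact : is_affine_action act.

(** For [None] this is w_{alpha_0}(varpi^2). The factor 1 is the unit expected by [act_wE]. *)
Definition simple_rep j : G := chev_w G (sroot j) (pi ^ sconst j * 1).

Lemma simple_rep_N j : N (simple_rep j).
Proof.
apply: (w_torus_normalizer Gt (sroot_root j)).
by rewrite mulr1 expfz_neq0 ?pi_neq0.
Qed.

Lemma act_simple_rep j : act (simple_rep j) = gen j.
Proof.
rewrite /simple_rep (act_wE Gt hact) ?sroot_root //; last exact: U_1.
by apply/funext => v; rewrite coxeter_genE.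
Qed.

Lemma actV n f f' : N n -> act n = f -> cancel f' f -> act n^-1%g = f'.
Proof.
move=> hn hf K; have hn' := normalizerV hn.
have : act (n^-1 * n)%g = id by rewrite mulVg (act_id hact).
rewrite (Defs.actM hact hn' hn) hf => h.
by apply/funext => v; have := congr1 (@^~ (f' v)) h; rewrite /= K.
Qed.

Lemma conj_T0 n f g : N n -> act n = f -> even_isometry f -> T0 g -> T0 (n * g * n^-1)%g.
Proof.
move=> hn hf hfI hg; apply: (hg (fun g => T0 (n * g * n^-1)%g)).
  exact/conj_subgroup/T0_subgroup.
move=> _ [a [u [ha hu ->]]]; rewrite -chev_h_elt.
have [b [k [c [u' [hb hu' Ec [hc hc'] _]]]]] := act_root Gt hact hn hf hfI ha.
have c0 : c != 0 by rewrite Ec mulf_neq0 ?expfz_neq0 ?pi_neq0 ?(U_neq0 hu').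
by rewrite (conj_chev_h Gt ha hb c0 (U_neq0 hu) hc hc'); exact: T0_chev_h.
Qed.

Lemma conj_root_I2 n f (g' : E -> E) a (m : int) g : N n -> act n = f -> even_isometry
  f ->
  cancel g' f -> a \in rts -> pos (affine a (2 * m) \o g') ->
  U_root a (2 * m) g -> I2 (n * g * n^-1)%g.
Proof.
move=> hn hf hfI K ha hp hg.
have [b [m' [hb Eb hU]]] := U_root_conj Gt hact m hn hf hfI ha.
by apply: (I2_root hb) (hU _ hg) => v /hp; rewrite /= Eb K.
Qed.

Lemma conj_I2 n f g : N n -> act n = f -> even_isometry f -> alcove_stable f ->
  I2 g -> I2 (n * g * n^-1)%g.
Proof.
move=> hn hf hfI st; have [g' [_ K K']] := even_isometry_inv hfI.
apply: (I2_ind (P := fun g => I2 (n * g * n^-1)%g)).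
- exact/conj_subgroup/I2_subgroup.
- by move=> t /(conj_T0 hn hf hfI)/I2_T0.
- move=> a m u ha hp; apply: (conj_root_I2 hn hf hfI K' ha) => v hv.
  by apply/hp/st; rewrite K'.
Qed.

(** By [simple_refl_negative], the reflection keeps every positive affine root other than [saff j]
    positive. *)
Lemma conj_J_I2 j z : J j z -> I2 ((simple_rep j)^-1 * z * simple_rep j)%g.
Proof.
have hn := normalizerV (simple_rep_N j);
  have hf := actV (simple_rep_N j) (act_simple_rep j) (@genK R Phi j).
have hI := @gen_isometry R Phi j.
rewrite -[X in I2 (_ * _ * X)%g]invgK => hz.
apply: (J_ind (P := fun z => I2 ((simple_rep j)^-1 * z * (simple_rep j)^-1^-1)%g)) hz.
  exact/conj_subgroup/I2_subgroup.
move=> {}z [[a [m [ha hp hne hg]]]|[a [c [ha hc ->]]]]; last first.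
  by apply: I2_T0; apply: (conj_T0 hn hf hI); exact: T0_chev_h (cong2_U hc).
apply: (conj_root_I2 hn hf hI (@genK R Phi j) ha _ hg).
have ar := aroot_affine m ha; have ar' := aroot_comp hI ar.
case: (aroot_pos_neg ar') => // hneg.
by case: hne; apply: (simple_refl_negative ar hp ar' hneg).
Qed.

Lemma I2_step n f j g : N n -> act n = f -> even_isometry f ->
  (forall f', cancel f f' -> cancel f' f -> pos (saff j \o f')) -> I2 g ->
  exists i1 i2, [/\ I2 i1, I2 i2 & (n * g * simple_rep j = i1 * (n * simple_rep j) *
    i2)%g].
Proof.
move=> hn hf hfI hp /(I2_factor Gt j)[u [s [z [hu hs hz ->]]]].
have [f' [_ K K']] := even_isometry_inv hfI.
exists (n * u * n^-1)%g, (((simple_rep j)^-1 * s * (simple_rep j)^-1^-1) * ((simple_rep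
  j)^-1 * z * simple_rep j))%g; split.
- have := conj_root_I2 (m := sconst_half j) hn hf hfI K' (sroot_root j) _ (g := u).
  rewrite -sconstE; apply=> //; exact: hp.
- have hf' := actV (simple_rep_N j) (act_simple_rep j) (@genK R Phi j).
  have hs' := conj_T0 (normalizerV (simple_rep_N j)) hf' (@gen_isometry R Phi j) hs.
  have [_ IM _] := I2_subgroup G; exact: IM _ _ (I2_T0 hs') (conj_J_I2 hz).
- by rewrite invgK !mulgA !mulgVK !mulgK.
Qed.

Definition word_rep (w : seq I) : G := foldr (fun j g => simple_rep j * g)%g 1%g w.

Lemma word_rep_N w : N (word_rep w) /\ act (word_rep w) = @word_value R Phi w.
Proof.
elim: w => [|j w [IH1 IH2]] /=.
  by rewrite (act_id hact); split=> // g; rewrite invg1 mulg1 mul1g.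
rewrite (Defs.actM hact (simple_rep_N j) IH1) act_simple_rep IH2; split=> //.
exact: N_M (simple_rep_N j) IH1.
Qed.

Lemma I2_word n f w g : N n -> act n = f -> even_isometry f ->
  increasing f w -> I2 g ->
  exists i1 i2, [/\ I2 i1, I2 i2 & (n * g * word_rep w = i1 * (n * word_rep w) * i2)%g].
Proof.
have [I1 IM _] := I2_subgroup G.
elim: w n f g => [|j w IH] n f g hn hf hfI /=.
  by move=> _ hg; exists 1%g, g; rewrite !mulg1 mul1g.
move=> [hp hw] hg; have [i1 [i2 [h1 h2 E1]]] := I2_step hn hf hfI hp hg.
have hfj : act (n * simple_rep j)%g = f \o gen j by rewrite (Defs.actM hact hn
  (simple_rep_N j)) hf act_simple_rep.
have hI := even_isometry_comp hfI (@gen_isometry R Phi j).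
have [i3 [i4 [h3 h4 E2]]] := IH _ _ _ (N_M hn (simple_rep_N j)) hfj hI hw h2.
exists (i1 * i3)%g, i4; split=> //; first exact: IM.
by rewrite mulgA E1 -2!mulgA (mulgA (n * _)%g) E2 !mulgA.
Qed.

(** The representative n2 need not be a product of simple ones. Its quotient m by [word_rep t] acts
    through the alcove stabiliser, so conjugation by m^-1 maps I_2 into itself, and n1 g n2 = (n1
    m)(m^-1 g m) word_rep t reduces the claim to [I2_word]. *)
Lemma I2_double_coset n1 n2 w1 w2 l1 l2 g : N n1 -> N n2 ->
  act n1 = w1 -> act n2 = w2 -> W_ea w1 -> W_ea w2 ->
  length_ea w1 l1 -> length_ea w2 l2 -> length_ea (w1 \o w2) (l1 + l2)%N -> I2 g ->
  exists i1 i2, [/\ I2 i1, I2 i2 & (n1 * g * n2 = i1 * (n1 * n2) * i2)%g].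
Proof.
move=> hn1 hn2 hf1 hf2 hw1 hw2 hl1 hl2 hl12 hg.
have [w [t [hw Ew2 inc]]] := length_additive hl1 hl2 hl12.
have [Nt act_t] := word_rep_N t.
pose m := (n2 * (word_rep t)^-1)%g.
have hm : N m by apply: N_M hn2 _; exact: normalizerV.
have Em : act m = w.
  rewrite /m (Defs.actM hact hn2 (normalizerV Nt)) hf2 Ew2.
  rewrite (actV (f' := @word_value R Phi (rev t)) Nt act_t); last exact: word_revK'.
  by apply/funext => v /=; rewrite word_revK'.
have E2 : n2 = (m * word_rep t)%g by rewrite /m mulgVK.
clearbody m; have wI := W_ea_isometry (proj1 hw).
have hg' : I2 (m^-1 * g * m)%g.
  have [w' [w'I K K']] := even_isometry_inv wI.
  have st' : alcove_stable w' by move=> v; rewrite -(Omega_stable hw) K'.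
  rewrite -[X in (_ * _ * X)%g]invgK.
  exact: conj_I2 (normalizerV hm) (actV hm Em K') w'I st' hg.
have Nn1 := N_M hn1 hm.
have act_n1 : act (n1 * m)%g = w1 \o w by rewrite (Defs.actM hact hn1 hm) hf1 Em.
have I1 := even_isometry_comp (W_ea_isometry hw1) wI.
have [i1 [i2 [h1 h2 Ei]]] := I2_word Nn1 act_n1 I1 inc hg'.
exists i1, i2; split=> //.
have <- : (n1 * m * word_rep t = n1 * n2)%g by rewrite E2 mulgA.
by rewrite -Ei [in LHS]E2 !mulgA mulgK.
Qed.

End DoubleCosets.

(** * The splitting over Gamma(2e) *)

Section Cover.
Variables (R : realType) (F : dyadic_field) (Phi : root_system R).
Variables (G : chevalley_group Phi F) (Gt : double_cover G).
Local Notation rts := (Defs.roots Phi).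
Local Notation hh := (@chev_h R Phi F G).
Local Notation I2 := (@I_2 R F Phi G).
Local Notation It := (@tilde R F Phi G Gt I2).
Local Notation Kt := (@tilde R F Phi G Gt (@K_ R F Phi G)).
Local Notation Gam := (@sGamma R F Phi G Gt (ram2 F)).
Implicit Types (g h k : Gt).

Lemma tilde_subgroup (S : G -> Prop) : is_subgroup S -> is_subgroup (@tilde R F Phi G
  Gt S).
Proof.
move=> [S1 SM SV]; split=> [|g h hg hh|g hg]; rewrite /tilde /=.
- by rewrite (cov_pr1 Gt).
- by rewrite cov_prM; exact: SM.
- by rewrite cov_prV; exact: SV.
Qed.

Lemma It_subgroup : is_subgroup It.
Proof. exact/tilde_subgroup/I2_subgroup. Qed.

Lemma Kt_subgroup : is_subgroup Kt.
Proof. exact/tilde_subgroup/generated_subgroup. Qed.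

Lemma K_x a t : a \in rts -> O_F t -> @K_ R F Phi G (chev_x G a t).
Proof.
move=> ha ht K hK; apply; exists a, t; split=> //.
by exists t; rewrite // expr0 mul1r.
Qed.

Lemma I2_K (g : G) : I2 g -> @K_ R F Phi G g.
Proof.
have Ks : is_subgroup (@K_ R F Phi G) by exact: generated_subgroup.
have [_ KM _] := Ks.
have Kw a u : a \in rts -> O_units u -> @K_ R F Phi G (chev_w G a u).
  move=> ha hu; rewrite chev_wE /w_elt.
  apply: (KM); [apply: (KM)|]; apply: K_x; rewrite ?root_opp //; try exact: U_O.
  exact/O_N/U_O/U_V.
apply: (I2_ind (P := @K_ R F Phi G) Ks) => [{}g hg|a m {}g ha hp [y hy ->]].
  apply: (hg _ Ks) => _ [a [u [ha hu ->]]]; rewrite -chev_h_elt chev_hE.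
  by apply: KM; apply: Kw => //; apply/U_N/U_1.
apply: K_x => //; apply: O_M => //; apply: O_expz.
by have [[_ ?]|[_ ?]] := positive_affine ha hp; lia.
Qed.

Lemma ram2_ge2 : (2 <= ram2 F)%N.
Proof. by rewrite /ram2 mul2n -addnn; have := ram_gt0 F; lia. Qed.

Lemma Gam_It k : Gam k -> It k.
Proof.
have [_ IM _] := I2_subgroup G.
have hU (A : 'rV[R]_(rk Phi) -> Prop) g :
    (forall a, A a -> a \in rts) ->
    (forall a t, A a -> O_ideal (ram2 F) t -> I2 (chev_x G a t)) ->
    Defs.generated (root_gens (@cov_x R F Phi G Gt) A (ram2 F)) g -> It g.
  move=> hA hx hg; apply: (hg _ It_subgroup) => _ [a [t [ha ht ->]]].
  by rewrite /tilde /= cov_pr_x ?hA //; exact: hx.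
have root_pos a : @pos_roots R Phi a -> a \in rts by case.
have root_neg a : @neg_roots R Phi a -> a \in rts.
  by move=> [h _]; rewrite -[a]opprK root_opp.
have ideal l t : (l <= ram2 F)%N -> O_ideal (ram2 F) t -> O_ideal (F := F) l t.
  move=> hl [y hy ->]; exists (dy_unif F ^+ (ram2 F - l) * y).
    by apply: O_M => //; apply/O_X/O_pi.
  by rewrite mulrA -exprD subnKC.
move=> [u [t [v [hu [a ha ->] hv ->]]]]; rewrite /tilde /= !cov_prM.
apply: (IM); first apply: (IM).
- apply: (hU _ _ root_neg _ hu) => b s hb hs K hK sK; apply: sK; right.
  by move=> K' hK'; apply; exists b, s; split=> //; apply: ideal hs; exact: ram2_ge2.
- apply: I2_T0; have [T1 TM _] := T0_subgroup G.
  have : forall r : seq 'I_(rk Phi), @T_ R F Phi G 0 (cov_pr (\prod_(i <- r) h_elt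
    (@cov_x R F Phi G Gt) (Defs.simple i) (a i))%g).
    elim=> [|i r IH]; first by rewrite big_nil (cov_pr1 Gt).
    rewrite big_cons cov_prM; apply: TM IH; rewrite cov_pr_h ?simple_root //.
    apply: T0_chev_h; first exact: simple_root.
    have := ha i; have := ram2_ge2; case: (ram2 F) => // m _ /= hi.
    by rewrite -[a i](subrK 1) addrC; apply: O_ideal_unit hi.
  exact.
- apply: (hU _ _ root_pos _ hv) => b s hb hs K hK sK; apply: sK; left; left.
  by move=> K' hK'; apply; exists b, s; split=> //; apply: ideal hs.
Qed.

Lemma It_Kt g : It g -> Kt g. Proof. exact: I2_K. Qed.

Section Quotient.
Variables (gT : finGroupType) (q : Gt -> gT).
Hypothesis hq : is_finite_quotient q.

Lemma quotient_map1 : q 1%g = 1%g.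
Proof.
have [K1 _ _] := Kt_subgroup; apply: (mulgI (q 1%g)).
by rewrite -(fq_M hq) // !mulg1.
Qed.

Lemma Gam_q g : Gam g <-> Kt g /\ q g = 1%g.
Proof.
split=> [hg|[h1 h2]]; last exact/(fq_ker hq).
by have hK := It_Kt (Gam_It hg); split=> //; apply/(fq_ker hq).
Qed.

(** Gamma(2e) is the kernel of q on K~, so closure comes from the finite quotient instead of the
    factorisation u^- t u^+. *)
Lemma Gam_subgroup : is_subgroup Gam.
Proof.
have [K1 KM KV] := Kt_subgroup; split.
- by apply/Gam_q; rewrite quotient_map1.
- move=> g h /Gam_q[h1 e1] /Gam_q[h2 e2]; apply/Gam_q; split; first exact: KM.
  by rewrite (fq_M hq) // e1 e2 mulg1.
- move=> g /Gam_q[h1 e1]; apply/Gam_q; split; first exact: KV.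
  by apply: (mulgI (q g)); rewrite -(fq_M hq) ?mulgV ?quotient_map1 ?e1 ?mulg1 //;
    exact: KV.
Qed.

(** On Gamma(2e) sigma is rho(1), which fixes every tensor [th a v]; the uniqueness clause of the
    universal property then forces rho(1) to be the identity. *)
Lemma sigma_Gam (V : vectType (complex R)) (tau : Gt -> 'End(V))
  (S : vectType (complex R)) (sigma : Gt -> 'End(S)) k :
  is_sigma2 q tau sigma -> Gam k -> sigma k = \1%VF.
Proof.
move=> [tauf [rho [_ [th [hb huniv hrho]] hs]]] hk.
have [hK qk] := proj1 (Gam_q k) hk; have hI := Gam_It hk.
rewrite (hs _ hI) qk.
have h1 : 1%g \in image_set q It.
  by rewrite inE; apply/asboolP; exists k.
have [f [_ uf]] := huniv S th hb.
apply/lfunP => x; rewrite id_lfunE.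
have E1 : f = rho 1%g.
  apply: uf; split; first exact: linearP.
  move=> a v ha; rewrite hrho //; congr (th _ v).
  apply/ffunP => y; rewrite ffunE (bigD1 1%g) //= ffunE eqxx mul1r invg1 mul1g.
  by rewrite big1 ?addr0 // => z /negPf nz; rewrite ffunE nz mul0r.
have E2 : f = id by apply: uf; split.
by rewrite -[RHS]/(id x) -E2 E1.
Qed.

End Quotient.
End Cover.

(** * Haar integrals as finite sums *)

Section Integration.
Variables (R : realType) (F : dyadic_field) (Phi : root_system R).
Variables (G : chevalley_group Phi F) (Gt : double_cover G).
Local Notation C := (complex R).
Local Notation Gam := (@sGamma R F Phi G Gt (ram2 F)).
Hypothesis Gam_sub : is_subgroup Gam.
Variable haar : (Gt -> C) -> C.
Hypothesis hhaar : is_haar haar.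
Implicit Types (g h k x : Gt) (S : Gt -> Prop) (X : seq Gt).

Lemma coset_open x : cover_open (fun g => Gam (x^-1 * g)%g).
Proof.
move=> g hg; exists (ram2 F) => // k hk; have [_ GM _] := Gam_sub.
by rewrite mulgA; exact: GM.
Qed.

Lemma compact_translate S x : cover_compact S -> cover_compact (fun g => S (x^-1 * g)%g).
Proof.
move=> hS J V hV sV.
have [|g hg|s hs] := hS J (fun j g => V j (x * g)%g).
- by move=> j g hg; have [m hm h] := hV j _ hg; exists m => // k /h; rewrite mulgA.
- by have [|j _ hj] := sV (x * g)%g; [rewrite /= mulKg|exists j].
- by exists s => g /hs[j js]; rewrite mulKVg; exists j.
Qed.

Lemma compact_union X (S : Gt -> Gt -> Prop) :
  (forall x, x \in X -> cover_compact (S x)) ->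
  cover_compact (fun g => exists2 x, x \in X & S x g).
Proof.
elim: X => [|x X IH] hS J V hV sV; first by exists [::] => g [].
have [|s hs] := hS x (mem_head _ _) J V hV.
  by move=> g hg; apply: sV; exists x; rewrite ?mem_head.
have hX : cover_compact (fun g => exists2 y, y \in X & S y g).
  by apply: IH => y hy; apply: hS; rewrite in_cons hy orbT.
have [|s' hs'] := hX J V hV.
  by move=> g [y hy hg]; apply: sV; exists y; rewrite // in_cons hy orbT.
exists (s ++ s') => g [y]; rewrite in_cons => /orP[/eqP ->|hy] hg.
  by have [j js hj] := hs g hg; exists j; rewrite // mem_cat js.
by have [|j js hj] := hs' g; [exists y|exists j; rewrite // mem_cat js orbT].
Qed.

(** The cosets of Gamma(2e) are open, so finitely many suffice; the list is pruned until they are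
    disjoint, which makes their indicator functions usable for sums. *)
Lemma compact_cosets S : cover_compact S ->
  exists X, (forall x y g, x \in X -> y \in X ->
      Gam (x^-1 * g)%g -> Gam (y^-1 * g)%g -> x = y) /\
    uniq X /\ forall g, S g -> exists2 x, x \in X & Gam (x^-1 * g)%g.
Proof.
have [G1 GM GV] := Gam_sub.
move=> hS; have [|g _|s hs] := hS Gt (fun x g => Gam (x^-1 * g)%g).
- exact: coset_open.
- by exists g; rewrite // mulVg.
have [X [dis uX cov]] : exists X, [/\ forall x y g, x \in X -> y \in X ->
      Gam (x^-1 * g)%g -> Gam (y^-1 * g)%g -> x = y, uniq X
    & forall z, z \in s -> exists2 x, x \in X & Gam (x^-1 * z)%g].
  elim: s {hs} => [|z s [X [dis uX cov]]]; first by exists [::].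
  case: (pselect (exists2 x, x \in X & Gam (x^-1 * z)%g)) => [hz|hz].
    by exists X; split=> // y; rewrite in_cons => /orP[/eqP ->|/cov].
  have ne x g : x \in X -> Gam (x^-1 * g)%g -> Gam (z^-1 * g)%g -> False.
    move=> hx h1 h2; apply: hz; exists x => //.
    have := GM _ _ h1 (GV _ h2); rewrite invgM invgK !mulgA mulgK.
    by [].
  exists (z :: X); split.
  - move=> x y g; rewrite !in_cons => /orP[/eqP ->|hx] /orP[/eqP ->|hy] // h1 h2.
    + by case: (ne y g).
    + by case: (ne x g).
    + exact: dis hx hy h1 h2.
  - rewrite /= uX andbT; apply/negP => zX; case: (ne z z zX); rewrite mulVg //.
  - move=> y; rewrite in_cons => /orP[/eqP ->|/cov[x hx hy]].
      by exists z; rewrite ?mem_head // mulVg.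
    by exists x; rewrite // in_cons hx orbT.
exists X; split=> //; split=> // g /hs[z zs hz]; have [x hx hxz] := cov z zs.
by exists x => //; have := GM _ _ hxz hz; rewrite -mulgA mulKVg.
Qed.

Definition right_inv (V : Type) (f : Gt -> V) := forall g k, Gam k -> f (g * k)%g = f g.
Definition supported (V : zmodType) S (f : Gt -> V) := forall g, ~ S g -> f g = 0.

Lemma right_inv_smooth (V : zmodType) S (f : Gt -> V) :
  right_inv f -> cover_compact S -> supported S f -> Cc_smooth f.
Proof.
move=> hf hS sf; split; last by exists S.
move=> g; exists (fun h => Gam (g^-1 * h)%g); first split.
- exact: coset_open.
- by rewrite mulVg; case: Gam_sub.
- by move=> h /(hf g); rewrite mulKVg.
Qed.

Lemma smooth_supp (V : zmodType) (f : Gt -> V) : Cc_smooth f ->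
  exists2 S, cover_compact S & supported S f.
Proof. by case. Qed.

Lemma supp_nonzero (V : zmodType) S (f : Gt -> V) g : supported S f -> f g <> 0 -> S g.
Proof. by move=> sf h; apply: contrapT => /sf. Qed.

Lemma haar0 : haar (fun=> 0) = 0.
Proof.
have h0 : Cc_smooth (fun _ : Gt => 0 : C).
  apply: (right_inv_smooth (S := fun=> False)) => // J V hV _; exists [::];
    by move=> g [].
have := haar_linear hhaar 1 h0 h0; rewrite mulr0 addr0 mul1r => h.
by apply: (addrI (haar (fun=> 0))); rewrite addr0 -h.
Qed.

Lemma vint0 (V : vectType C) : vint haar (fun=> 0 : V) = 0.
Proof.
rewrite /vint big1 // => i _.
have -> : (fun h : Gt => coord (vbasis fullv) i (0 : V)) = fun=> 0.
  by apply/funext => h; rewrite linear0.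
by rewrite haar0 scale0r.
Qed.

Lemma vint_translate (V : vectType C) S (f : Gt -> V) x :
  right_inv f -> cover_compact S -> supported S f ->
  vint haar (fun h => f (x * h)%g) = vint haar f.
Proof.
move=> hf hS sf; apply: eq_bigr => i _; congr (_ *: _).
apply: (haar_invariant hhaar x (f := fun h => coord (vbasis fullv) i (f h))).
apply: (right_inv_smooth _ hS); first by move=> g k hk; rewrite hf.
by move=> g /sf ->; rewrite linear0.
Qed.

(** The indicator of Gamma(2e) can only be integrated once it is known to vanish outside a compact
    set; [hecke_Gam_compact] provides one. *)
Variable S0 : Gt -> Prop.
Hypothesis S0_compact : cover_compact S0.
Hypothesis Gam_S0 : forall k, Gam k -> S0 k.

Definition sGamma_ind g : C := if `[< Gam g >] then 1 else 0.

Lemma sGamma_ind_inv x : right_inv (fun h => sGamma_ind (x^-1 * h)%g).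
Proof.
have [_ GM GV] := Gam_sub.
move=> g k hk; rewrite /sGamma_ind; congr (if _ then _ else _).
apply/asbool_equiv_eq; split=> h; last by rewrite mulgA; exact: GM.
by have := GM _ _ h (GV _ hk); rewrite !mulgA mulgK.
Qed.

Lemma sGamma_ind_supp x : supported (fun g => S0 (x^-1 * g)%g) (fun h => sGamma_ind
  (x^-1 * h)%g).
Proof. by move=> g hg; rewrite /sGamma_ind; case: asboolP => // /Gam_S0. Qed.

Lemma haar_sGamma_ind x : haar (fun h => sGamma_ind (x^-1 * h)%g) = haar sGamma_ind.
Proof.
have := haar_invariant hhaar x
  (right_inv_smooth (@sGamma_ind_inv x) (compact_translate (x := x) S0_compact)
    (@sGamma_ind_supp x)) => <-.
by congr haar; apply/funext => h; rewrite mulKg.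
Qed.

Lemma haar_sum_ind X (c : Gt -> C) :
  haar (fun h => \sum_(x <- X) c x * sGamma_ind (x^-1 * h)%g) = \sum_(x <- X) c x *
    haar sGamma_ind.
Proof.
elim: X => [|x X IH].
  rewrite big_nil -[RHS]haar0; congr haar; apply/funext => h; exact: big_nil.
have -> : (fun h => \sum_(y <- x :: X) c y * sGamma_ind (y^-1 * h)%g) =
    (fun h => c x * sGamma_ind (x^-1 * h)%g + \sum_(y <- X) c y * sGamma_ind (y^-1 *
      h)%g).
  by apply/funext => h; rewrite big_cons.
rewrite (haar_linear hhaar) ?haar_sGamma_ind ?big_cons ?IH //.
  exact: right_inv_smooth (@sGamma_ind_inv x) (compact_translate (x := x) S0_compact)
    (@sGamma_ind_supp x).
apply: (@right_inv_smooth _ (fun g => exists2 y, y \in X & S0 (y^-1 * g)%g)).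
- by move=> g k hk; apply: eq_bigr => y _; rewrite (sGamma_ind_inv y).
- by apply: compact_union => y _; exact: compact_translate.
- move=> g hg; rewrite big_seq big1 // => y hy.
  by rewrite (sGamma_ind_supp (x := y)) ?mulr0 // => ?; apply: hg; exists y.
Qed.

(* The integral of a right [Gam]-invariant function is a sum over coset
   representatives which only depend on its support. *)
Lemma vint_sum S : cover_compact S -> exists X, forall (V : vectType C) (f : Gt -> V),
  right_inv f -> supported S f -> vint haar f = haar sGamma_ind *: \sum_(x <- X) f x.
Proof.
move=> hS; have [X [dis [uX cov]]] := compact_cosets hS; exists X => V f hf sf.
have E i h : coord (vbasis fullv) i (f h) = \sum_(x <- X) coord (vbasis fullv) i (f x)
  * sGamma_ind (x^-1 * h)%g.
  case: (pselect (exists2 x, x \in X & Gam (x^-1 * h)%g)) => [[x hx hxh]|hn].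
    rewrite (bigD1_seq x) //= big1_seq => [|y /andP[nyx hy]].
      rewrite /sGamma_ind asboolT // mulr1 addr0.
      by have := hf x _ hxh; rewrite mulKVg => ->.
    rewrite /sGamma_ind asboolF ?mulr0 // => hyh.
    by move: nyx; rewrite (dis _ _ _ hy hx hyh hxh) eqxx.
  rewrite sf => [|/cov //]; rewrite linear0 big_seq big1 // => x hx.
  by rewrite /sGamma_ind asboolF ?mulr0 // => hxh; apply: hn; exists x.
rewrite /vint scaler_sumr [RHS](eq_bigr (fun x => \sum_(i < \dim {:V}) (coord (vbasis
  {:V}) i (f x) * haar sGamma_ind) *: (vbasis {:V})`_i)).
  rewrite exchange_big /=; apply: eq_bigr => i _; rewrite -scaler_suml; congr (_ *: _).
  rewrite -haar_sum_ind; congr haar; exact/funext.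
move=> x _; rewrite {1}(coord_vbasis (memvf (f x))) scaler_sumr.
by apply: eq_bigr => i _; rewrite scalerA mulrC.
Qed.

End Integration.

(** * Convolution *)

Section Convolution.
Variables (R : realType) (F : dyadic_field) (Phi : root_system R).
Variables (G : chevalley_group Phi F) (Gt : double_cover G).
Local Notation C := (complex R).
Local Notation Gam := (@sGamma R F Phi G Gt (ram2 F)).
Local Notation It := (@tilde R F Phi G Gt (@I_2 R F Phi G)).
Hypothesis Gam_sub : is_subgroup Gam.
Variable haar : (Gt -> C) -> C.
Hypothesis hhaar : is_haar haar.
Variables (S : vectType C) (sigma : Gt -> 'End(S)).
Hypothesis sigma_triv : forall k, Gam k -> sigma k = \1%VF.
Implicit Types (g h k x : Gt) (f : Gt -> 'End(Defs.dual S)).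
Local Notation sv := (contragredient sigma).
Local Notation conv := (convolution haar).
Local Notation hecke := (hecke sigma).
Local Notation "f \oV g" := (comp_lfun f g) (at level 50).

Lemma sv_Gam k : Gam k -> sv k = \1%VF.
Proof.
move=> hk; have hk' : Gam k^-1%g by case: Gam_sub => _ _; apply.
rewrite /contragredient (sigma_triv hk').
have -> : (fun l : Defs.dual S => (l \o \1)%VF : Defs.dual S) = id.
  by apply/funext => l; rewrite comp_lfun1r.
by apply/lfunP => l; rewrite !(lfunE idfun).
Qed.

Lemma Gam1 : Gam 1%g. Proof. by case: Gam_sub. Qed.
Lemma It1 : It 1%g. Proof. exact: Gam_It Gam1. Qed.

Lemma hecke_right f : hecke f -> right_inv f.
Proof.
move=> [_ hf] g k hk; have := hf 1%g g k It1 (Gam_It hk).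
by rewrite mul1g (sv_Gam Gam1) (sv_Gam hk) comp_lfun1l comp_lfun1r.
Qed.

Lemma hecke_left f g k : hecke f -> Gam k -> f (k * g)%g = f g.
Proof.
move=> [_ hf] hk; have := hf k g 1%g (Gam_It hk) It1.
by rewrite mulg1 (sv_Gam Gam1) (sv_Gam hk) comp_lfun1l comp_lfun1r.
Qed.

Lemma hecke_l f g k : hecke f -> It k -> f (k * g)%g = sv k \oV f g.
Proof.
move=> [_ hf] hk; have := hf k g 1%g hk It1.
by rewrite mulg1 (sv_Gam Gam1) comp_lfun1r.
Qed.

Lemma hecke_r f g k : hecke f -> It k -> f (g * k)%g = f g \oV sv k.
Proof.
move=> [_ hf] hk; have := hf 1%g g k It1 hk.
by rewrite mul1g (sv_Gam Gam1) comp_lfun1l.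
Qed.

Lemma hecke_compact f : hecke f -> exists2 T, cover_compact T & supported T f.
Proof. by case=> /smooth_supp. Qed.

Lemma comp_suml (I : Type) (r : seq I) (A : I -> 'End(Defs.dual S)) (B : 'End(Defs.dual
  S)) :
  (\sum_(i <- r) A i) \oV B = \sum_(i <- r) (A i \oV B).
Proof.
apply: (big_morph (fun A => A \oV B)) => [X Y|]; first exact: comp_lfunDl.
exact: comp_lfun0l.
Qed.

Lemma comp_sumr (I : Type) (r : seq I) (A : I -> 'End(Defs.dual S)) (B : 'End(Defs.dual
  S)) :
  B \oV (\sum_(i <- r) A i) = \sum_(i <- r) (B \oV A i).
Proof.
apply: (big_morph (fun A => B \oV A)) => [X Y|]; first exact: comp_lfunDr.
exact: comp_lfun0r.
Qed.

Lemma integrand_inv f1 f2 g : right_inv f1 ->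
  (forall h k, Gam k -> f2 (k * h)%g = f2 h) ->
  right_inv (fun h => f1 h \oV f2 (h^-1 * g)%g).
Proof.
move=> h1 h2 h k hk; rewrite h1 // invgM -mulgA h2 //.
by case: Gam_sub => _ _; apply.
Qed.

Lemma integrand_supp T f1 f2 g : supported T f1 ->
  supported T (fun h => f1 h \oV f2 (h^-1 * g)%g).
Proof. by move=> sf h /sf ->; rewrite comp_lfun0l. Qed.

(** f is constant on g Gamma(2e), so this coset lies in any compact set outside which f vanishes;
    translate by g^-1. *)
Lemma hecke_Gam_compact f g : hecke f -> f g <> 0 ->
  exists2 T, cover_compact T & forall k, Gam k -> T k.
Proof.
move=> hf hg; have [T cT sT] := hecke_compact hf.
exists (fun k => T (g^-1^-1 * k)%g); first exact: compact_translate.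
by move=> k hk; rewrite invgK; apply: (supp_nonzero sT); rewrite hecke_right.
Qed.

Lemma conv0l f : conv (fun=> 0) f = fun=> 0.
Proof.
apply/funext => g; rewrite /convolution;
  under [X in vint _ X]funext do rewrite comp_lfun0l.
exact: vint0.
Qed.

Lemma conv0r f : conv f (fun=> 0) = fun=> 0.
Proof.
apply/funext => g; rewrite /convolution;
  under [X in vint _ X]funext do rewrite comp_lfun0r.
exact: vint0.
Qed.

Variable S0 : Gt -> Prop.
Hypothesis S0_compact : cover_compact S0.
Hypothesis Gam_S0 : forall k, Gam k -> S0 k.

(** The list X depends neither on the functions nor on g, so sums over it can be interchanged with
    other integrals. *)
Lemma conv_sum T : cover_compact T -> exists X : seq Gt, forall f1 f2 g,
  right_inv f1 -> supported T f1 -> (forall h k, Gam k -> f2 (k * h)%g = f2 h) ->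
  conv f1 f2 g = haar (@sGamma_ind R F Phi G Gt) *: \sum_(x <- X) (f1 x \oV f2 (x^-1 *
    g)%g).
Proof.
move=> hT; have [X hX] := vint_sum Gam_sub hhaar S0_compact Gam_S0 hT.
by exists X => f1 f2 g i1 s1 i2; apply: hX; [exact: integrand_inv|exact: integrand_supp].
Qed.

Lemma conv_hecke f1 f2 : hecke f1 -> hecke f2 -> hecke (conv f1 f2).
Proof.
move=> h1 h2; have [T1 c1 s1] := hecke_compact h1; have [T2 c2 s2] := hecke_compact h2.
have [X hX] := conv_sum c1.
have i1 := hecke_right h1; have i2 h k := hecke_left h h2 (k := k).
have hX' g := hX f1 f2 g i1 s1 i2.
split.
  apply: (@right_inv_smooth _ _ _ _ _ Gam_sub _ (fun g => exists2 x, x \in X & T2 (x^-1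
    * g)%g)).
  - move=> g k hk; rewrite !hX'; congr (_ *: _); apply: eq_bigr => x _.
    by rewrite mulgA (hecke_right h2).
  - by apply: compact_union => x _; exact: compact_translate.
  - move=> g hg; rewrite hX' big_seq big1 ?scaler0 // => x hx.
    by rewrite s2 ?comp_lfun0r // => ?; apply: hg; exists x.
move=> k1 g k2 hk1 hk2.
have [Y hY] := vint_sum Gam_sub hhaar S0_compact Gam_S0 c1.
pose psi h := f1 h \oV f2 (h^-1 * g)%g.
have ip : right_inv psi := integrand_inv g i1 i2.
have sp : supported T1 psi := integrand_supp f2 g s1.
(* Substituting k1 h for h brings k1 out on the left through f1 and cancels it inside f2. *)
rewrite /convolution -(vint_translate Gam_sub hhaar k1 (integrand_inv (k1 * g * k2)%g
  i1 i2) c1 (integrand_supp f2 _ s1)).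
have -> : (fun h => f1 (k1 * h)%g \oV f2 ((k1 * h)^-1 * (k1 * g * k2))%g) =
    (fun h => sv k1 \oV psi h \oV sv k2).
  apply/funext => h; rewrite (hecke_l _ h1) // invgM -!mulgA mulKg !mulgA.
  by rewrite (hecke_r _ h2) // /psi !comp_lfunA.
rewrite -[X in _ = sv k1 \oV X \oV _]/(vint haar psi) (hY _ psi ip sp).
rewrite (hY _ (fun h => sv k1 \oV psi h \oV sv k2)).
- by rewrite -comp_lfunZr -comp_lfunZl comp_sumr comp_suml.
- by move=> h k hk; rewrite ip.
- by move=> h /sp ->; rewrite comp_lfun0r comp_lfun0l.
Qed.

(** Fubini for finite sums. Translating the inner integral by x makes all the inner integrands
    vanish outside one compact set T, so a single list Y serves for every x and the two sums can be
    exchanged. *)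
Lemma conv_assoc f1 f2 f3 : hecke f1 -> hecke f2 -> hecke f3 ->
  conv f1 (conv f2 f3) = conv (conv f1 f2) f3.
Proof.
move=> h1 h2 h3; have [T1 c1 s1] := hecke_compact h1; have [T2 c2 s2] := hecke_compact h2.
have [X hX] := conv_sum c1.
have i1 := hecke_right h1; have i2 := hecke_right h2.
have l2 h k := hecke_left h h2 (k := k); have l3 h k := hecke_left h h3 (k := k).
have h23 := conv_hecke h2 h3; have l23 h k := hecke_left h h23 (k := k).
apply/funext => g; rewrite (hX _ _ g i1 s1 l23).
pose T g := exists2 x, x \in X & T2 (x^-1 * g)%g.
have cT : cover_compact T by apply: compact_union => x _; exact: compact_translate.
have [Y hY] := vint_sum Gam_sub hhaar S0_compact Gam_S0 cT.
pose psi x h := f2 (x^-1 * h)%g \oV f3 (h^-1 * g)%g.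
have ip x : right_inv (psi x).
  move=> h k hk; rewrite /psi mulgA i2 // invgM -mulgA l3 //.
  by case: Gam_sub => _ _; apply.
have sp x : x \in X -> supported T (psi x).
  by move=> hx h hT; rewrite /psi s2 ?comp_lfun0l // => ?; apply: hT; exists x.
have E x : x \in X -> conv f2 f3 (x^-1 * g)%g = vint haar (psi x).
  move=> hx; rewrite -(vint_translate Gam_sub hhaar x (ip x) cT (sp x hx)).
  congr vint; apply/funext => h; rewrite /psi mulKg invgM; congr (_ \oV f3 _).
  by rewrite mulgA.
rewrite [conv (conv f1 f2) f3]/convolution.
have -> : (fun h => conv f1 f2 h \oV f3 (h^-1 * g)%g) =
    (fun h => haar (@sGamma_ind R F Phi G Gt) *: \sum_(x <- X) (f1 x \oV psi x h)).
  apply/funext => h; rewrite (hX _ _ h i1 s1 l2) -comp_lfunZl comp_suml.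
  by congr (_ *: _); apply: eq_bigr => x _; rewrite comp_lfunA.
rewrite (hY _ (fun h => haar (@sGamma_ind R F Phi G Gt) *: \sum_(x <- X) (f1 x \oV psi
  x h))).
- congr (_ *: _); rewrite -scaler_sumr exchange_big /= scaler_sumr !big_seq.
  apply: eq_bigr => x hx; rewrite E // (hY _ _ (ip x) (sp x hx)).
  by rewrite -comp_lfunZr comp_sumr.
- by move=> h k hk; congr (_ *: _); apply: eq_bigr => x _; rewrite ip.
- move=> h hT; rewrite big_seq big1 ?scaler0 // => x hx.
  by rewrite (sp x hx) ?comp_lfun0r.
Qed.

End Convolution.

(** * The product of t_{w_1} and t_{w_2} *)

Lemma normalizer_pr (R : realType) (F : dyadic_field) (Phi : root_system R)
  (G : chevalley_group Phi F) (Gt : double_cover G) (n : Gt) :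
  Defs.normalizer (tilde (@torus R F Phi G)) n ->
  Defs.normalizer (@torus R F Phi G) (cov_pr n).
Proof.
move=> hn g; have [h <-] := cov_pr_surj Gt g.
by have := hn h; rewrite /tilde /= !cov_prM cov_prV.
Qed.

Theorem proposition6p27
  (R : realType) (F : dyadic_field) (Phi : root_system R)
  (G : chevalley_group Phi F) (Gt : double_cover G)
  (gT : finGroupType) (q : Gt -> gT) (hq : is_finite_quotient q)
  (V : vectType (complex R)) (tau : Gt -> 'End(V))
  (htau : pseudo_spherical tau)
  (S : vectType (complex R)) (sigma2 : Gt -> 'End(S))
  (hsigma2 : is_sigma2 q tau sigma2)
  (haar : (Gt -> complex R) -> complex R) (hhaar : is_haar haar)
  (act : G -> 'rV[R]_(rk Phi) -> 'rV[R]_(rk Phi))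
  (hact : is_affine_action act)
  (t : ('rV[R]_(rk Phi) -> 'rV[R]_(rk Phi)) -> Gt -> 'End(dual S))
  (ht : forall w, @W_ea R Phi w -> spans_hecke_supp sigma2 act w (t w))
  (w1 w2 : 'rV[R]_(rk Phi) -> 'rV[R]_(rk Phi))
  (hw1 : @W_ea R Phi w1) (hw2 : @W_ea R Phi w2)
  (l1 l2 : nat) (hl1 : length_ea w1 l1) (hl2 : length_ea w2 l2)
  (hl12 : length_ea (w1 \o w2) (l1 + l2)%N) :
  exists C12 : complex R,
    convolution haar (t w1) (t w2) = (fun g => C12 *: t (w1 \o w2) g) /\
    (hecke_invertible sigma2 haar (t w1) ->
     (exists g, t w2 g <> 0) -> C12 != 0).
Proof.
have Gs := Gam_subgroup hq; have triv k := sigma_Gam hq hsigma2 (k := k).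
have [[h1 [n1 [hn1 act_id] supp1]] _] := ht _ hw1.
have [[h2 [n2 [hn2 act2] supp2]] _] := ht _ hw2.
have [_ span] := ht _ (W_ea_comp hw1 hw2).
(* A nonzero value of t_{w_1} is needed to obtain the compact set around Gamma(2e). If t_{w_1} = 0,
   the constant 0 works, and invertibility would make the unit, hence t_{w_2}, vanish. *)
case: (pselect (exists g, t w1 g <> 0)) => [[g0 hg0]|hz]; last first.
  have z1 : t w1 = fun=> 0.
    by apply/funext => g; apply: contrapT => ?; apply: hz; exists g.
  exists 0; split.
    by rewrite z1 (conv0l Gs hhaar); apply/funext => g; rewrite scale0r.
  move=> [_ [one [f [[_ hone] _ _ Ef]]]] [g hg].
  by case: hg; rewrite -(proj1 (hone _ h2)) -Ef z1 (conv0r Gs hhaar) (conv0l Gs hhaar).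
have [S0 cS0 GS0] := hecke_Gam_compact Gs triv h1 hg0.
have h12 := conv_hecke Gs hhaar triv cS0 GS0 h1 h2.
have [|c Ec] := span (convolution haar (t w1) (t w2)).
  have N1 := normalizer_pr hn1; have N2 := normalizer_pr hn2.
  split=> //; exists (n1 * n2)%g.
    split; last by rewrite cov_prM (Defs.actM hact N1 N2) act_id act2.
    by move=> g; rewrite hn2 hn1 invgM !mulgA.
  move=> g hg; have [T1 c1 s1] := hecke_compact h1.
  have [X hX] := conv_sum Gs hhaar S cS0 GS0 c1.
  rewrite (hX _ _ g (hecke_right Gs triv h1) s1 (fun h k hk => hecke_left Gs triv h h2
    hk)).
  rewrite big1 ?scaler0 // => x _.
  case: (pselect (t w1 x = 0)) => [->|nx]; first by rewrite comp_lfun0l.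
  case: (pselect (t w2 (x^-1 * g)%g = 0)) => [->|ny]; first by rewrite comp_lfun0r.
  case: hg.
  have [k1 [k2 [hk1 hk2 Ex]]] := contrapT (fun h => nx (supp1 x h)).
  have [k3 [k4 [hk3 hk4 Ey]]] := contrapT (fun h => ny (supp2 _ h)).
  have [_ IM _] := I2_subgroup G.
  have hk23 : I_2 (cov_pr k2 * cov_pr k3)%g by exact: IM.
  have [i1 [i2 [hi1 hi2 Ei]]] :=
    I2_double_coset Gt hact N1 N2 act_id act2 hw1 hw2 hl1 hl2 hl12 hk23.
  (* Only the projection of g is controlled. Take any lift j of i1 and let the right factor be
     whatever makes the equation hold in the cover: it absorbs the sign, and its membership in I_2~
     depends only on its projection. *)
  have [j Ej] := cov_pr_surj Gt i1.
  have Eg : g = (k1 * (n1 * (k2 * k3) * n2) * k4)%g.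
    by rewrite -[g](mulKVg x) Ey Ex !mulgA.
  exists (k1 * j)%g, ((j * (n1 * n2))^-1 * (n1 * (k2 * k3) * n2) * k4)%g; split.
  - by rewrite /tilde /= cov_prM Ej; exact: IM.
  - by rewrite /tilde /= !(cov_prM, cov_prV) Ej Ei mulKg; exact: IM.
  - rewrite Eg; move: (n1 * n2)%g (n1 * _ * n2)%g => n z.
    by rewrite -!mulgA (mulgA j n) mulKVg.
exists c; split=> // -[_ [one [f [[_ hone] hf _ Ef]]]] [g hg].
apply/eqP => c0; case: hg.
rewrite -(proj1 (hone _ h2)) -Ef -(conv_assoc Gs hhaar triv cS0 GS0 hf h1 h2) Ec c0.
have -> : (fun h => 0 *: t (w1 \o w2) h) = fun=> 0 by apply/funext => h; rewrite scale0r.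
by rewrite (conv0r Gs hhaar).
Qed.
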